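(* For every $m\ge 3$ the kernel of $\varphi(4,m):\mathcal{F}(4,m)\to\mathbb{C}[V^m]^{D_8}$ is minimally generated as a $GL$-ideal by the four elements $\mathcal{R}_{2,2,2}$, $\mathcal{R}(4)_{4,2}$, $\mathcal{R}(4)_{6,2}$, $\mathcal{R}(4)_{4,4}$, where (writing only the first three index entries, the remaining ones being $0$) $$\mathcal{R}_{2,2,2}=\det\begin{pmatrix}\rho_{2,0,0}&\rho_{1,1,0}&\rho_{1,0,1}\\ \rho_{1,1,0}&\rho_{0,2,0}&\rho_{0,1,1}\\ \rho_{1,0,1}&\rho_{0,1,1}&\rho_{0,0,2}\end{pmatrix},$$ $$\mathcal{R}(4)_{4,2}=\pi_{4,0,0}\rho_{0,2,0}-2\pi_{3,1,0}\rho_{1,1,0}+\pi_{2,2,0}\rho_{2,0,0},$$ $$\mathcal{R}(4)_{6,2}=-\pi_{3,1,0}^2+\pi_{4,0,0}\pi_{2,2,0}-4\rho_{2,0,0}^2(\rho_{1,1,0}^2-\rho_{2,0,0}\rho_{0,2,0}),$$ $$\mathcal{R}(4)_{4,4}=3\pi_{2,2,0}^2+\pi_{4,0,0}\pi_{0,4,0}-4\pi_{3,1,0}\pi_{1,3,0}-16(\rho_{1,1,0}^2-\rho_{2,0,0}\rho_{0,2,0})^2.$$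
   Context: Let $\omega\in\mathbb{C}$ be a primitive $4$th root of $1$, and $D_{8}\subset GL_2(\mathbb{C})$ the dihedral group of order $8$ generated by $\begin{pmatrix}\omega&0\\0&\omega^{-1}\end{pmatrix}$ and $\begin{pmatrix}0&1\\1&0\end{pmatrix}$. It acts on $V=\mathbb{C}^2$ and diagonally on $V^m$. Let $x_i,y_i$ be the first and second coordinate of the $i$th vector component, so $\mathbb{C}[V^m]=\mathbb{C}[x_1,y_1,\dots,x_m,y_m]$; $\mathbb{C}[V^m]^{D_{8}}$ is the algebra of invariants. For $\beta\in\mathbb{N}_0^m$ with $\sum\beta_i=4$ put $p_\beta=x_1^{\beta_1}\cdots x_m^{\beta_m}+y_1^{\beta_1}\cdots y_m^{\beta_m}$. For $\alpha\in\mathbb{N}_0^m$ with $\sum\alpha_i=2$ put $q_\alpha=x_iy_i$ if $\alpha_i=2$, and $q_\alpha=\frac12(x_iy_j+y_ix_j)$ if $\alpha_i=\alpha_j=1$, $i\neq j$. The $p_\beta$ and $q_\alpha$ form a minimal homogeneous generating system of $\mathbb{C}[V^m]^{D_{8}}$. $\mathcal{F}(4,m)=\mathbb{C}[\rho_\alpha,\pi_\beta\mid \alpha,\beta\in\mathbb{N}_0^m,\ \sum\alpha_i=2,\ \sum\beta_j=4]$ is the polynomial ring, graded by $\deg\rho_\alpha=2$, $\deg\pi_\beta=4$, and $\varphi(4,m):\mathcal{F}(4,m)\to\mathbb{C}[V^m]^{D_{8}}$ is the surjective graded algebra homomorphism with $\rho_\alpha\mapsto q_\alpha$, $\pi_\beta\mapsto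 p_\beta$. $GL_m(\mathbb{C})$ acts on $\mathbb{C}[V^m]$ by algebra automorphisms with $g\cdot x_j=\sum_i g_{ij}x_i$, $g\cdot y_j=\sum_i g_{ij}y_i$. The spans of $\{q_\alpha\}$ and of $\{p_\beta\}$ are $GL_m(\mathbb{C})$-stable; transporting the action along $\rho_\alpha\leftrightarrow q_\alpha$, $\pi_\beta\leftrightarrow p_\beta$ and extending by algebra automorphisms gives the action on $\mathcal{F}(4,m)$, and $\varphi(4,m)$ is equivariant. A $GL$-ideal is a $GL_m(\mathbb{C})$-stable ideal. Elements $r_1,\dots,r_s$ minimally generate a $GL$-ideal $I$ as a $GL$-ideal if each $r_i$ generates an irreducible $GL_m(\mathbb{C})$-submodule, the sum of these submodules is direct, and this sum is a minimal generating subspace of the ideal $I$ (it generates $I$ as an ideal and no proper subspace of it does). *)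

(* Defs.v *)
From HB Require Import structures.
From mathcomp Require Import all_boot all_order all_algebra.
From mathcomp Require Import mpoly complex.
From mathcomp Require Import boolp classical_sets reals.

Set Implicit Arguments.
Unset Strict Implicit.
Unset Printing Implicit Defensive.

Import GRing.Theory Num.Theory.

Local Open Scope ring_scope.

Definition mx_of_rows (A : nmodType) (n : nat) (rows : seq (seq A)) : 'M[A]_n :=
  \matrix_(i < n, j < n) nth 0 (nth [::] rows i) j.

(* The homomorphism of K-algebras K[X_0, .., X_(n-1)] -> A with X_i |-> h i. *)
Definition subst (K : fieldType) (n : nat) (A : comAlgType K) (h : 'I_n -> A)
  : {mpoly K[n]} -> A := mmap (in_alg A) h.

Section Subst.
Variables (K : fieldType) (n : nat) (A : comAlgType K) (h : 'I_n -> A).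

HB.instance Definition _ := GRing.RMorphism.on (subst h).

Lemma substZ c f : subst h (c *: f) = c *: subst h f.
Proof. by rewrite /subst mmapZ mulr_algl. Qed.

HB.instance Definition _ :=
  GRing.isScalable.Build K {mpoly K[n]} A *:%R (subst h) substZ.

Lemma substX i : subst h 'X_i = h i.
Proof. by rewrite /subst mmapX mmap1U. Qed.

End Subst.

Lemma subst_comp (K : fieldType) (n : nat) (A B : comAlgType K)
    (u : {lrmorphism A -> B}) (h : 'I_n -> A) f :
  u (subst h f) = subst (u \o h) f.
Proof.
rewrite /subst /mmap raddf_sum; apply: eq_bigr => M _.
rewrite /= [in LHS]mulr_algl [in RHS]mulr_algl linearZ rmorph_prod; congr (_ *: _).
by apply: eq_bigr => i _; rewrite rmorphXn.
Qed.

Section Invariants.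
Variables (K : numClosedFieldType) (w : K) (m : nat).

(* K[V^m]: the variables x_1, .., x_m come first, then y_1, .., y_m. *)
Notation KV := {mpoly K[m + m]}.

Definition xvar (i : 'I_m) : KV := 'X_(lshift m i).
Definition yvar (i : 'I_m) : KV := 'X_(rshift m i).

Definition on_xy (T : Type) (hx hy : 'I_m -> T) (k : 'I_(m + m)) : T :=
  match split k with inl i => hx i | inr i => hy i end.

Lemma on_xyx T (hx hy : 'I_m -> T) i : on_xy hx hy (lshift m i) = hx i.
Proof. by rewrite /on_xy (unsplitK (inl i)). Qed.

Lemma on_xyy T (hx hy : 'I_m -> T) i : on_xy hx hy (rshift m i) = hy i.
Proof. by rewrite /on_xy (unsplitK (inr i)). Qed.

Definition rotation : 'M[K]_2 := mx_of_rows 2 [:: [:: w; 0]; [:: 0; w^-1]].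
Definition reflection : 'M[K]_2 := mx_of_rows 2 [:: [:: 0; 1]; [:: 1; 0]].

Inductive dihedral : 'M[K]_2 -> Prop :=
| dihedral_rot : dihedral rotation
| dihedral_refl : dihedral reflection
| dihedral_one : dihedral 1%:M
| dihedral_mul d e : dihedral d -> dihedral e -> dihedral (d *m e)
| dihedral_inv d : dihedral d -> dihedral (invmx d).

(* f |-> (v |-> f (d v)); precomposing with d^-1 instead gives the usual left
   action, and a group has the same invariants either way. *)
Definition precomp (d : 'M[K]_2) : KV -> KV :=
  subst (on_xy (fun i => d 0 0 *: xvar i + d 0 1 *: yvar i)
               (fun i => d 1 0 *: xvar i + d 1 1 *: yvar i)).

Definition invariant : {pred KV} :=
  fun f => `[< forall d, dihedral d -> precomp d f = f >].

Lemma invariant_subalg : subalg_closed invariant.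
Proof.
split.
- by apply/asboolP => d _; rewrite /precomp rmorph1.
- move=> c u v /asboolP hu /asboolP hv; apply/asboolP => d dd.
  by rewrite /precomp linearP /= -/(precomp d u) -/(precomp d v) hu ?hv.
- move=> u v /asboolP hu /asboolP hv; apply/asboolP => d dd.
  by rewrite /precomp rmorphM /= -/(precomp d u) -/(precomp d v) hu ?hv.
Qed.

HB.instance Definition _ :=
  GRing.isSubalgClosed.Build K KV invariant invariant_subalg.

Record invariants := Invariant {
  inv_poly :> KV; inv_polyP : inv_poly \in invariant }.

HB.instance Definition _ := [isSub for inv_poly].
HB.instance Definition _ := [Choice of invariants by <:].
HB.instance Definition _ := [SubChoice_isSubAlgebra of invariants by <:].
HB.instance Definition _ := [SubNzRing_isSubComNzRing of invariants by <:].

Lemma inv_poly_linear : linear inv_poly.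
Proof. exact: (linearP (\val : {linear invariants -> KV})). Qed.

Lemma inv_poly_monoid : monoid_morphism inv_poly.
Proof.
split; first exact: (rmorph1 (\val : {rmorphism invariants -> KV})).
exact: (rmorphM (\val : {rmorphism invariants -> KV})).
Qed.

HB.instance Definition _ :=
  GRing.isLinear.Build K invariants KV *:%R inv_poly inv_poly_linear.
HB.instance Definition _ :=
  GRing.isMonoidMorphism.Build invariants KV inv_poly inv_poly_monoid.

Lemma precomp1 f : precomp 1%:M f = f.
Proof.
rewrite /precomp /subst -[RHS]comp_mpoly_id /comp_mpoly.
apply: eq_bigr => M _.
congr (_ * _); first by rewrite /= -mul_mpolyC mulr1.
apply: eq_bigr => k _; congr (_ ^+ _).
rewrite tnth_mktuple /on_xy !mxE /=.
by case: (splitP k) => j kj; rewrite scale1r scale0r ?addr0 ?add0r;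
  congr 'X_(_); apply: val_inj.
Qed.

Lemma precomp_mul d e f : precomp (d *m e) f = precomp e (precomp d f).
Proof.
rewrite {2 3}/precomp.
rewrite (subst_comp (subst _) _ f) /precomp /subst /mmap; apply: eq_bigr => M _.
congr (_ * _); apply: eq_bigr => k _; congr (_ ^+ _).
have xE i : precomp e (xvar i) = e 0 0 *: xvar i + e 0 1 *: yvar i.
  by rewrite /precomp substX on_xyx.
have yE i : precomp e (yvar i) = e 1 0 *: xvar i + e 1 1 *: yvar i.
  by rewrite /precomp substX on_xyy.
rewrite /= /on_xy; case: (split k) => j; rewrite linearD !linearZ /=;
  rewrite -!/(precomp e _) xE yE !scalerDr !scalerA addrACA -!scalerDl;
  by rewrite !mxE !big_ord_recl !big_ord0 !addr0;
     congr (_ *: _ + _ *: _); congr (_ * _ + _ * _); congr (_ _ _);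
     apply: val_inj.
Qed.

Lemma invariantP f :
  precomp rotation f = f -> precomp reflection f = f -> f \in invariant.
Proof.
move=> hrot hrefl; apply/asboolP => d; elim=> //.
- exact: precomp1.
- by move=> d1 d2 _ h1 _ h2; rewrite precomp_mul h1 h2.
move=> d1 _ h1; have [ud|nud] := boolP (d1 \in unitmx).
  by rewrite -{1}h1 -precomp_mul mulmxV // precomp1.
by rewrite /invmx (negbTE nud).
Qed.

End Invariants.

Arguments invariant {K} w m _.
Arguments invariants {K} w m.

Definition mindex (m d : nat) := {a : 'X_{1..m < d.+1} | mdeg a == d}.

Definition mnm_of (m d : nat) (a : mindex m d) : 'X_{1..m} := val (val a).
Coercion mnm_of : mindex >-> multinom.

Section Generators.
Variables (K : numClosedFieldType) (m : nat).

Notation KV := {mpoly K[m + m]}.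
Notation x := (@xvar K m).
Notation y := (@yvar K m).

Definition pgen (b : mindex m 4) : KV :=
  \prod_(i < m) x i ^+ b i + \prod_(i < m) y i ^+ b i.

(* The final 0 is never reached, since the entries of a sum to 2 (see qgenE). *)
Definition qgen (a : mindex m 2) : KV :=
  if [pick i : 'I_m | a i == 2%N] is Some i then x i * y i
  else if [pick ij : 'I_m * 'I_m | [&& ij.1 != ij.2, a ij.1 == 1%N
                                     & a ij.2 == 1%N]] is Some ij
  then 2^-1 *: (x ij.1 * y ij.2 + y ij.1 * x ij.2)
  else 0.

Definition gen (k : mindex m 2 + mindex m 4) : KV :=
  match k with inl a => qgen a | inr b => pgen b end.

Notation F := {mpoly K[#|{: mindex m 2 + mindex m 4}|]}.

Definition rho_var (a : mindex m 2) : F := 'X_(enum_rank (inl a)).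
Definition pi_var (b : mindex m 4) : F := 'X_(enum_rank (inr b)).

(* The variables indexed by plain exponent vectors; junk value 0 unless the
   entries sum to 2, resp. 4. *)
Definition rhoX (a : 'X_{1..m}) : F :=
  if [pick a' : mindex m 2 | mnm_of a' == a] is Some a' then rho_var a' else 0.
Definition piX (b : 'X_{1..m}) : F :=
  if [pick b' : mindex m 4 | mnm_of b' == b] is Some b' then pi_var b' else 0.

Lemma rhoE (a : mindex m 2) : rhoX a = rho_var a.
Proof.
rewrite /rhoX; case: pickP => [a' /eqP /val_inj /val_inj -> //|/(_ a)].
by rewrite eqxx.
Qed.

Lemma piE (b : mindex m 4) : piX b = pi_var b.
Proof.
rewrite /piX; case: pickP => [b' /eqP /val_inj /val_inj -> //|/(_ b)].
by rewrite eqxx.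
Qed.

Lemma mindexP d (a : 'X_{1..m}) : mdeg a = d -> exists a' : mindex m d, a = a'.
Proof.
move=> da; have la : (mdeg a < d.+1)%N by rewrite da.
have ea : mdeg (BMultinom la) == d by rewrite /= da.
by exists (exist _ (BMultinom la) ea).
Qed.

Lemma mdeg_mindex d (a : mindex m d) : mdeg a = d.
Proof. exact/eqP/(valP a). Qed.

Lemma mdegS (a : 'X_{1..m}) d :
  mdeg a = d.+1 -> exists i b, a = (U_(i) + b)%MM /\ mdeg b = d.
Proof.
move=> da; have [i ai] : exists i, a i != 0%N.
  apply/existsP; apply: contra_eqT da => /existsPn h.
  by rewrite mdegE big1 // => i _; apply/eqP; move: (h i); rewrite negbK.
exists i, (a - U_(i))%MM.
have ea : a = (U_(i) + (a - U_(i)))%MM by rewrite addmC submK // lep1mP.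
split=> //; move: da; rewrite {1}ea mdegD mdeg1 => [[]] //.
Qed.

Lemma mdeg2P (a : 'X_{1..m}) :
  mdeg a = 2%N -> exists i j, a = (U_(i) + U_(j))%MM.
Proof.
move=> /mdegS [i [b [-> /mdegS [j [c [-> /eqP]]]]]].
by rewrite mdeg_eq0 => /eqP ->; exists i, j; rewrite addm0.
Qed.

Lemma qgenE (a : mindex m 2) i j : mnm_of a = (U_(i) + U_(j))%MM ->
  qgen a = 2^-1 *: (x i * y j + y i * x j).
Proof.
move=> ea; have two0 : (2 : K) != 0 by rewrite pnatr_eq0.
rewrite /qgen ea; case: pickP => [k|h].
  rewrite mnmDE !mnm1E; case: (eqVneq i k) => [->|_];
    case: (eqVneq j k) => [->|_] // _.
  by rewrite [y k * _]mulrC -mulr2n -scaler_nat scalerA mulVf ?scale1r.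
have nij : i != j.
  by move: (h i); rewrite mnmDE !mnm1E eqxx; case: (eqVneq i j).
case: pickP => [[k l] /=|/(_ (i, j)) /=]; last first.
  by rewrite nij !mnmDE !mnm1E !eqxx [j == i]eq_sym (negbTE nij).
rewrite !mnmDE !mnm1E => /and3P[nkl].
have [eik|nik] := eqVneq i k; have [ejk|njk] := eqVneq j k => //=.
- have [eil|nil] := eqVneq i l; first by rewrite -eik eil eqxx in nkl.
  by have [ejl|njl] := eqVneq j l; rewrite // eik ejl.
- have [eil|nil] := eqVneq i l => _.
    rewrite ejk eil => _; congr (_ *: _).
    by rewrite addrC [_ * x k]mulrC [_ * y k]mulrC.
  by rewrite ejk (negbTE nkl).
Qed.

(* The sum of the x- and y-exponents, per vector component. *)
Definition multidegree (M : 'X_{1..m + m}) : 'X_{1..m} :=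
  [multinom (M (lshift m i) + M (rshift m i))%N | i < m].

Lemma multidegree_qgen (a : mindex m 2) M :
  M \in msupp (qgen a) -> multidegree M = a.
Proof.
have [i [j ea]] := mdeg2P (mdeg_mindex a).
rewrite ea (qgenE ea) /xvar /yvar -!mpolyXD mcoeff_msupp mcoeffZ mcoeffD !mcoeffX.
case: (eqVneq _ M) => [<- _|_].
  apply/mnmP => k; rewrite mnmE !mnmDE !mnm1E.
  by rewrite !eq_lshift !eq_rshift eq_lrshift eq_rlshift addn0 add0n.
case: (eqVneq _ M) => [<- _|_]; last by rewrite addr0 mulr0 eqxx.
apply/mnmP => k; rewrite mnmE !mnmDE !mnm1E.
by rewrite !eq_lshift !eq_rshift eq_lrshift eq_rlshift addn0 add0n addnC.
Qed.

Lemma multidegree_pgen (b : mindex m 4) M :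
  M \in msupp (pgen b) -> multidegree M = b.
Proof.
have xE : \prod_(i < m) x i ^+ b i =
    'X_[(\sum_(i < m) U_(lshift m i) *+ b i)%MM].
  by rewrite -mprodXE; apply: eq_bigr => i _; rewrite mpolyXn.
have yE : \prod_(i < m) y i ^+ b i =
    'X_[(\sum_(i < m) U_(rshift m i) *+ b i)%MM].
  by rewrite -mprodXE; apply: eq_bigr => i _; rewrite mpolyXn.
rewrite /pgen xE yE mcoeff_msupp mcoeffD !mcoeffX.
have s1 (k : 'I_m) : (\sum_(i < m) (i == k) * b i = b k)%N.
  by rewrite (bigD1 k) //= eqxx mul1n big1 ?addn0 // => i /negbTE ->.
case: (eqVneq _ M) => [<- _|_].
  apply/mnmP => k; rewrite mnmE !mnm_sumE -[RHS]s1 [X in (_ + X)%N]big1.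
    by rewrite addn0; apply: eq_bigr => i _; rewrite mulmnE mnm1E eq_lshift mulnC.
  by move=> i _; rewrite mulmnE mnm1E eq_lrshift.
case: (eqVneq _ M) => [<- _|_]; last by rewrite addr0 eqxx.
apply/mnmP => k; rewrite mnmE !mnm_sumE -[RHS]s1 [X in (X + _)%N]big1.
  by rewrite add0n; apply: eq_bigr => i _; rewrite mulmnE mnm1E eq_rshift mulnC.
by move=> i _; rewrite mulmnE mnm1E eq_rlshift.
Qed.

Lemma qgen_neq0 (a : mindex m 2) : qgen a != 0.
Proof.
have [i [j /qgenE ->]] := mdeg2P (mdeg_mindex a).
apply: contra_neq (oner_neq0 K) => /(congr1 (meval (fun=> 1))).
rewrite mevalZ mevalD !mevalM !mevalXU meval0 !mulr1 -[1 + 1]/(2%:R).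
by rewrite mulVf ?pnatr_eq0.
Qed.

Lemma pgen_neq0 (b : mindex m 4) : pgen b != 0.
Proof.
have : (2%:R : K) != 0 by rewrite pnatr_eq0.
apply: contra_neq => /(congr1 (meval (fun=> 1))).
rewrite mevalD meval0 !rmorph_prod /= !big1 //= => i _;
  by rewrite rmorphXn /= mevalXU expr1n.
Qed.

(* The coordinate of h on b j, for a linear combination h of polynomials b j
   with pairwise disjoint supports (see coordK). *)
Definition coord (J : finType) (b : J -> KV) (j : J) (h : KV) : K :=
  h@_(mlead (b j)) / mleadc (b j).

Definition in_span (J : finType) (b : J -> KV) (h : KV) : Prop :=
  exists c : J -> K, h = \sum_j c j *: b j.

Lemma in_spanD (J : finType) (b : J -> KV) h k :
  in_span b h -> in_span b k -> in_span b (h + k).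
Proof.
move=> [c ->] [d ->]; exists (fun j => c j + d j).
by rewrite -big_split; apply: eq_bigr => j _; rewrite scalerDl.
Qed.

Lemma in_spanZ (J : finType) (b : J -> KV) c h :
  in_span b h -> in_span b (c *: h).
Proof.
move=> [d ->]; exists (fun j => c * d j).
by rewrite scaler_sumr; apply: eq_bigr => j _; rewrite scalerA.
Qed.

Lemma in_span0 (J : finType) (b : J -> KV) : in_span b 0.
Proof. by exists (fun=> 0); rewrite big1 // => j _; rewrite scale0r. Qed.

Lemma in_spanX (J : finType) (b : J -> KV) j : in_span b (b j).
Proof.
exists (fun k => (k == j)%:R); rewrite (bigD1 j) //= eqxx scale1r.
by rewrite big1 ?addr0 // => k /negbTE ->; rewrite scale0r.
Qed.

Lemma in_span_sum (J I : finType) (b : J -> KV) (h : I -> KV) :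
  (forall i, in_span b (h i)) -> in_span b (\sum_i h i).
Proof.
by move=> bh; elim/big_ind: _ => //; [exact: in_span0|exact: in_spanD].
Qed.

Lemma coordK d (b : mindex m d -> KV) h :
    (forall j, b j != 0) ->
    (forall j M, M \in msupp (b j) -> multidegree M = j) ->
  in_span b h -> h = \sum_j coord b j h *: b j.
Proof.
move=> b0 bM [c ->]; apply: eq_bigr => j _; congr (_ *: _).
rewrite /coord raddf_sum (bigD1 j) //= mcoeffZ big1 ?addr0.
  by rewrite mulfK // mleadc_eq0.
move=> k nkj; rewrite mcoeffZ; apply/eqP; rewrite mulf_eq0; apply/orP; right.
apply: contraR nkj; rewrite -mcoeff_msupp => /bM e.
apply/eqP/val_inj/val_inj; rewrite -[LHS]e.
by apply: bM; apply: mlead_supp.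
Qed.

Definition GL_actV (g : 'M[K]_m) : KV -> KV :=
  subst (on_xy (fun j => \sum_(i < m) g i j *: x i)
               (fun j => \sum_(i < m) g i j *: y i)).

Lemma GL_actVx g j : GL_actV g (x j) = \sum_(i < m) g i j *: x i.
Proof. by rewrite /GL_actV substX on_xyx. Qed.

Lemma GL_actVy g j : GL_actV g (y j) = \sum_(i < m) g i j *: y i.
Proof. by rewrite /GL_actV substX on_xyy. Qed.

Lemma GL_actV_qgen g (a : mindex m 2) :
  in_span qgen (GL_actV g (qgen a)).
Proof.
have [i [j /qgenE ->]] := mdeg2P (mdeg_mindex a).
have -> : GL_actV g (2^-1 *: (x i * y j + y i * x j)) =
    \sum_(k < m) \sum_(l < m) (g k i * g l j) *: (2^-1 *: (x k * y l + y k * x l)).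
  rewrite /GL_actV linearZ linearD !rmorphM /= -!/(GL_actV g _).
  rewrite !GL_actVx !GL_actVy !big_distrl -big_split scaler_sumr /=.
  apply: eq_bigr => k _; rewrite !big_distrr -big_split scaler_sumr /=.
  apply: eq_bigr => l _; rewrite -!scalerAl -!scalerAr !scalerA.
  by rewrite -scalerDr scalerA mulrC.
apply: in_span_sum => k; apply: in_span_sum => l; apply: in_spanZ.
have [|a' ea] := @mindexP 2 (U_(k) + U_(l))%MM; first by rewrite mdegD !mdeg1.
by rewrite -(qgenE (esym ea)); exact: in_spanX.
Qed.

Lemma homog_mindex d (f : {mpoly K[m]}) :
  f \is d.-homog -> f = \sum_(b : mindex m d) f@_b *: 'X_[b].
Proof.
move=> fd; apply/mpolyP => M; rewrite raddf_sum /=.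
have [dM|ndM] := eqVneq (mdeg M) d; last first.
  rewrite (dhomog_nemf_coeff fd ndM) big1 // => b _.
  rewrite mcoeffZ mcoeffX; case: eqVneq => [e|]; last by rewrite mulr0.
  by rewrite -e mdeg_mindex eqxx in ndM.
have [b ->] := mindexP dM; rewrite (bigD1 b) //= mcoeffZ mcoeffX eqxx mulr1.
rewrite big1 ?addr0 // => c ncb; rewrite mcoeffZ mcoeffX; case: eqVneq => [e|].
  by case/eqP: ncb; apply/val_inj/val_inj.
by rewrite mulr0.
Qed.

Lemma GL_actV_pgen g (b : mindex m 4) :
  in_span pgen (GL_actV g (pgen b)).
Proof.
pose f : {mpoly K[m]} := \prod_(j < m) (\sum_(i < m) g i j *: 'X_i) ^+ b j.
have fh : f \is 4.-homog.
  rewrite -(mdeg_mindex b) mdegE.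
  apply: (big_rec2 (fun (p : {mpoly K[m]}) e => p \is e.-homog)).
    exact: dhomog1.
  move=> j e p _; apply: dhomogM.
  rewrite -[X in X.-homog]mul1n; apply: dhomogMn; apply: rpred_sum => i _.
  by apply: rpredZ; rewrite dhomogX; apply/eqP; exact: mdeg1.
have fX : subst x f = \prod_j GL_actV g (x j) ^+ b j.
  rewrite rmorph_prod; apply: eq_bigr => j _; rewrite rmorphXn /= GL_actVx.
  by rewrite linear_sum; congr (_ ^+ _); apply: eq_bigr => i _;
    rewrite linearZ /= substX.
have fY : subst y f = \prod_j GL_actV g (y j) ^+ b j.
  rewrite rmorph_prod; apply: eq_bigr => j _; rewrite rmorphXn /= GL_actVy.
  by rewrite linear_sum; congr (_ ^+ _); apply: eq_bigr => i _;
    rewrite linearZ /= substX.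
exists (fun b' : mindex m 4 => f@_b').
have -> : GL_actV g (pgen b) = subst x f + subst y f.
  rewrite fX fY /pgen /GL_actV linearD !rmorph_prod /=.
  by congr (_ + _); apply: eq_bigr => j _; rewrite rmorphXn.
rewrite {1 2}(homog_mindex fh) !linear_sum -big_split; apply: eq_bigr => b' _.
rewrite !linearZ /= -scalerDr; congr (_ *: (_ + _)).
  by rewrite /subst mmapX.
by rewrite /subst mmapX.
Qed.

(* Transport of the action along rho_a <-> q_a and pi_b <-> p_b; see
   qgen_transport, pgen_transport and phi_equivariant. *)
Definition GL_actF (g : 'M[K]_m) : F -> F :=
  subst (fun k : 'I_#|{: mindex m 2 + mindex m 4}| => match enum_val k with
    | inl a => \sum_(a' : mindex m 2) coord qgen a' (GL_actV g (qgen a)) *: rho_var a'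
    | inr b => \sum_(b' : mindex m 4) coord pgen b' (GL_actV g (pgen b)) *: pi_var b'
    end).

Lemma qgen_transport g (a : mindex m 2) :
  \sum_(a' : mindex m 2)
     coord qgen a' (GL_actV g (qgen a)) *: qgen a'
  = GL_actV g (qgen a).
Proof.
by rewrite -coordK //; [exact: qgen_neq0|exact: multidegree_qgen|
                        exact: GL_actV_qgen].
Qed.

Lemma pgen_transport g (b : mindex m 4) :
  \sum_(b' : mindex m 4)
     coord pgen b' (GL_actV g (pgen b)) *: pgen b'
  = GL_actV g (pgen b).
Proof.
rewrite -coordK //; last exact: GL_actV_pgen.
  by move=> j; exact: pgen_neq0.
by move=> j; exact: multidegree_pgen.
Qed.

(* The exponent vector (a, b, c, 0, .., 0). *)
Definition mi3 (a b c : nat) : 'X_{1..m} :=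
  [multinom nth 0%N [:: a; b; c] i | i < m].

Lemma mdeg_mi3 a b c : (3 <= m)%N -> mdeg (mi3 a b c) = (a + b + c)%N.
Proof.
move=> m3; rewrite mdegE (eq_bigr (fun i : 'I_m => nth 0%N [:: a; b; c] i)).
  case: m m3 => [|[|[|n]]] // _; rewrite 3!big_ord_recl /= big1 ?addn0 ?addnA //.
  by move=> i _; rewrite /= nth_nil.
by move=> i _; rewrite mnmE.
Qed.

Notation "'r_[' a , b , c ]" := (rhoX (mi3 a b c)).
Notation "'p_[' a , b , c ]" := (piX (mi3 a b c)).

Definition R222 : F :=
  \det (mx_of_rows 3 [:: [:: r_[2, 0, 0]; r_[1, 1, 0]; r_[1, 0, 1]];
                         [:: r_[1, 1, 0]; r_[0, 2, 0]; r_[0, 1, 1]];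
                         [:: r_[1, 0, 1]; r_[0, 1, 1]; r_[0, 0, 2]]]).

Definition R42 : F :=
  p_[4, 0, 0] * r_[0, 2, 0] - 2 * p_[3, 1, 0] * r_[1, 1, 0]
  + p_[2, 2, 0] * r_[2, 0, 0].

Definition R62 : F :=
  - p_[3, 1, 0] ^+ 2 + p_[4, 0, 0] * p_[2, 2, 0]
  - 4 * r_[2, 0, 0] ^+ 2 * (r_[1, 1, 0] ^+ 2 - r_[2, 0, 0] * r_[0, 2, 0]).

Definition R44 : F :=
  3 * p_[2, 2, 0] ^+ 2 + p_[4, 0, 0] * p_[0, 4, 0]
  - 4 * p_[3, 1, 0] * p_[1, 3, 0]
  - 16 * (r_[1, 1, 0] ^+ 2 - r_[2, 0, 0] * r_[0, 2, 0]) ^+ 2.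

End Generators.

Notation FK K m := {mpoly K[#|{: mindex m 2 + mindex m 4}|]}.

Section Phi.
Variables (K : numClosedFieldType) (w : K) (m : nat).
Hypothesis hw : 4.-primitive_root w.

Lemma gen_invariant (k : mindex m 2 + mindex m 4) :
  gen K k \in invariant w m.
Proof.
have w0 : w != 0.
  by apply: contra_eq_neq (prim_expr_order hw) => ->; rewrite expr0n eq_sym oner_eq0.
have rotx i : precomp (rotation w) (xvar K i) = w *: xvar K i.
  by rewrite /precomp substX on_xyx !mxE /= scale0r addr0.
have roty i : precomp (rotation w) (yvar K i) = w^-1 *: yvar K i.
  by rewrite /precomp substX on_xyy !mxE /= scale0r add0r.
have refx i : precomp (reflection K) (xvar K i) = yvar K i.
  by rewrite /precomp substX on_xyx !mxE /= scale0r add0r scale1r.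
have refy i : precomp (reflection K) (yvar K i) = xvar K i.
  by rewrite /precomp substX on_xyy !mxE /= scale0r addr0 scale1r.
case: k => [a|b] /=.
  have [i [j /qgenE ->]] := mdeg2P (mdeg_mindex a).
  apply: invariantP; rewrite /precomp linearZ linearD !rmorphM /= -!/(precomp _ _).
    by rewrite !rotx !roty -!scalerAl -!scalerAr !scalerA mulfV // mulVf // !scale1r.
  by rewrite !refx !refy addrC [_ * yvar K j]mulrC [_ * xvar K j]mulrC; congr (_ *: _);
    rewrite addrC.
have pw (v : K) (z : 'I_m -> {mpoly K[m + m]}) : v ^+ 4 = 1 ->
    \prod_(i < m) (v *: z i) ^+ b i = \prod_(i < m) z i ^+ b i.
  move=> v4; under eq_bigr do rewrite exprZn.
  by rewrite scaler_prod prodrXr -mdegE mdeg_mindex v4 scale1r.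
apply: invariantP; rewrite /precomp /pgen linearD !rmorph_prod /=.
  congr (_ + _).
    rewrite -(pw w) ?prim_expr_order //; apply: eq_bigr => i _.
    by rewrite rmorphXn /= -/(precomp _ _) rotx.
  rewrite -(pw w^-1) ?exprVn ?prim_expr_order ?invr1 //; apply: eq_bigr => i _.
  by rewrite rmorphXn /= -/(precomp _ _) roty.
rewrite addrC; congr (_ + _); apply: eq_bigr => i _; rewrite rmorphXn /=.
  by rewrite -/(precomp _ _) refy.
by rewrite -/(precomp _ _) refx.
Qed.

Definition phi : FK K m -> invariants w m :=
  subst (fun k => Invariant (gen_invariant (enum_val k))).

HB.instance Definition _ := GRing.LRMorphism.on phi.

Lemma inv_poly_phi f : inv_poly (phi f) = subst (fun k => gen K (enum_val k)) f.
Proof.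
exact: (subst_comp (@inv_poly K w m)).
Qed.

Lemma phi_rho (a : mindex m 2) : inv_poly (phi (rhoX K a)) = qgen K a.
Proof. by rewrite rhoE inv_poly_phi substX enum_rankK. Qed.

Lemma phi_pi (b : mindex m 4) : inv_poly (phi (piX K b)) = pgen K b.
Proof. by rewrite piE inv_poly_phi substX enum_rankK. Qed.

Lemma phi_equivariant (g : 'M[K]_m) f :
  inv_poly (phi (GL_actF g f)) = GL_actV g (inv_poly (phi f)).
Proof.
rewrite !inv_poly_phi /GL_actF /GL_actV !subst_comp; apply: eq_bigr => M _.
congr (_ * _); apply: eq_bigr => k _; congr (_ ^+ _).
rewrite /= -/(GL_actV g _); case: (enum_val k) => [a|b] /=.
  rewrite -qgen_transport linear_sum; apply: eq_bigr => a' _.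
  by rewrite linearZ /= substX enum_rankK.
rewrite -pgen_transport linear_sum; apply: eq_bigr => b' _.
by rewrite linearZ /= substX enum_rankK.
Qed.

End Phi.

Local Open Scope classical_set_scope.

Section GLModules.
Variables (K : numClosedFieldType) (m : nat).

Notation F := (FK K m).
Implicit Types (I U W : set F).

Definition subspace W : Prop :=
  W 0 /\ forall (c : K) u v, W u -> W v -> W (c *: u + v).

Definition ideal I : Prop :=
  [/\ I 0, forall u v, I u -> I v -> I (u + v) & forall a u, I u -> I (a * u)].

Definition GL_stable W : Prop :=
  forall g : 'M[K]_m, g \in unitmx -> forall f, W f -> W (GL_actF g f).

Definition GL_ideal I : Prop := ideal I /\ GL_stable I.

Definition GL_submodule W : Prop := subspace W /\ GL_stable W.

Definition GL_irreducible W : Prop :=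
  [/\ GL_submodule W, W <> [set 0]
    & forall U, GL_submodule U -> U `<=` W -> U = [set 0] \/ U = W].

Definition GL_span (r : F) : set F := smallest GL_submodule [set r].

Definition sum_subspaces s (W : 'I_s -> set F) : set F :=
  [set f | exists2 v : 'I_s -> F, forall i, W i (v i) & f = \sum_i v i].

Definition direct_sum s (W : 'I_s -> set F) : Prop :=
  forall v : 'I_s -> F, (forall i, W i (v i)) -> \sum_i v i = 0 ->
  forall i, v i = 0.

Definition minimal_generating_subspace I W : Prop :=
  [/\ subspace W, smallest ideal W = I
    & forall U, subspace U -> U `<=` W -> smallest ideal U = I -> U = W].

Definition minimally_GL_generated I s (r : s.-tuple F) : Prop :=
  let W i := GL_span (tnth r i) in
  [/\ GL_ideal I, forall i, GL_irreducible (W i), direct_sum W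
    & minimal_generating_subspace I (sum_subspaces W)].

End GLModules.

Definition kernel (A B : nmodType) (f : A -> B) : set A := [set a | f a = 0].

(* Main.v *)
From HB Require Import structures.
Require Import Defs.
From mathcomp Require Import all_boot all_order all_algebra.
From mathcomp Require Import ssrcomplements mpoly complex ring zify.
From mathcomp Require Import boolp classical_sets reals.

(* Apart from generation, everything follows from a Hermitian form on F(4, m)
   (monomials orthogonal, with apolar norms) for which the action of the
   conjugate transpose of g is adjoint to that of g.  Given it, each r_i
   generates an irreducible module because the part of its highest weight is a
   line, and weights, degrees and the sign change pi -> - pi show that the four
   modules are orthogonal to each other and to F(4, m)_+ times their sum.

   Generation: put d_ij = x_i x_j + y_i y_j.  The products d_ij d_kl are the
   images of D_ijkl = pi_ijkl + 2 (rho_ik rho_jl + rho_il rho_jk - rho_ij rho_kl),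
   and polarising the four relations shows that, modulo the ideal J they
   generate, the matrix (D_ijkl) has vanishing 2-minors and each row (D_ijkl)_ij
   is killed by the polarised 2-minors against (rho_ij).  The minors allow one
   to adjoin to F(4, m) / J elements d_ij with d_ij d_kl = D_ijkl.  There
   S = 2 rho + d and T = 2 rho - d satisfy the Veronese relations, as do u_i u_j
   and v_i v_j for u = x + y and v = i (x - y).  So u_i u_j -> S_ij,
   v_i v_j -> T_ij is well defined, and it inverts phi modulo J. *)

Set Implicit Arguments.
Unset Strict Implicit.
Unset Printing Implicit Defensive.

Import Order.TTheory GRing.Theory Num.Theory.

Local Open Scope ring_scope.

(** * The apolar Hermitian form *)

(** Origin of d_ij: it is fixed by the reflection and changes sign under the rotation, so it is an
    invariant of the index-two subgroup generated by the reflection and -1. In the coordinates u, v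
    that subgroup is the group of all sign changes of u and of v. Its invariants are generated by
    the u_i u_j and the v_i v_j, subject to Veronese relations only, which explains S and T. The
    delicate point is that adjoining the d_ij must not enlarge J. A monomial in the d_ij is sent
    back to F by pairing up its letters; the 2-minors say exactly that the choice of pairing is
    immaterial modulo J, and constants are fixed. On the side of representations, the action is
    polynomial, so every submodule is also stable under singular matrices. Projections onto two or
    three variables thus become available: they cut modules down to lines, and those of rank two
    kill the module of the determinant. In the minimality statement the competing subspace need be
    neither graded nor stable. This is why orthogonality to all of F_+ times the sum is wanted: it
    allows a Nakayama argument without any grading of that subspace. *)

Section LinearExtension.
Variables (n : nat) (A : nzRingType) (B : comNzRingType).
Variable i : {rmorphism A -> B}.
Variable u : 'X_{1..n} -> B.

(** One extension serves three purposes: the Hermitian form, [pairing], and, with a genuine change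
    of coefficients [i], the map [sigma]. *)
Definition lext (f : {mpoly A[n]}) : B := \sum_(M <- msupp f) i f@_M * u M.

Lemma lextwE k f : (msize f <= k)%N ->
  lext f = \sum_(M : 'X_{1..n < k}) i f@_M * u M.
Proof.
move=> fk; rewrite /lext (big_mksub 'X_{1..n < k}) //=.
- rewrite big_rmcond //= => M.
  by move/memN_msupp_eq0 => ->; rewrite rmorph0 mul0r.
- exact: msupp_uniq.
by move=> M /msize_mdeg_lt /leq_trans; apply.
Qed.

Lemma lext_linear c f g : lext (c *: f + g) = i c * lext f + lext g.
Proof.
pose k := maxn (msize (c *: f + g)) (maxn (msize f) (msize g)).
rewrite !(@lextwE k) ?leq_max ?leqnn ?orbT //.
rewrite mulr_sumr -big_split; apply: eq_bigr => M _ /=.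
by rewrite mcoeffD mcoeffZ rmorphD rmorphM mulrDl mulrA.
Qed.

Lemma lext0 : lext 0 = 0.
Proof. by rewrite /lext msupp0 big_nil. Qed.

Lemma lextD f g : lext (f + g) = lext f + lext g.
Proof. by have := lext_linear 1 f g; rewrite scale1r rmorph1 mul1r. Qed.

Lemma lextZ c f : lext (c *: f) = i c * lext f.
Proof. by have := lext_linear c f 0; rewrite !addr0 lext0 addr0. Qed.

Lemma lext_sum I (r : seq I) (P : pred I) (F : I -> {mpoly A[n]}) :
  lext (\sum_(j <- r | P j) F j) = \sum_(j <- r | P j) lext (F j).
Proof. exact: (big_morph lext lextD lext0). Qed.

Lemma lextX M : lext 'X_[M] = u M.
Proof. by rewrite /lext msuppX big_seq1 mcoeffX eqxx rmorph1 mul1r. Qed.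

End LinearExtension.

Section FischerForm.
Variables (K : numClosedFieldType) (n : nat) (c : 'I_n -> K).
Hypothesis c_gt0 : forall k, 0 < c k.
Implicit Types (f h : {mpoly K[n]}).

(** The factorials make multiplication by a variable adjoint to differentiation. The weights [c]
    will give each generator of F the norm of the monomial it stands for. *)
Definition mnorm (M : 'X_{1..n}) : K := \prod_k (c k ^+ M k * (M k)`!%:R).

Definition fischer f h : K :=
  lext (idfun : {rmorphism K -> K}) (fun M => (h@_M)^* * mnorm M) f.

Lemma mnorm_gt0 M : 0 < mnorm M.
Proof. by apply: prodr_gt0 => k _; rewrite mulr_gt0 ?exprn_gt0 ?ltr0n ?fact_gt0. Qed.

Lemma mnormS k M : mnorm (U_(k) + M)%MM = c k * (M k).+1%:R * mnorm M.
Proof.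
rewrite /mnorm (bigD1 k) //= [in RHS](bigD1 k) //= mnmDE mnm1E eqxx add1n.
rewrite exprS factS natrM.
under eq_bigr => j jk do rewrite mnmDE mnm1E eq_sym (negbTE jk) add0n.
by ring.
Qed.

Lemma fischer_linear a f g h : fischer (a *: f + g) h = a * fischer f h + fischer g h.
Proof. exact: lext_linear. Qed.

Lemma fischerC f h : fischer h f = (fischer f h)^*.
Proof.
pose k := maxn (msize f) (msize h).
rewrite /fischer !(@lextwE _ _ _ _ _ k) ?leq_max ?leqnn ?orbT //.
rewrite rmorph_sum; apply: eq_bigr => M _ /=.
rewrite /= !rmorphM /= conjCK (conj_Creal (gtr0_real (mnorm_gt0 M))).
by ring.
Qed.

Lemma fischerDl f g h : fischer (f + g) h = fischer f h + fischer g h.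
Proof. exact: lextD. Qed.

Lemma fischerZl a f h : fischer (a *: f) h = a * fischer f h.
Proof. exact: lextZ. Qed.

Lemma fischer0l h : fischer 0 h = 0.
Proof. exact: lext0. Qed.

Lemma fischerDr f g h : fischer h (f + g) = fischer h f + fischer h g.
Proof. by rewrite fischerC fischerDl rmorphD /= -!fischerC. Qed.

Lemma fischerZr a f h : fischer h (a *: f) = a^* * fischer h f.
Proof. by rewrite fischerC fischerZl rmorphM /= -fischerC. Qed.

Lemma fischer0r h : fischer h 0 = 0.
Proof. by rewrite fischerC fischer0l rmorph0. Qed.

Lemma fischer_suml I (r : seq I) (P : pred I) (F : I -> {mpoly K[n]}) h :
  fischer (\sum_(j <- r | P j) F j) h = \sum_(j <- r | P j) fischer (F j) h.
Proof. exact: lext_sum. Qed.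

Lemma fischer_sumr I (r : seq I) (P : pred I) (F : I -> {mpoly K[n]}) h :
  fischer h (\sum_(j <- r | P j) F j) = \sum_(j <- r | P j) fischer h (F j).
Proof. exact: (big_morph _ (fun f g => fischerDr f g h) (fischer0r h)). Qed.

Lemma fischerX M h : fischer 'X_[M] h = (h@_M)^* * mnorm M.
Proof. exact: lextX. Qed.

Lemma fischer_eq0 f : fischer f f = 0 -> f = 0.
Proof.
have e M : f@_M * ((f@_M)^* * mnorm M) = `|f@_M| ^+ 2 * mnorm M.
  by rewrite normCK mulrA.
rewrite /fischer /lext (eq_bigr _ (fun M _ => e M)) => /eqP.
rewrite psumr_eq0; last first.
  by move=> M _; rewrite mulr_ge0 ?exprn_ge0 ?normr_ge0 ?ltW ?mnorm_gt0.
move/allP => f0; apply/mpolyP => M; rewrite mcoeff0.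
case: (boolP (M \in msupp f)) => [/f0 /=|/memN_msupp_eq0 //].
by rewrite mulf_eq0 expf_eq0 /= normr_eq0 (gt_eqF (mnorm_gt0 M)) orbF => /eqP.
Qed.

Lemma fischer_deriv k f h : fischer ('X_k * f) h = c k * fischer f (mderiv k h).
Proof.
elim/mpolyind: f => [|a M f _ _ IH]; first by rewrite mulr0 !fischer0l mulr0.
rewrite mulrDr fischerDl IH fischerDl mulrDr; congr (_ + _).
rewrite -scalerAr !fischerZl -mpolyXD !fischerX mnormS.
rewrite mcoeff_deriv rmorphMn /= [(U_(k) + M)%MM]addmC -mulr_natr.
by ring.
Qed.

Definition linsubst (A : 'I_n -> 'I_n -> K) : {mpoly K[n]} -> {mpoly K[n]} :=
  subst (fun l => \sum_k A k l *: 'X_k).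

HB.instance Definition _ A := GRing.LRMorphism.on (linsubst A).

Lemma linsubstX A l : linsubst A 'X_l = \sum_k A k l *: 'X_k.
Proof. exact: substX. Qed.

Lemma mpoly_indX (P : {mpoly K[n]} -> Prop) :
  P 1 -> (forall f g a, P f -> P g -> P (a *: f + g)) ->
  (forall k f, P f -> P ('X_k * f)) -> forall f, P f.
Proof.
move=> P1 PD PX f; elim/mpolyind: f => [|a M f _ _ Pf].
  by rewrite -(addNr (1 : {mpoly K[n]})) -scaleN1r; apply: PD.
apply: PD => //; elim: {M}(mdeg M) {-2}M (erefl (mdeg M)) => [|d IH] M.
  by move/eqP; rewrite mdeg_eq0 => /eqP ->; rewrite mpolyX0.
by case/mdegS => k [N [-> dN]]; rewrite mpolyXD; apply/PX/IH.
Qed.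

(** The chain rule for a linear substitution. *)
Lemma mderiv_linsubst A l h :
  mderiv l (linsubst A h) = \sum_k A l k *: linsubst A (mderiv k h).
Proof.
elim/mpoly_indX: h => [|f g a IHf IHg|j f IH].
- rewrite rmorph1 mderivC big1 // => k _.
  by rewrite mderivC raddf0 scaler0.
- rewrite linearP /= mderivD mderivZ IHf IHg scaler_sumr -big_split /=.
  apply: eq_bigr => k _; rewrite mderivD mderivZ linearP /= scalerDr !scalerA.
  by rewrite mulrC.
rewrite rmorphM /= linsubstX mderivM IH.
under [in RHS]eq_bigr => k _ do rewrite mderivM linearD !rmorphM /= scalerDr.
rewrite big_split /=; congr (_ + _); last first.
  by rewrite mulr_sumr; apply: eq_bigr => k _; rewrite linsubstX scalerAr.
have dX k i : mderiv k ('X_i : {mpoly K[n]}) = (i == k)%:R.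
  rewrite mderivX mnm1E; case: eqVneq => [->|_]; last by rewrite scale0r.
  have -> : (U_(k) - U_(k) = 0 :> 'X_{1..n})%MM.
    by apply/mnmP => q; rewrite mnmBE subnn mnm0E.
  by rewrite mpolyX0 scale1r.
rewrite [in RHS](bigD1 j) //= dX eqxx rmorph1 mul1r [X in _ = _ + X]big1 ?addr0.
  rewrite raddf_sum /= (bigD1 l) //= mderivZ dX eqxx big1 ?addr0 -?scalerAl ?mul1r //.
  by move=> k kl; rewrite mderivZ dX (negbTE kl) scaler0.
by move=> k kj; rewrite dX eq_sym (negbTE kj) rmorph0 mul0r scaler0.
Qed.

Lemma linsubst_coef0 A h : (linsubst A h)@_0%MM = h@_0%MM.
Proof.
elim/mpoly_indX: h => [|f g a IHf IHg|k f _]; first by rewrite rmorph1.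
  by rewrite linearP /= !mcoeffD !mcoeffZ IHf IHg.
by rewrite !rmorphM /= linsubstX raddf_sum /= big1 => [|l _];
  rewrite ?mcoeffZ mcoeffX mnm1_eq0 ?mulr0 ?mul0r.
Qed.

(** The hypothesis is adjointness on the span of the variables. Induction peels a variable off [f];
    on the other side it becomes a derivative, which passes through the substitution by the chain
    rule. *)
Lemma fischer_adjoint A B f h :
  (forall k l, c k * A k l = c l * (B l k)^*) ->
  fischer (linsubst A f) h = fischer f (linsubst B h).
Proof.
move=> AB; elim/mpoly_indX: f h => [h|f g a IHf IHg h|l f IH h].
- by rewrite rmorph1 -mpolyX0 !fischerX linsubst_coef0.
- by rewrite linearP /= !fischer_linear IHf IHg.
rewrite rmorphM /= linsubstX mulr_suml fischer_suml fischer_deriv.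
rewrite mderiv_linsubst fischer_sumr mulr_sumr; apply: eq_bigr => k _.
by rewrite -scalerAl fischerZl fischer_deriv IH fischerZr [RHS]mulrA -AB; ring.
Qed.

End FischerForm.

(** * Families depending polynomially on a parameter *)

Section PolynomialFamilies.
Variable K : numClosedFieldType.

Lemma exists_nonroot (q : {poly K}) : q != 0 -> exists t, q.[t] != 0.
Proof.
move=> q0; apply: contrapT => /forallNP h.
have : (size [seq k%:R : K | k <- iota 0 (size q)] < size q)%N.
  apply: max_poly_roots => //.
    by apply/allP => t _; apply/rootP/eqP; move: (h t) => /negP; rewrite negbK.
  by rewrite map_inj_uniq ?iota_uniq //; apply: mulrIn; rewrite oner_neq0.
by rewrite size_map size_iota ltnn.
Qed.

Definition polyfam (A : comAlgType K) (u : K -> A) :=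
  exists p : {poly A}, forall t, u t = p.[t%:A].

Lemma polyfam_ext (A : comAlgType K) (v u : K -> A) :
  (forall t, u t = v t) -> polyfam v -> polyfam u.
Proof. by move=> uv [p hp]; exists p => t; rewrite uv. Qed.

Lemma subst_ext n (A : comAlgType K) (h h' : 'I_n -> A) f :
  (forall k, h k = h' k) -> subst h f = subst h' f.
Proof. by move=> hh; congr subst; apply/funext. Qed.

Lemma polyfamC (A : comAlgType K) (a : A) : polyfam (fun=> a).
Proof. by exists a%:P => t; rewrite hornerC. Qed.

Lemma polyfam_id (A : comAlgType K) (a : A) : polyfam (fun t => t *: a).
Proof. by exists (a *: 'X) => t; rewrite hornerZ hornerX mulr_algr. Qed.

Lemma polyfamD (A : comAlgType K) (u v : K -> A) :
  polyfam u -> polyfam v -> polyfam (fun t => u t + v t).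
Proof. by move=> [p hp] [q hq]; exists (p + q) => t; rewrite hornerD hp hq. Qed.

Lemma polyfamM (A : comAlgType K) (u v : K -> A) :
  polyfam u -> polyfam v -> polyfam (fun t => u t * v t).
Proof. by move=> [p hp] [q hq]; exists (p * q) => t; rewrite hornerM hp hq. Qed.

Lemma polyfam_sum (A : comAlgType K) I (r : seq I) (u : I -> K -> A) :
  (forall i, polyfam (u i)) -> polyfam (fun t => \sum_(i <- r) u i t).
Proof.
move=> hu; elim: r => [|i r IH].
  by under eq_fun => t do rewrite big_nil; exact: polyfamC.
by under eq_fun => t do rewrite big_cons; exact: polyfamD.
Qed.

Lemma horner_alg_coef (A : comAlgType K) (p : {poly A}) (t : K) :
  p.[t%:A] = \sum_(k < size p) t ^+ k *: p`_k.
Proof.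
rewrite horner_coef; apply: eq_bigr => k _.
by rewrite exprZn expr1n mulr_algr.
Qed.

Lemma polyfam_lin (A B : comAlgType K) (L : {linear A -> B}) (u : K -> A) :
  polyfam u -> polyfam (fun t => L (u t)).
Proof.
move=> [p hp]; exists (\poly_(k < size p) L p`_k) => t.
rewrite hp horner_alg_coef linear_sum horner_poly; apply: eq_bigr => k _.
by rewrite linearZ /= exprZn expr1n mulr_algr.
Qed.

Lemma polyfam_subst n (A : comAlgType K) (h : K -> 'I_n -> A) f :
  (forall k, polyfam (fun t => h t k)) -> polyfam (fun t => subst (h t) f).
Proof.
move=> hh; elim/mpoly_indX: f => [|f g a IHf IHg|k f IH].
- by under eq_fun => t do rewrite rmorph1; exact: polyfamC.
- under eq_fun => t do rewrite linearP /=.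
  by apply: polyfamD => //; exact: (polyfam_lin ( *:%R a)).
by under eq_fun => t do rewrite rmorphM /= substX; exact: polyfamM.
Qed.

Variable m : nat.
Notation F := (FK K m).
Implicit Types (W : set F).

Lemma subspaceZ W c u : subspace W -> W u -> W (c *: u).
Proof. by move=> [W0 WD] /WD -/(_ c 0 W0); rewrite addr0. Qed.

Lemma subspaceD W u v : subspace W -> W u -> W v -> W (u + v).
Proof. by move=> [W0 WD] Wu Wv; have := WD 1 _ _ Wu Wv; rewrite scale1r. Qed.

Lemma subspaceB W u v : subspace W -> W u -> W v -> W (u - v).
Proof.
by move=> hW Wu Wv; rewrite -scaleN1r; apply: subspaceD => //; exact: subspaceZ.
Qed.

Lemma subspace_sum W I (r : seq I) (P : pred I) (u : I -> F) : subspace W ->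
  (forall i, P i -> W (u i)) -> W (\sum_(i <- r | P i) u i).
Proof.
by move=> hW Wu; elim/big_ind: _ => //; [case: hW|move=> *; exact: subspaceD].
Qed.

(** The value at 2t minus 2^N times the value at t has no term of degree N, and its k-th coefficient
    is multiplied by 2^k - 2^N, which is nonzero for k < N. Both points must avoid the roots of [q],
    hence the product of [q] with its rescaling. *)
Lemma subspace_coefs W N (f : nat -> F) (q : {poly K}) : subspace W -> q != 0 ->
  (forall t, q.[t] != 0 -> W (\sum_(k < N) t ^+ k *: f k)) ->
  forall k, (k < N)%N -> W (f k).
Proof.
move=> hW; elim: N f q => // N IH f q q0 Wf.
have two0 : (2 : K) != 0 by rewrite pnatr_eq0.
have q20 : q * (q \Po (2 *: 'X)) != 0.
  rewrite mulf_neq0 // comp_poly_eq0 // size_scale //.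
  by rewrite size_polyX.
have WN k : (k < N)%N -> W (f k).
  move=> kN; have : W ((2 ^+ k - 2 ^+ N) *: f k).
    apply: (IH (fun k => (2 ^+ k - 2 ^+ N) *: f k) _ q20 _ _ kN) => t.
    rewrite hornerM horner_comp hornerZ hornerX mulf_eq0 negb_or => /andP[t1 t2].
    have := subspaceB hW (Wf _ t2) (subspaceZ (2 ^+ N) hW (Wf _ t1)).
    rewrite !big_ord_recr /= scalerDr opprD addrACA scaler_sumr -sumrB.
    rewrite !scalerA exprMn subrr addr0; congr W; apply: eq_bigr => i _.
    by rewrite !scalerA -scalerBl exprMn; congr (_ *: _); ring.
  move/(subspaceZ (2 ^+ k - 2 ^+ N)^-1 hW); rewrite scalerA mulVf ?scale1r //.
  by rewrite subr_eq0 -!natrX eqr_nat eqn_exp2l // ltn_eqF.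
move=> k; rewrite ltnS leq_eqVlt => /predU1P[->|]; last exact: WN.
(* The factor ['X] keeps [t] nonzero, so that the top term can be divided by its power of [t]. *)
have /exists_nonroot [t] : q * 'X != 0 by rewrite mulf_neq0 ?polyX_eq0.
rewrite hornerM hornerX mulf_eq0 negb_or => /andP[qt t0].
have := Wf _ qt; rewrite big_ord_recr /= => Wt.
have W' : W (\sum_(i < N) t ^+ i *: f i).
  by apply: subspace_sum => // i _; apply: subspaceZ => //; exact: WN.
have := subspaceZ (t ^- N) hW (subspaceB hW Wt W').
by rewrite addrAC subrr add0r scalerA mulVf ?scale1r // expf_neq0.
Qed.

Lemma subspace_poly W (p : {poly F}) (q : {poly K}) : subspace W -> q != 0 ->
  (forall t, q.[t] != 0 -> W p.[t%:A]) -> forall k, W p`_k.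
Proof.
move=> hW q0 Wp k; case: (ltnP k (size p)) => [kp|/(nth_default 0) -> ]; last by case: hW.
by apply: (@subspace_coefs W (size p) (nth 0 p) q) => // t /Wp; rewrite horner_alg_coef.
Qed.

End PolynomialFamilies.

(** * The action on F expressed through symbols *)

Section Symbols.
Variables (K : numClosedFieldType) (m : nat).
Notation Z := {mpoly K[m]}.
Notation KV := {mpoly K[m + m]}.
Notation F := (FK K m).

(** In the symbol ring [Z] the monomial z^a stands for rho_a in degree 2 and for pi_a in degree 4;
    the action on F is induced by this one. *)
Definition lin (g : 'M[K]_m) : Z -> Z := linsubst (fun i j => g i j).

HB.instance Definition _ g := GRing.LRMorphism.on (lin g).
HB.instance Definition _ g := GRing.LRMorphism.on (@GL_actV K m g).
HB.instance Definition _ g := GRing.LRMorphism.on (@GL_actF K m g).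

Lemma linX g j : lin g 'X_j = \sum_i g i j *: 'X_i.
Proof. exact: linsubstX. Qed.

Lemma lin_homog g M : lin g 'X_[M] \is (mdeg M).-homog.
Proof.
rewrite mpolyXE_id rmorph_prod /= mdegE.
apply: (big_rec2 (fun (p : Z) e => p \is e.-homog)); first exact: dhomog1.
move=> j e p _; apply: dhomogM; rewrite rmorphXn /= linX -[X in X.-homog]mul1n.
apply: dhomogMn; apply: rpred_sum => i _.
by apply: rpredZ; rewrite dhomogX; apply/eqP; exact: mdeg1.
Qed.

Lemma lin_coef g d f (a : mindex m d) :
  (lin g f)@_a = \sum_(b : mindex m d) f@_b * (lin g 'X_[b])@_a.
Proof.
elim/mpolyind: f => [|c M f _ _ IH].
  by rewrite raddf0 mcoeff0 big1 // => b _; rewrite mcoeff0 mul0r.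
rewrite [lin g _]linearP mcoeffD mcoeffZ {}IH.
under [in RHS]eq_bigr => b _ do rewrite mcoeffD mcoeffZ mcoeffX mulrDl.
rewrite big_split; congr (_ + _) => /=.
have [dM|ndM] := eqVneq (mdeg M) d; last first.
  have nda : mdeg a != mdeg M by rewrite mdeg_mindex eq_sym.
  rewrite (dhomog_nemf_coeff (lin_homog g M) nda) mulr0.
  rewrite big1 // => b _; case: eqP => [e|_]; last by rewrite mulr0 mul0r.
  by rewrite e mdeg_mindex eqxx in ndM.
have [b ->] := mindexP dM; rewrite (bigD1 b) //= eqxx mulr1 big1 ?addr0 // => k kb.
case: eqVneq => [e|_]; last by rewrite mulr0 mul0r.
by case/eqP: kb; apply/val_inj/val_inj.
Qed.

Lemma coord_sum d (b : mindex m d -> KV) (c : mindex m d -> K) :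
    (forall j, b j != 0) ->
    (forall j M, M \in msupp (b j) -> multidegree M = j) ->
  forall j, Defs.coord b j (\sum_k c k *: b k) = c j.
Proof.
move=> b0 bM j; rewrite /Defs.coord raddf_sum (bigD1 j) //= mcoeffZ big1 ?addr0.
  by rewrite mulfK // mleadc_eq0.
move=> k nkj; rewrite mcoeffZ; apply/eqP; rewrite mulf_eq0; apply/orP; right.
apply: contraR nkj; rewrite -mcoeff_msupp => /bM e.
apply/eqP/val_inj/val_inj; rewrite -[LHS]e.
by apply: bM; apply: mlead_supp.
Qed.

(** Used with [polar2] and [power4]: an intertwining map [L] that carries monomials to generators
    makes the matrix of [g] the same on both. *)
Lemma coord_GL d (b : mindex m d -> KV) (L : {linear Z -> KV}) g (a a' : mindex m d) :
    (forall j, b j != 0) ->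
    (forall j M, M \in msupp (b j) -> multidegree M = j) ->
    (forall j : mindex m d, b j = L 'X_[j]) -> (forall f, GL_actV g (L f) = L (lin g f)) ->
  Defs.coord b a' (GL_actV g (b a)) = (lin g 'X_[a])@_a'.
Proof.
move=> b0 bM bL gL; rewrite bL gL.
have /homog_mindex e : lin g 'X_[a] \is d.-homog.
  by rewrite -{2}(mdeg_mindex a) lin_homog.
rewrite {1}e linear_sum /=; under eq_bigr => k _ do rewrite linearZ -bL.
exact: coord_sum.
Qed.

(* Sends [z_i z_j] to [(x_i y_j + y_i x_j) / 2]. *)
Definition polar2 (f : Z) : KV :=
  2^-1 *: (subst (fun i => xvar K i + yvar K i) f - subst (@xvar K m) f
           - subst (@yvar K m) f).

Definition power4 (f : Z) : KV := subst (@xvar K m) f + subst (@yvar K m) f.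

Lemma polar2_linear : linear polar2.
Proof.
have e (V : lmodType K) (a b : K) (u u' v v' w w' : V) :
    b *: (a *: u + u' + (a *: v + v') + (a *: w + w')) =
    a *: (b *: (u + v + w)) + b *: (u' + v' + w').
  rewrite scalerA [a * b]mulrC -scalerA -scalerDr !(@scalerDr _ _ a).
  by rewrite (addrACA (a *: u)) (addrACA (a *: u + a *: v)).
by move=> a f g; rewrite /polar2 !linearP e.
Qed.

Lemma power4_linear : linear power4.
Proof. by move=> a f g; rewrite /power4 !linearP /= scalerDr addrACA. Qed.

HB.instance Definition _ :=
  GRing.isLinear.Build K Z KV *:%R polar2 polar2_linear.
HB.instance Definition _ :=
  GRing.isLinear.Build K Z KV *:%R power4 power4_linear.

Lemma polar2M i j : polar2 ('X_i * 'X_j) =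
  2^-1 *: (xvar K i * yvar K j + yvar K i * xvar K j).
Proof. rewrite /polar2 !rmorphM /= !substX; congr (_ *: _); ring. Qed.

Lemma qgen_polar2 (a : mindex m 2) : qgen K a = polar2 'X_[a].
Proof.
have [i [j ea]] := mdeg2P (mdeg_mindex a).
by rewrite (qgenE K ea) ea mpolyXD polar2M.
Qed.

Lemma pgen_power4 (b : mindex m 4) : pgen K b = power4 'X_[b].
Proof. by rewrite /pgen /power4 /subst !mmapX. Qed.

Lemma GL_actV_subst g (h : 'I_m -> KV) f :
  (forall j, GL_actV g (h j) = \sum_i g i j *: h i) ->
  GL_actV g (subst h f) = subst h (lin g f).
Proof.
move=> hg; rewrite (subst_comp (GL_actV g)) /lin /linsubst (subst_comp (subst h)).
apply: subst_ext => j; rewrite /= hg linear_sum.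
by apply: eq_bigr => i _; rewrite linearZ /= substX.
Qed.

Lemma GL_actV_polar2 g f : GL_actV g (polar2 f) = polar2 (lin g f).
Proof.
rewrite /polar2 linearZ !linearB /=.
rewrite [X in _ - X - _]GL_actV_subst; last exact: GL_actVx.
rewrite [X in _ - X]GL_actV_subst; last exact: GL_actVy.
rewrite GL_actV_subst => [|j]; first by rewrite !scalerBr.
rewrite linearD /= GL_actVx GL_actVy -big_split.
by apply: eq_bigr => i _; rewrite scalerDr.
Qed.

Lemma GL_actV_power4 g f : GL_actV g (power4 f) = power4 (lin g f).
Proof.
rewrite /power4 linearD /=.
by rewrite (GL_actV_subst _ (GL_actVx g)) (GL_actV_subst _ (GL_actVy g)).
Qed.

(** Only the part of degree 2 is read (degree 4 in [piF]), so both maps are linear on all of [Z]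
    without a homogeneity condition. *)
Definition rhoF (f : Z) : F := \sum_(a : mindex m 2) f@_a *: rho_var K a.
Definition piF (f : Z) : F := \sum_(b : mindex m 4) f@_b *: pi_var K b.

Lemma rho_linear : linear rhoF.
Proof.
move=> c f g; rewrite /rhoF scaler_sumr -big_split; apply: eq_bigr => a _.
by rewrite /= mcoeffD mcoeffZ scalerDl scalerA.
Qed.

Lemma pi_linear : linear piF.
Proof.
move=> c f g; rewrite /piF scaler_sumr -big_split; apply: eq_bigr => a _.
by rewrite /= mcoeffD mcoeffZ scalerDl scalerA.
Qed.

HB.instance Definition _ := GRing.isLinear.Build K Z F *:%R rhoF rho_linear.
HB.instance Definition _ := GRing.isLinear.Build K Z F *:%R piF pi_linear.

Lemma sum_mindexX d (u : mindex m d -> F) (a : mindex m d) :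
  \sum_(b : mindex m d) ('X_[a] : Z)@_b *: u b = u a.
Proof.
rewrite (bigD1 a) //= mcoeffX eqxx scale1r big1 ?addr0 // => b ba.
rewrite mcoeffX; case: eqVneq => [e|_]; last by rewrite scale0r.
by case/eqP: ba; apply/val_inj/val_inj.
Qed.

Lemma rhoX_rho M : mdeg M = 2%N -> rhoX K M = rhoF 'X_[M].
Proof. by case/mindexP => a ->; rewrite rhoE /rhoF sum_mindexX. Qed.

Lemma piX_pi M : mdeg M = 4%N -> piX K M = piF 'X_[M].
Proof. by case/mindexP => a ->; rewrite Defs.piE /piF sum_mindexX. Qed.

Lemma GL_rho_var g (a : mindex m 2) : GL_actF g (rho_var K a) = rhoF (lin g 'X_[a]).
Proof.
rewrite /rho_var /GL_actF substX enum_rankK; apply: eq_bigr => a' _; congr (_ *: _).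
apply: coord_GL => [j|j M|j|f]; [exact: qgen_neq0|exact: multidegree_qgen|
                       exact: qgen_polar2|exact: GL_actV_polar2].
Qed.

Lemma GL_pi_var g (b : mindex m 4) : GL_actF g (pi_var K b) = piF (lin g 'X_[b]).
Proof.
rewrite /pi_var /GL_actF substX enum_rankK; apply: eq_bigr => a' _; congr (_ *: _).
apply: coord_GL => [j|j M|j|f]; [exact: pgen_neq0|exact: multidegree_pgen|
                       exact: pgen_power4|exact: GL_actV_power4].
Qed.

Lemma GL_rho g f : GL_actF g (rhoF f) = rhoF (lin g f).
Proof.
rewrite {1}/rhoF linear_sum; under eq_bigr => a _ do rewrite linearZ /= GL_rho_var.
rewrite /rhoF; under [in RHS]eq_bigr => a _ do rewrite lin_coef scaler_suml.
rewrite exchange_big; apply: eq_bigr => b _ /=.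
by rewrite scaler_sumr; apply: eq_bigr => a _; rewrite scalerA.
Qed.

Lemma GL_pi g f : GL_actF g (piF f) = piF (lin g f).
Proof.
rewrite {1}/piF linear_sum; under eq_bigr => a _ do rewrite linearZ /= GL_pi_var.
rewrite /piF; under [in RHS]eq_bigr => a _ do rewrite lin_coef scaler_suml.
rewrite exchange_big; apply: eq_bigr => b _ /=.
by rewrite scaler_sumr; apply: eq_bigr => a _; rewrite scalerA.
Qed.

Lemma linM g h f : lin (g *m h) f = lin g (lin h f).
Proof.
rewrite [in RHS]/lin /linsubst -/(lin g _) (subst_comp (lin g)).
apply: subst_ext => j; rewrite /= linear_sum /=.
under [in RHS]eq_bigr => i _ do rewrite linearZ /= linX scaler_sumr.
rewrite exchange_big; apply: eq_bigr => i _ /=.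
rewrite !mxE scaler_suml; apply: eq_bigr => k _.
by rewrite scalerA mulrC.
Qed.

Lemma F_ind (P : F -> Prop) :
  P 1 -> (forall f g a, P f -> P g -> P (a *: f + g)) ->
  (forall a f, P f -> P (rhoF a * f)) -> (forall a f, P f -> P (piF a * f)) ->
  forall f, P f.
Proof.
move=> P1 PD Pr Pp f; elim/mpoly_indX: f => // k f Pf.
have <- := enum_valK k; case: (enum_val k) => [a|b].
  by rewrite -/(rho_var K a) -rhoE rhoX_rho ?mdeg_mindex //; exact: Pr.
by rewrite -/(pi_var K b) -Defs.piE piX_pi ?mdeg_mindex //; exact: Pp.
Qed.

Lemma GL_actF_mul (g h : 'M[K]_m) (f : F) : GL_actF (g *m h) f = GL_actF g (GL_actF h f).
Proof.
elim/F_ind: f => [|f k a IHf IHk|a f IH|b f IH]; first by rewrite !rmorph1.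
- by rewrite !linearP /= IHf IHk.
- by rewrite !rmorphM /= IH !GL_rho linM.
- by rewrite !rmorphM /= IH !GL_pi linM.
Qed.

Lemma polyfam_lin_shift g f : polyfam (fun t => lin (g + t%:M) f).
Proof.
apply: polyfam_subst => k; apply: polyfam_sum => i.
under eq_fun => t do rewrite !mxE scalerDl.
apply: polyfamD; first exact: polyfamC.
case: eqVneq => _; last by under eq_fun => t do rewrite mulr0n scale0r; exact: polyfamC.
by under eq_fun => t do rewrite mulr1n; exact: polyfam_id.
Qed.

Lemma polyfam_GL_shift (g : 'M[K]_m) (f : F) : polyfam (fun t => GL_actF (g + t%:M) f).
Proof.
elim/F_ind: f => [|f k a IHf IHk|a f IH|b f IH].
- by apply: (@polyfam_ext _ _ (fun=> 1)) => [t|]; [rewrite rmorph1|exact: polyfamC].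
- apply: (@polyfam_ext _ _
    (fun t => a *: GL_actF (g + t%:M) f + GL_actF (g + t%:M) k)) => [t|].
    by rewrite linearP.
  by apply: polyfamD => //; exact: (polyfam_lin ( *:%R a)).
- apply: (@polyfam_ext _ _
    (fun t => rhoF (lin (g + t%:M) a) * GL_actF (g + t%:M) f)) => [t|].
    by rewrite rmorphM /= GL_rho.
  by apply: polyfamM => //; apply: polyfam_lin; exact: polyfam_lin_shift.
- apply: (@polyfam_ext _ _
    (fun t => piF (lin (g + t%:M) b) * GL_actF (g + t%:M) f)) => [t|].
    by rewrite rmorphM /= GL_pi.
  by apply: polyfamM => //; apply: polyfam_lin; exact: polyfam_lin_shift.
Qed.

(** Identifies the exceptional [t] in the density argument with the roots of a monic polynomial. *)
Lemma char_poly_shift (g : 'M[K]_m) t : (char_poly (- g)).[t] = \det (g + t%:M).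
Proof.
rewrite -[LHS]/(horner_eval t _) -det_map_mx; congr (\det _).
apply/matrixP => i j; rewrite !mxE /= /horner_eval hornerD hornerN hornerC hornerMn hornerX.
by rewrite opprK addrC.
Qed.

(* Invertible matrices are dense: [g + t] is invertible for all but finitely many [t]. *)
Lemma GL_submodule_mx (W : set F) g f : GL_submodule W -> W f -> W (GL_actF g f).
Proof.
move=> [hW sW] Wf; have [p hp] := polyfam_GL_shift g f.
have : W p`_0.
  apply: (@subspace_poly _ _ W p (char_poly (- g))) => //.
    by rewrite monic_neq0 // char_poly_monic.
  by move=> t; rewrite char_poly_shift -hp => ut; apply: sW => //; rewrite unitmxE unitfE.
by rewrite -horner_coef0; have := hp 0; rewrite scale0r raddf0 addr0 => <-.
Qed.

End Symbols.

(** * The form on F and the adjoint of the action *)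

Section HermitianForm.
Variables (K : numClosedFieldType) (m : nat).
Notation Z := {mpoly K[m]}.
Notation N := #|{: mindex m 2 + mindex m 4}|.
Notation F := (FK K m).
Notation c1 := (fun _ : 'I_m => 1 : K).
Implicit Types (f h : F) (g : 'M[K]_m).

(* The generators [rho_a], [pi_b] behave like the monomials [z^a], [z^b]. *)
Definition gnorm (k : 'I_N) : K :=
  match enum_val k with
  | inl a => mnorm c1 (mnm_of a)
  | inr b => mnorm c1 (mnm_of b)
  end.

Lemma gnorm_gt0 k : 0 < gnorm k.
Proof. by rewrite /gnorm; case: (enum_val k) => a; apply: mnorm_gt0 => _; exact: ltr01. Qed.

Definition herm f h : K := fischer gnorm f h.

Definition adjmx g : 'M[K]_m := (map_mx Num.conj g)^T.

Lemma adjmxK g : adjmx (adjmx g) = g.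
Proof. by apply/matrixP => i j; rewrite !mxE conjCK. Qed.

Lemma adjmx_unit g : g \in unitmx -> adjmx g \in unitmx.
Proof. by rewrite /adjmx unitmx_tr map_unitmx. Qed.

Lemma lin_adjoint g (f h : Z) :
  fischer c1 (lin g f) h = fischer c1 f (lin (adjmx g) h).
Proof.
apply: fischer_adjoint => [k|k l]; first exact: ltr01.
by rewrite !mul1r !mxE conjCK.
Qed.

(** Adjointness on [Z] read off on a pair of monomials; this is the condition that [fischer_adjoint]
    asks of the weights [gnorm]. *)
Lemma symcoef_adj d g (a b : mindex m d) :
  mnorm c1 a * (lin g 'X_[b])@_a =
  mnorm c1 b * ((lin (adjmx g) 'X_[a])@_b)^*.
Proof.
have := lin_adjoint g 'X_[b] 'X_[a].
rewrite fischerX fischerC => [|k]; last exact: ltr01.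
rewrite fischerX rmorphM /= conjCK (conj_Creal (gtr0_real (mnorm_gt0 _ _))).
  by rewrite mulrC => ->; rewrite mulrC.
by move=> k; exact: ltr01.
Qed.

(** Block matrix of [g] on the variables of F: the rho and the pi do not mix. *)
Definition gcoef g (l k : 'I_N) : K :=
  match enum_val k, enum_val l with
  | inl a, inl a' => (lin g 'X_[mnm_of a])@_(mnm_of a')
  | inr b, inr b' => (lin g 'X_[mnm_of b])@_(mnm_of b')
  | _, _ => 0
  end.

Lemma GL_actF_linsubst g f : GL_actF g f = linsubst (gcoef g) f.
Proof.
apply: subst_ext => k; transitivity (GL_actF g 'X_k); first by rewrite [RHS]substX.
rewrite -{1}(enum_valK k) (reindex (@enum_rank (mindex m 2 + mindex m 4)%type)) /=; last first.
  by apply: onW_bij; exact: enum_rank_bij.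
rewrite big_sumType /= /gcoef.
under eq_bigr => a _ do rewrite enum_rankK.
under [X in _ + X]eq_bigr => a _ do rewrite enum_rankK.
case: (enum_val k) => [a|b].
  rewrite -/(rho_var K a) GL_rho_var [X in _ + X]big1 ?addr0 // => b _.
  by rewrite scale0r.
rewrite -/(pi_var K b) GL_pi_var big1 ?add0r // => a _.
by rewrite scale0r.
Qed.

Lemma herm_adjoint g f h : herm (GL_actF g f) h = herm f (GL_actF (adjmx g) h).
Proof.
rewrite !GL_actF_linsubst; apply: fischer_adjoint => [k|k l]; first exact: gnorm_gt0.
rewrite /gnorm /gcoef; case: (enum_val k) => a; case: (enum_val l) => b.
- exact: symcoef_adj.
- by rewrite rmorph0 !mulr0.
- by rewrite rmorph0 !mulr0.
- exact: symcoef_adj.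
Qed.

Lemma herm_sym f h : herm h f = (herm f h)^*.
Proof. exact: fischerC gnorm_gt0 f h. Qed.
Lemma hermDl f f' h : herm (f + f') h = herm f h + herm f' h.
Proof. exact: fischerDl. Qed.
Lemma hermZl a f h : herm (a *: f) h = a * herm f h.
Proof. exact: fischerZl. Qed.
Lemma herm0l h : herm 0 h = 0.
Proof. exact: fischer0l. Qed.
Lemma hermDr f f' h : herm h (f + f') = herm h f + herm h f'.
Proof. exact: fischerDr gnorm_gt0 _ _ _. Qed.
Lemma hermZr a f h : herm h (a *: f) = a^* * herm h f.
Proof. exact: fischerZr gnorm_gt0 _ _ _. Qed.
Lemma herm0r h : herm h 0 = 0.
Proof. exact: fischer0r gnorm_gt0 _. Qed.
Lemma herm_suml I (r : seq I) (P : pred I) (u : I -> F) h :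
  herm (\sum_(j <- r | P j) u j) h = \sum_(j <- r | P j) herm (u j) h.
Proof. exact: fischer_suml. Qed.
Lemma herm_sumr I (r : seq I) (P : pred I) (u : I -> F) h :
  herm h (\sum_(j <- r | P j) u j) = \sum_(j <- r | P j) herm h (u j).
Proof. exact: fischer_sumr gnorm_gt0 _ _ _ _ _. Qed.
Lemma herm_eq0 f : herm f f = 0 -> f = 0.
Proof. exact: fischer_eq0 gnorm_gt0 _. Qed.

End HermitianForm.

(** * Polarised relations *)

(* A product of signed sums of letters is computed as a signed list of sorted
   words; additive maps then become sums of values at words, on which [ring]
   decides the multilinear identities below. *)
Section Expansion.
Variables (Z F : comNzRingType) (f : {additive Z -> F}) (e : nat -> Z).

Inductive lexp := LVar of nat | LAdd of lexp & lexp | LOpp of lexp.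

Fixpoint lden (l : lexp) : Z :=
  match l with
  | LVar n => e n
  | LAdd l1 l2 => lden l1 + lden l2
  | LOpp l1 => - lden l1
  end.

Fixpoint lterms (l : lexp) : seq (bool * nat) :=
  match l with
  | LVar n => [:: (false, n)]
  | LAdd l1 l2 => lterms l1 ++ lterms l2
  | LOpp l1 => [seq (~~ p.1, p.2) | p <- lterms l1]
  end.

Fixpoint insert_nat (n : nat) (s : seq nat) : seq nat :=
  if s is k :: s' then if Nat.leb n k then n :: s else k :: insert_nat n s'
  else [:: n].

Definition letters (s : seq nat) : Z := foldr (fun n z => e n * z) 1 s.

Definition expand (ls : seq lexp) : seq (bool * seq nat) :=
  foldr (fun l acc => [seq (x.1 (+) y.1, insert_nat x.2 y.2) | x <- lterms l, y <- acc])
        [:: (false, [::])] ls.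

Definition signed (A : zmodType) (b : bool) (x : A) : A := if b then - x else x.

Definition expanded (ls : seq lexp) : F :=
  foldr (fun p acc => signed p.1 (f (letters p.2)) + acc) 0 (expand ls).

Lemma lden_lterms l : lden l = \sum_(p <- lterms l) signed p.1 (e p.2).
Proof.
elim: l => [n|l1 IH1 l2 IH2|l IH] /=; first by rewrite big_seq1.
  by rewrite big_cat /= IH1 IH2.
rewrite big_map IH -sumrN; apply: eq_bigr => -[b n] _ /=.
by case: b; rewrite /signed ?opprK.
Qed.

Lemma letters_insert n s : letters (insert_nat n s) = e n * letters s.
Proof.
by elim: s => //= k s IH; case: ifP => //= _; rewrite IH mulrCA.
Qed.

Lemma expandE ls :
  foldr *%R 1 (map lden ls) = \sum_(p <- expand ls) signed p.1 (letters p.2).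
Proof.
elim: ls => [|l ls IH] /=; first by rewrite big_seq1.
rewrite lden_lterms IH big_allpairs_dep mulr_suml; apply: eq_bigr => -[b n] _ /=.
rewrite mulr_sumr; apply: eq_bigr => -[b' s] _ /=; rewrite letters_insert.
by case: b; case: b'; rewrite /signed /= ?mulNr ?mulrN ?opprK.
Qed.

Lemma expandedE ls : f (foldr *%R 1 (map lden ls)) = expanded ls.
Proof.
rewrite expandE /expanded; elim: (expand ls) => [|[b s] r IH] /=.
  by rewrite big_nil raddf0.
by rewrite big_cons raddfD IH; case: b; rewrite /signed /= ?raddfN.
Qed.

End Expansion.

Ltac letter_index e a :=
  lazymatch e with
  | a :: _ => constr:(O)
  | _ :: ?e' => let n := letter_index e' a in constr:(S n)
  end.

Ltac reify_lexp e t :=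
  lazymatch t with
  | ?u + ?v => let p := reify_lexp e u in let q := reify_lexp e v in
               constr:(LAdd p q)
  | - ?u => let p := reify_lexp e u in constr:(LOpp p)
  | _ => let n := letter_index e t in constr:(LVar n)
  end.

Section Relations.
Variables (Z F : comNzRingType) (rho pi : {additive Z -> F}).
Implicit Types (a b c d e x y z : Z).

Definition q2 x y : F := rho (x * y).
Definition q4 x y z t : F := pi (x * y * z * t).

Lemma q2_expand (e : nat -> Z) (k l : lexp) :
  q2 (lden e k) (lden e l) = expanded rho e [:: k; l].
Proof. by rewrite -expandedE /= mulr1. Qed.

Lemma q4_expand (e : nat -> Z) (k l k' l' : lexp) :
  q4 (lden e k) (lden e l) (lden e k') (lden e l') = expanded pi e [:: k; l; k'; l'].
Proof. by rewrite -expandedE /= mulr1 !mulrA. Qed.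

Inductive sexp :=
| S2 of lexp & lexp
| S4 of lexp & lexp & lexp & lexp
| SAdd of sexp & sexp
| SMul of sexp & sexp
| SOpp of sexp
| SExp of sexp & nat
| SCst of F.

Fixpoint sden (e : nat -> Z) (s : sexp) : F :=
  match s with
  | S2 k l => q2 (lden e k) (lden e l)
  | S4 k l k' l' => q4 (lden e k) (lden e l) (lden e k') (lden e l')
  | SAdd s1 s2 => sden e s1 + sden e s2
  | SMul s1 s2 => sden e s1 * sden e s2
  | SOpp s1 => - sden e s1
  | SExp s1 n => sden e s1 ^+ n
  | SCst c => c
  end.

Fixpoint sexpanded (e : nat -> Z) (s : sexp) : F :=
  match s with
  | S2 k l => expanded rho e [:: k; l]
  | S4 k l k' l' => expanded pi e [:: k; l; k'; l']
  | SAdd s1 s2 => sexpanded e s1 + sexpanded e s2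
  | SMul s1 s2 => sexpanded e s1 * sexpanded e s2
  | SOpp s1 => - sexpanded e s1
  | SExp s1 n => sexpanded e s1 ^+ n
  | SCst c => c
  end.

Lemma sexpandedE (e : nat -> Z) s : sden e s = sexpanded e s.
Proof.
elim: s => /= [k l|k l k' l'|s1 -> s2 ->|s1 -> s2 ->|s1 ->|s1 -> n|c] //.
  exact: q2_expand.
exact: q4_expand.
Qed.

Definition disc a b : F := q2 a b ^+ 2 - q2 a a * q2 b b.

Definition r222 a b c : F :=
  q2 a a * (q2 b b * q2 c c - q2 b c ^+ 2)
  - q2 a b * (q2 a b * q2 c c - q2 b c * q2 a c)
  + q2 a c * (q2 a b * q2 b c - q2 b b * q2 a c).

Definition r42 a b : F :=
  q4 a a a a * q2 b b - 2 * q4 a a a b * q2 a b + q4 a a b b * q2 a a.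

Definition r62 a b : F :=
  - q4 a a a b ^+ 2 + q4 a a a a * q4 a a b b - 4 * q2 a a ^+ 2 * disc a b.

Definition r44 a b : F :=
  3 * q4 a a b b ^+ 2 + q4 a a a a * q4 b b b b - 4 * q4 a a a b * q4 a b b b
  - 16 * disc a b ^+ 2.

(* Maps to the product of [x_a x_b + y_a y_b] and [x_c x_d + y_c y_d]. *)
Definition dprod a b c d : F :=
  q4 a b c d + 2 * (q2 a c * q2 b d + q2 a d * q2 b c - q2 a b * q2 c d).

(** Minus its copy with [b] and [c] exchanged, this is the Kulkarni-Nomizu product of the symmetric
    forms rho and D_..xy, a tensor with the symmetries of a curvature tensor. *)
Definition curv a b c d x y : F := q2 a b * dprod c d x y + q2 c d * dprod a b x y.

Variables (lf : Z -> Prop) (J : F -> Prop).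
Hypothesis lfD : forall a b, lf a -> lf b -> lf (a + b).
Hypothesis lfN : forall a, lf a -> lf (- a).
Hypothesis JD : forall u v, J u -> J v -> J (u + v).
Hypothesis JM : forall u v, J v -> J (u * v).
Hypothesis Jdiv : forall n u, J (n.+1%:R * u) -> J u.
Hypothesis J222 : forall a b c, lf a -> lf b -> lf c -> J (r222 a b c).
Hypothesis J42 : forall a b, lf a -> lf b -> J (r42 a b).
Hypothesis J62 : forall a b, lf a -> lf b -> J (r62 a b).
Hypothesis J44 : forall a b, lf a -> lf b -> J (r44 a b).

Ltac reify_sexp l t :=
  lazymatch t with
  | q2 ?x ?y => let x' := reify_lexp l x in let y' := reify_lexp l y in
      constr:(S2 x' y')
  | q4 ?x ?y ?z ?u =>
      let x' := reify_lexp l x in let y' := reify_lexp l y in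
      let z' := reify_lexp l z in let u' := reify_lexp l u in
      constr:(S4 x' y' z' u')
  | ?u + ?v => let p := reify_sexp l u in let q := reify_sexp l v in
      constr:(SAdd p q)
  | ?u * ?v => let p := reify_sexp l u in let q := reify_sexp l v in
      constr:(SMul p q)
  | - ?u => let p := reify_sexp l u in constr:(SOpp p)
  | ?u ^+ ?n => let p := reify_sexp l u in constr:(SExp p n)
  | _ => constr:(SCst t)
  end.

Ltac expand_symbols l :=
  let e := constr:(nth 0 l) in
  lazymatch goal with
  | |- ?u = ?v => let u' := reify_sexp l u in let v' := reify_sexp l v in
      transitivity (sden e u'); [reflexivity|];
      transitivity (sden e v'); [|reflexivity]
  end;
  rewrite !sexpandedE;
  cbv beta iota zeta delta [sexpanded expanded expand foldr lterms map cat fst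
    snd addb negb insert_nat Nat.leb signed allpairs_dep flatten].

Lemma JB u v : J u -> J v -> J (u - v).
Proof. by move=> Ju Jv; apply: JD => //; rewrite -mulN1r; exact: JM. Qed.

(** [r42] has degree 4 in its first argument, so the second difference [p] is twice its part of
    bidegree (2, 2). Three such parts and [r222] have multidegree (2, 2, 2), and a linear
    combination of them gives 40 times the claim. [Jdiv n] cancels [n.+1], whence 39. *)
Lemma J_curv_squares a b c : lf a -> lf b -> lf c ->
  J (q2 a a * dprod b b c c + q2 b b * dprod a a c c - 2 * q2 a b * dprod a b c c).
Proof.
move=> la lb lc; pose p x y z := r42 (x + y) z + r42 (x - y) z - 2 * r42 x z - 2 * r42 y z.
apply: (@Jdiv 39).
have -> : 40%:R * (q2 a a * dprod b b c c + q2 b b * dprod a a c c - 2 * q2 a b * dprod a b c c)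
  = - p a b c + 3 * p a c b + 3 * p b c a - 160 * r222 a b c.
  rewrite /p /dprod /r42 /r222.
  by expand_symbols [:: a; b; c]; ring.
have pJ x y z : lf x -> lf y -> lf z -> J (p x y z).
  move=> lx ly lz; apply: JB; last by apply: JM; exact: J42.
  apply: JB; last by apply: JM; exact: J42.
  by apply: JD; apply: J42 => //; apply: lfD => //; exact: lfN.
apply: JB; last by apply: JM; exact: J222.
apply: JD; last by apply: JM; exact: pJ.
by apply: JD; [rewrite -mulN1r|]; apply: JM; exact: pJ.
Qed.

Lemma J_polar (u : Z -> F) a b : (forall x, lf x -> J (u x)) -> lf a -> lf b ->
  J (u (a + b) - u a - u b).
Proof. by move=> Ju la lb; apply: JB; [apply: JB|]; auto. Qed.

(** As sectional curvatures determine the curvature tensor: the case of equal pairs is polarised in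
    the last two slots, then in [u], then in [v], and a Bianchi-type difference of two copies of
    [n3] isolates three times the tensor. *)
Lemma J_curv_pairs a b c d x y : lf a -> lf b -> lf c -> lf d -> lf x -> lf y ->
  J (curv a b c d x y - curv a c b d x y).
Proof.
pose n u v w : F := q2 u u * dprod v v w w + q2 v v * dprod u u w w - 2 * q2 u v * dprod u v w w.
pose n1 u v w w' : F :=
  q2 u u * dprod v v w w' + q2 v v * dprod u u w w' - 2 * q2 u v * dprod u v w w'.
pose n2 u u' v w w' : F := q2 u u' * dprod v v w w' + q2 v v * dprod u u' w w'
  - q2 u v * dprod u' v w w' - q2 u' v * dprod u v w w'.
pose n3 u u' v v' w w' : F :=
  2 * curv u u' v v' w w' - curv u v u' v' w w' - curv u v' u' v w w'.
have n1J u v w w' : lf u -> lf v -> lf w -> lf w' -> J (n1 u v w w').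
  move=> lu lv lw lw'; apply: (@Jdiv 1).
  have -> : 2%:R * n1 u v w w' = n u v (w + w') - n u v w - n u v w'.
    by rewrite /n1 /n /dprod; expand_symbols [:: u; v; w; w']; ring.
  by apply: J_polar => // z lz; exact: J_curv_squares.
have n2J u u' v w w' : lf u -> lf u' -> lf v -> lf w -> lf w' -> J (n2 u u' v w w').
  move=> lu lu' lv lw lw'; apply: (@Jdiv 1).
  have -> : 2%:R * n2 u u' v w w' = n1 (u + u') v w w' - n1 u v w w' - n1 u' v w w'.
    by rewrite /n2 /n1 /dprod; expand_symbols [:: u; u'; v; w; w']; ring.
  by apply: (@J_polar (fun u => n1 u v w w')) => // z lz; exact: n1J.
have n3J u u' v v' w w' : lf u -> lf u' -> lf v -> lf v' -> lf w -> lf w' ->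
    J (n3 u u' v v' w w').
  move=> lu lu' lv lv' lw lw'.
  have -> : n3 u u' v v' w w' = n2 u u' (v + v') w w' - n2 u u' v w w' - n2 u u' v' w w'.
    by rewrite /n3 /n2 /curv /dprod; expand_symbols [:: u; u'; v; v'; w; w']; ring.
  by apply: (@J_polar (fun v => n2 u u' v w w')) => // z lz; exact: n2J.
move=> la lb lc ld lx ly; apply: (@Jdiv 2).
have -> : 3%:R * (curv a b c d x y - curv a c b d x y) = n3 a b c d x y - n3 a c b d x y.
  by rewrite /n3 /curv /dprod; expand_symbols [:: a; b; c; d; x; y]; ring.
by apply: JB; exact: n3J.
Qed.

(* The coefficient of [s^2] in [r62 (l + s d) b], polarised in [b]. *)
Definition r62_polar2 l d b b' : F :=
  - 2 * (3 * q4 l d d b * q4 l l l b' + 9 * q4 l l d b * q4 l l d b'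
         + 3 * q4 l l l b * q4 l d d b')
  + 2 * (q4 l l l l * q4 d d b b' + 8 * q4 l l l d * q4 l d b b'
         + 6 * q4 l l d d * q4 l l b b')
  - 8 * (q2 l l ^+ 2 * q2 d b * q2 d b'
         + 4 * q2 l l * q2 l d * (q2 d b * q2 l b' + q2 l b * q2 d b')
         + (2 * q2 l l * q2 d d + 4 * q2 l d ^+ 2) * q2 l b * q2 l b'
         - q2 b b' * (3 * q2 l l ^+ 2 * q2 d d + 12 * q2 l l * q2 l d ^+ 2)).

Lemma J_r62_polar2 l d b b' : lf l -> lf d -> lf b -> lf b' -> J (r62_polar2 l d b b').
Proof.
pose s l b b' : F := 2 * (q4 l l l l * q4 l l b b' - q4 l l l b * q4 l l l b'
  - 4 * q2 l l ^+ 2 * (q2 l b * q2 l b' - q2 l l * q2 b b')).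
have sJ u v v' : lf u -> lf v -> lf v' -> J (s u v v').
  move=> lu lv lv'.
  have -> : s u v v' = r62 u (v + v') - r62 u v - r62 u v'.
    by rewrite /s /r62 /disc; expand_symbols [:: u; v; v']; ring.
  by apply: J_polar => // z lz; exact: J62.
pose s1 d : F := s (l + d) b b' + s (l - d) b b'.
move=> ll ld lb lb'; apply: (@Jdiv 23).
have s1J u : lf u -> J (s1 u).
  by move=> lu; apply: JD; apply: sJ => //; apply: lfD => //; exact: lfN.
(* [s] has degree 6 in its first argument. If c_k is the part of degree k in [d] of s (l + d), the
   brackets are 2 c_2 + 2 c_4 and 8 c_2 + 32 c_4, where 128 = 2 * 2^6 removes c_6; eliminating c_4
   leaves 24 c_2. *)
have -> : 24%:R * r62_polar2 l d b b' =
    16 * (s1 d - 2 * s l b b' - 2 * s d b b')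
    - (s1 (d + d) - 2 * s l b b' - 128 * s d b b').
  rewrite /s1 /s /r62_polar2.
  expand_symbols [:: l; d; b; b'].
  ring.
apply: JB.
  by apply: JM; apply: JB; [apply: JB; [exact: s1J|]|]; apply: JM; exact: sJ.
by apply: JB; [apply: JB; [apply: s1J; exact: lfD|]|]; apply: JM; exact: sJ.
Qed.

(* The coefficient of [s^2] in [r62_polar2 (l + s c) d b b']. *)
Definition r62_polar22 l c d b b' : F :=
  let w b := q2 l l * q2 c d * q2 c b
    + 2 * q2 l c * (q2 c d * q2 l b + q2 l d * q2 c b) + q2 c c * q2 l d * q2 l b in
  - 2 * (9 * (q4 l d d b * q4 l c c b' + q4 c d d b * q4 l l c b'
              + q4 l l d b * q4 c c d b' + 4 * q4 l c d b * q4 l c d b'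
              + q4 c c d b * q4 l l d b' + q4 l c c b * q4 l d d b'
              + q4 l l c b * q4 c d d b'))
  + 2 * (6 * q4 l l c c * q4 d d b b'
         + 24 * (q4 l c c d * q4 l d b b' + q4 l l c d * q4 c d b b')
         + 6 * (q4 l l d d * q4 c c b b' + 4 * q4 l c d d * q4 l c b b'
                + q4 c c d d * q4 l l b b'))
  - 8 * ((2 * q2 l l * q2 c c + 4 * q2 l c ^+ 2) * q2 d b * q2 d b'
         + 4 * (q2 d b * w b' + q2 d b' * w b)
         + 2 * q2 d d * (q2 l l * q2 c b * q2 c b'
             + 2 * q2 l c * (q2 c b * q2 l b' + q2 l b * q2 c b')
             + q2 c c * q2 l b * q2 l b')
         + 4 * (q2 l d ^+ 2 * q2 c b * q2 c b'
             + 2 * q2 l d * q2 c d * (q2 c b * q2 l b' + q2 l b * q2 c b')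
             + q2 c d ^+ 2 * q2 l b * q2 l b')
         - q2 b b' * (3 * q2 d d * (2 * q2 l l * q2 c c + 4 * q2 l c ^+ 2)
             + 12 * (q2 l l * q2 c d ^+ 2 + 4 * q2 l c * q2 l d * q2 c d
                     + q2 c c * q2 l d ^+ 2))).

(** In an argument of degree 4, summing over both signs keeps the even terms, and subtracting the
    two extreme ones leaves twice the middle one. The polarisations of [r44] below use the same
    second difference. *)
Lemma J_r62_polar22 l c d b b' : lf l -> lf c -> lf d -> lf b -> lf b' -> J (r62_polar22 l c d b b').
Proof.
move=> ll lc ld lb lb'; apply: (@Jdiv 1).
have -> : 2%:R * r62_polar22 l c d b b' = r62_polar2 (l + c) d b b' + r62_polar2 (l - c) d b b'
    - 2 * r62_polar2 l d b b' - 2 * r62_polar2 c d b b'.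
  rewrite /r62_polar22 /r62_polar2.
  expand_symbols [:: l; c; d; b; b'].
  ring.
apply: JB; last by apply: JM; exact: J_r62_polar2.
apply: JB; last by apply: JM; exact: J_r62_polar2.
by apply: JD; apply: J_r62_polar2 => //; apply: lfD => //; exact: lfN.
Qed.

(* The coefficient of [s^2] in [r44 (a + s b) c]. *)
Definition r44_polar2 a b c : F :=
  3 * (2 * q4 a a c c * q4 b b c c + 4 * q4 a b c c ^+ 2)
  + 6 * q4 a a b b * q4 c c c c
  - 12 * (q4 a b b c * q4 a c c c + q4 a a b c * q4 b c c c)
  - 16 * (2 * disc a c * disc b c + 4 * (q2 a c * q2 b c - q2 a b * q2 c c) ^+ 2).

Lemma J_r44_polar2 a b c : lf a -> lf b -> lf c -> J (r44_polar2 a b c).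
Proof.
move=> la lb lc; apply: (@Jdiv 1).
have -> : 2%:R * r44_polar2 a b c =
    r44 (a + b) c + r44 (a - b) c - 2 * r44 a c - 2 * r44 b c.
  by rewrite /r44_polar2 /r44 /disc; expand_symbols [:: a; b; c]; ring.
apply: JB; last by apply: JM; exact: J44.
apply: JB; last by apply: JM; exact: J44.
by apply: JD; apply: J44 => //; apply: lfD => //; exact: lfN.
Qed.

(* The coefficient of [s^2] in [r44_polar2 a b (c + s d)]. *)
Definition r44_polar22 a b c d : F :=
  6 * (q4 a a d d * q4 b b c c + 4 * q4 a a c d * q4 b b c d + q4 a a c c * q4 b b d d)
  + 24 * (q4 a b c c * q4 a b d d + 2 * q4 a b c d ^+ 2)
  + 36 * (q4 a a b b * q4 c c d d - q4 a b b c * q4 a c d d - q4 a b b d * q4 a c c d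
          - q4 a a b c * q4 b c d d - q4 a a b d * q4 b c c d)
  - 32 * (disc a c * disc b d + disc a d * disc b c
          + 4 * (q2 a c * q2 a d - q2 a a * q2 c d) * (q2 b c * q2 b d - q2 b b * q2 c d))
  - 64 * ((q2 a c * q2 b d + q2 a d * q2 b c - 2 * q2 a b * q2 c d) ^+ 2
          + 2 * (q2 a c * q2 b c - q2 a b * q2 c c) * (q2 a d * q2 b d - q2 a b * q2 d d)).

Lemma J_r44_polar22 a b c d : lf a -> lf b -> lf c -> lf d -> J (r44_polar22 a b c d).
Proof.
move=> la lb lc ld; apply: (@Jdiv 1).
have -> : 2%:R * r44_polar22 a b c d = r44_polar2 a b (c + d) + r44_polar2 a b (c - d)
    - 2 * r44_polar2 a b c - 2 * r44_polar2 a b d.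
  by rewrite /r44_polar22 /r44_polar2 /disc; expand_symbols [:: a; b; c; d]; ring.
apply: JB; last by apply: JM; exact: J_r44_polar2.
apply: JB; last by apply: JM; exact: J_r44_polar2.
by apply: JD; apply: J_r44_polar2 => //; apply: lfD => //; exact: lfN.
Qed.

(** The only place where [r62] and [r44] enter. Repeated letters bring the minor to multidegree (2,
    2, 2, 2), where it is a combination of their double polarisations and of the exchanges of [curv]
    multiplied by rho. *)
Lemma J_minor4 a b c d : lf a -> lf b -> lf c -> lf d ->
  J (dprod a a b b * dprod c c d d - dprod a a c c * dprod b b d d).
Proof.
pose t a b c d x y := curv a b c d x y - curv a c b d x y.
(* The coefficients solve a linear system in the multidegree (2, 2, 2, 2). *)
pose E a b c d := 20 * r62_polar22 a c d b b + 28 * r44_polar22 a b c d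
  + 40 * (r62_polar22 (a + b) c d a b - r62_polar22 a c d a b - r62_polar22 b c d a b)
  + 4 * (- 1120 * t a d b d c c * q2 a b - 1260 * t b b c d c d * q2 a a
         - 1400 * t a c b d c d * q2 a b - 700 * t c d c d a a * q2 b b
         - 560 * t a b a b c c * q2 d d - 1400 * t a d c c a b * q2 b d
         + 2520 * t a a c d b b * q2 c d + 560 * t a b c d b c * q2 a d).
move=> la lb lc ld.
apply: (@Jdiv 2519).
(* The minor changes sign when [b] and [c] are exchanged, so it is sought as the antisymmetrisation
   of a single [E]. *)
have -> : 2520%:R * (dprod a a b b * dprod c c d d - dprod a a c c * dprod b b d d) =
    E a b c d - E a c b d.
  rewrite /E /t /curv /dprod /r62_polar22 /r44_polar22 /disc.
  expand_symbols [:: a; b; c; d].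
  ring.
have tJM k u v w z x y q : lf u -> lf v -> lf w -> lf z -> lf x -> lf y ->
    J (k * t u v w z x y * q).
  by move=> *; rewrite mulrAC; apply: JM; exact: J_curv_pairs.
have EJ u v w z : lf u -> lf v -> lf w -> lf z -> J (E u v w z).
  move=> lu lv lw lz; apply: JD; last first.
    by apply: JM; do 7?[apply: JB || apply: JD]; apply: tJM.
  apply: JD; last first.
    apply: JM; apply: (@J_polar (fun l => r62_polar22 l w z u v)) => // l ll.
    exact: J_r62_polar22.
  by apply: JD; apply: JM; [exact: J_r62_polar22|exact: J_r44_polar22].
by apply: JB; exact: EJ.
Qed.

(* [dprod] is bilinear on pairs of quadratic forms, and squares span. *)
Lemma J_minor a b c d a' b' c' d' : lf a -> lf b -> lf c -> lf d ->
    lf a' -> lf b' -> lf c' -> lf d' ->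
  J (dprod a a' b b' * dprod c c' d d' - dprod a a' c c' * dprod b b' d d').
Proof.
pose n a a' b b' c c' d d' := dprod a a' b b' * dprod c c' d d' - dprod a a' c c' * dprod b b' d d'.
have ddA x y z z' : dprod (x + y) (x + y) z z' = dprod x x z z' + dprod y y z z' + 2 * dprod x y z z'.
  by rewrite /dprod; expand_symbols [:: x; y; z; z']; ring.
have ddC x y z t : dprod x y z t = dprod z t x y.
  by rewrite /dprod; expand_symbols [:: x; y; z; t]; ring.
have J1 u u' x y z : lf u -> lf u' -> lf x -> lf y -> lf z -> J (n u u' x x y y z z).
  move=> lu lu' lx ly lz; apply: (@Jdiv 1).
  have -> : 2%:R * n u u' x x y y z z = n (u + u') (u + u') x x y y z z
      - n u u x x y y z z - n u' u' x x y y z z by rewrite /n !ddA; ring.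
  by apply: (@J_polar (fun u => n u u x x y y z z)) => // v lv; exact: J_minor4.
have J2 u u' x x' y z : lf u -> lf u' -> lf x -> lf x' -> lf y -> lf z ->
    J (n u u' x x' y y z z).
  move=> lu lu' lx lx' ly lz; apply: (@Jdiv 1).
  have -> : 2%:R * n u u' x x' y y z z = n u u' (x + x') (x + x') y y z z
      - n u u' x x y y z z - n u u' x' x' y y z z.
    by rewrite /n !(ddC u u') !ddA; ring.
  by apply: (@J_polar (fun x => n u u' x x y y z z)) => // v lv; exact: J1.
have J3 u u' x x' y y' z : lf u -> lf u' -> lf x -> lf x' -> lf y -> lf y' -> lf z ->
    J (n u u' x x' y y' z z).
  move=> lu lu' lx lx' ly ly' lz; apply: (@Jdiv 1).
  have -> : 2%:R * n u u' x x' y y' z z = n u u' x x' (y + y') (y + y') z z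
      - n u u' x x' y y z z - n u u' x x' y' y' z z.
    by rewrite /n !(ddC u u') !ddA; ring.
  by apply: (@J_polar (fun y => n u u' x x' y y z z)) => // v lv; exact: J2.
move=> la lb lc ld la' lb' lc' ld'; apply: (@Jdiv 1).
have -> : 2%:R * (dprod a a' b b' * dprod c c' d d' - dprod a a' c c' * dprod b b' d d') =
    n a a' b b' c c' (d + d') (d + d')
      - n a a' b b' c c' d d - n a a' b b' c c' d' d'.
  by rewrite /n !(ddC _ _ (_ + _)) !ddA -!(ddC _ _ d) -!(ddC _ _ d'); ring.
by apply: (@J_polar (fun d => n a a' b b' c c' d d)) => // v lv; exact: J3.
Qed.

End Relations.

(** * Highest weight properties of the relations *)

Section Covariance.
Variables (K : numClosedFieldType) (Z F : comAlgType K) (rho pi : {linear Z -> F}).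
Implicit Types (a b c x y : Z) (s t : K).
Notation qq2 := (q2 rho).
Notation qq4 := (q4 pi).

Lemma q2C a b : qq2 a b = qq2 b a.
Proof. by rewrite /q2 mulrC. Qed.

Lemma q2Dl a b c : qq2 (a + b) c = qq2 a c + qq2 b c.
Proof. by rewrite /q2 mulrDl raddfD. Qed.

Lemma q2Zl t a b : qq2 (t *: a) b = t%:A * qq2 a b.
Proof. by rewrite mulr_algl /q2 -scalerAl; exact: (linearZ_LR rho). Qed.

Lemma q4C12 a b x y : qq4 a b x y = qq4 b a x y.
Proof. by rewrite /q4 [a * b]mulrC. Qed.

Lemma q4C13 a b x y : qq4 a b x y = qq4 x b a y.
Proof. by rewrite /q4; congr (pi _); ring. Qed.

Lemma q4C14 a b x y : qq4 a b x y = qq4 y b x a.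
Proof. by rewrite /q4; congr (pi _); ring. Qed.

Lemma q4C23 a b x y : qq4 x a b y = qq4 x b a y.
Proof. by rewrite /q4; congr (pi _); ring. Qed.

Lemma q4C34 a b x y : qq4 x y a b = qq4 x y b a.
Proof. by rewrite /q4; congr (pi _); ring. Qed.

(** Adjacent transpositions oriented towards [a] before [b]: repeated rewriting sorts the arguments
    of each symbol, after which [ring] recognises equal ones. *)
Definition swapE a b := (q2C b a, q4C12 b a, q4C23 b a, q4C34 b a).

Lemma q4Dl a b x y c : qq4 (a + b) x y c = qq4 a x y c + qq4 b x y c.
Proof. by rewrite /q4 !mulrDl raddfD. Qed.

Lemma q4Zl t a x y c : qq4 (t *: a) x y c = t%:A * qq4 a x y c.
Proof. by rewrite mulr_algl /q4 -!scalerAl; exact: (linearZ_LR pi). Qed.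

Lemma q2Dr a b c : qq2 c (a + b) = qq2 c a + qq2 c b.
Proof. by rewrite q2C q2Dl !(q2C c). Qed.

Lemma q2Zr t a b : qq2 b (t *: a) = t%:A * qq2 b a.
Proof. by rewrite q2C q2Zl (q2C b). Qed.

Lemma q4Z2 t a x y c : qq4 x (t *: a) y c = t%:A * qq4 x a y c.
Proof. by rewrite q4C12 q4Zl q4C12. Qed.
Lemma q4Z3 t a x y c : qq4 x y (t *: a) c = t%:A * qq4 x y a c.
Proof. by rewrite q4C13 q4Zl q4C13. Qed.
Lemma q4Z4 t a x y c : qq4 x y c (t *: a) = t%:A * qq4 x y c a.
Proof. by rewrite q4C14 q4Zl q4C14. Qed.
Lemma q4D2 a b x y c : qq4 x (a + b) y c = qq4 x a y c + qq4 x b y c.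
Proof. by rewrite q4C12 q4Dl !(q4C12 x). Qed.
Lemma q4D3 a b x y c : qq4 x y (a + b) c = qq4 x y a c + qq4 x y b c.
Proof. by rewrite q4C13 q4Dl q4C13 (q4C13 b). Qed.
Lemma q4D4 a b x y c : qq4 x y c (a + b) = qq4 x y c a + qq4 x y c b.
Proof. by rewrite q4C14 q4Dl q4C14 (q4C14 b). Qed.

Definition qE := (q2Dl, q2Dr, q2Zl, q2Zr, q4Dl, q4D2, q4D3, q4D4, q4Zl, q4Z2, q4Z3, q4Z4).

Notation qr222 := (r222 rho).
Notation qr42 := (r42 rho pi).
Notation qr62 := (r62 rho pi).
Notation qr44 := (r44 rho pi).

(* What makes [r (a, b)] a highest weight vector of weight [(n1, n2)] for [a, b] basis vectors. *)
Definition covariant (r : Z -> Z -> F) n1 n2 :=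
  [/\ forall s t a b, r (s *: a) (t *: b) = (s ^+ n1 * t ^+ n2) *: r a b,
      forall t a b, r a (b + t *: a) = r a b
    & forall (u v : K -> Z), polyfam u -> polyfam v -> polyfam (fun s => r (u s) (v s))].

Lemma polyfamN (A : comAlgType K) (u : K -> A) : polyfam u -> polyfam (fun t => - u t).
Proof. by move=> [p hp]; exists (- p) => t; rewrite hornerN hp. Qed.

Lemma polyfamX (A : comAlgType K) (u : K -> A) n :
  polyfam u -> polyfam (fun t => u t ^+ n).
Proof. by move=> [p hp]; exists (p ^+ n) => t; rewrite horner_exp hp. Qed.

Lemma polyfam_q2 (u v : K -> Z) : polyfam u -> polyfam v -> polyfam (fun s => qq2 (u s) (v s)).
Proof. by move=> hu hv; apply: polyfam_lin; exact: polyfamM. Qed.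

Lemma polyfam_q4 (u v u' v' : K -> Z) : polyfam u -> polyfam v -> polyfam u' ->
  polyfam v' -> polyfam (fun s => qq4 (u s) (v s) (u' s) (v' s)).
Proof. by move=> *; apply: polyfam_lin; do !apply: polyfamM. Qed.

Ltac polyfam :=
  repeat first [assumption | apply: polyfamC | apply: polyfam_q2 | apply: polyfam_q4
    | apply: polyfamN | apply: polyfamX | apply: polyfamD | apply: polyfamM].

Lemma algM s t : (s * t)%:A = s%:A * t%:A :> F.
Proof. by rewrite mulr_algl scalerA. Qed.

Lemma algX s n : (s ^+ n)%:A = s%:A ^+ n :> F.
Proof. by rewrite exprZn expr1n. Qed.

Lemma covariant_r42 : covariant qr42 4 2.
Proof.
split=> [s t a b|t a b|u v hu hv]; rewrite /r42.
- by rewrite -[RHS]mulr_algl algM !algX !qE; ring.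
- by rewrite !qE !(swapE a b); ring.
- by polyfam.
Qed.

Lemma covariant_r62 : covariant qr62 6 2.
Proof.
split=> [s t a b|t a b|u v hu hv]; rewrite /r62 /disc.
- by rewrite -[RHS]mulr_algl algM !algX !qE; ring.
- by rewrite !qE !(swapE a b); ring.
- by polyfam.
Qed.

Lemma covariant_r44 : covariant qr44 4 4.
Proof.
split=> [s t a b|t a b|u v hu hv]; rewrite /r44 /disc.
- by rewrite -[RHS]mulr_algl algM !algX !qE; ring.
- by rewrite !qE !(swapE a b); ring.
- by polyfam.
Qed.

Lemma r44C a b : qr44 a b = qr44 b a.
Proof.
by rewrite /r44 /disc !(swapE a b); ring.
Qed.

Lemma r222Z t a b c : qr222 (t *: a) (t *: b) (t *: c) = t ^+ 6 *: qr222 a b c.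
Proof. by rewrite /r222 -[RHS]mulr_algl algX !qE; ring. Qed.

(** [r222] is the Gram determinant of the symmetric bilinear form [q2], so a change of vectors
    multiplies it by the square of the determinant of [g], which vanishes with the last row. *)
Lemma r222_gram (g : 'I_3 -> 'I_3 -> K) a b c :
  let l j := g 0 j *: a + g 1 j *: b + g 2%:R j *: c in
  exists d, qr222 (l 0) (l 1) (l 2%:R) = d *: qr222 a b c /\
    ((forall j, g 2%:R j = 0) -> d = 0).
Proof.
pose d := g 0 0 * (g 1 1 * g 2%:R 2%:R - g 1 2%:R * g 2%:R 1)
  - g 0 1 * (g 1 0 * g 2%:R 2%:R - g 1 2%:R * g 2%:R 0)
  + g 0 2%:R * (g 1 0 * g 2%:R 1 - g 1 1 * g 2%:R 0).
exists (d ^+ 2); split=> [|g0]; last by rewrite /d !g0; ring.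
rewrite -[RHS]mulr_algl algX.
have -> : d%:A = (g 0 0)%:A * ((g 1 1)%:A * (g 2%:R 2%:R)%:A - (g 1 2%:R)%:A * (g 2%:R 1)%:A)
  - (g 0 1)%:A * ((g 1 0)%:A * (g 2%:R 2%:R)%:A - (g 1 2%:R)%:A * (g 2%:R 0)%:A)
  + (g 0 2%:R)%:A * ((g 1 0)%:A * (g 2%:R 1)%:A - (g 1 1)%:A * (g 2%:R 0)%:A) :> F.
  by rewrite /d !(scalerDl, scaleNr, scalerBl) !algM !(scalerDl, scaleNr, scalerBl) !algM.
rewrite /r222 !qE !(q2C b a, q2C c a, q2C c b).
ring.
Qed.

End Covariance.

Section Morphism.
Variables (Z F : comNzRingType) (rho pi : {additive Z -> F}).
Variables (phi : {rmorphism F -> F}) (psi : Z -> Z).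
Hypothesis phi_q2 : forall a b, phi (q2 rho a b) = q2 rho (psi a) (psi b).
Hypothesis phi_q4 : forall a b c d,
  phi (q4 pi a b c d) = q4 pi (psi a) (psi b) (psi c) (psi d).

Lemma morph_r222 a b c : phi (r222 rho a b c) = r222 rho (psi a) (psi b) (psi c).
Proof. by rewrite /r222 -!phi_q2; ring. Qed.

Lemma morph_r42 a b : phi (r42 rho pi a b) = r42 rho pi (psi a) (psi b).
Proof. by rewrite /r42 -!phi_q2 -!phi_q4; ring. Qed.

Lemma morph_r62 a b : phi (r62 rho pi a b) = r62 rho pi (psi a) (psi b).
Proof. by rewrite /r62 /disc -!phi_q2 -!phi_q4; ring. Qed.

Lemma morph_r44 a b : phi (r44 rho pi a b) = r44 rho pi (psi a) (psi b).
Proof. by rewrite /r44 /disc -!phi_q2 -!phi_q4; ring. Qed.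

End Morphism.

(** * Pairing map *)

Record is_ideal (R : comNzRingType) (J : R -> Prop) : Prop := IsIdeal {
  ideal_0 : J 0;
  ideal_D : forall x y, J x -> J y -> J (x + y);
  ideal_M : forall x y, J y -> J (x * y) }.

Section Congruence.
Variables (R : comNzRingType) (J : R -> Prop) (hJ : is_ideal J).

Definition eqmod (x y : R) := J (x - y).

Lemma eqmod_refl x : eqmod x x.
Proof. by rewrite /eqmod subrr; exact: ideal_0. Qed.

Lemma eqmod_sym x y : eqmod x y -> eqmod y x.
Proof. by move/(ideal_M hJ (-1)); rewrite mulN1r opprB. Qed.

Lemma eqmod_trans y x z : eqmod x y -> eqmod y z -> eqmod x z.
Proof. by move=> /(ideal_D hJ) h /h; rewrite /eqmod addrA subrK. Qed.

Lemma eqmodMl x y z : eqmod y z -> eqmod (x * y) (x * z).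
Proof. by move/(ideal_M hJ x); rewrite mulrBr. Qed.

Lemma eqmodMr x y z : eqmod y z -> eqmod (y * x) (z * x).
Proof. by rewrite ![_ * x]mulrC; exact: eqmodMl. Qed.

Lemma eqmodD x y z t : eqmod x y -> eqmod z t -> eqmod (x + z) (y + t).
Proof. by move=> /(ideal_D hJ) h /h; rewrite /eqmod opprD addrACA. Qed.

Variables (I : eqType) (B : I -> I -> R).
Hypothesis Bsym : forall a b, eqmod (B a b) (B b a).
Hypothesis Bexch : forall a b c d, eqmod (B a b * B c d) (B a c * B b d).

(* The product of [B] over a pairing of [s]; junk value 0 for odd length. *)
Fixpoint pairs (s : seq I) : R :=
  match s with
  | [::] => 1
  | [:: _] => 0
  | a :: b :: s' => B a b * pairs s'
  end.

Lemma pairs_swap01 a b s : eqmod (pairs [:: a, b & s]) (pairs [:: b, a & s]).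
Proof. exact: eqmodMr. Qed.

(** Together with the swap inside the first pair this suffices for all permutations, since
    [pairs_cons2] shifts positions by two. If only three letters remain, both sides are 0 by the
    default value of [pairs]. *)
Lemma pairs_swap12 a b c s :
  eqmod (pairs [:: a, b, c & s]) (pairs [:: a, c, b & s]).
Proof.
case: s => [|d s] /=; first by rewrite !mulr0; exact: eqmod_refl.
by rewrite !mulrA; exact: eqmodMr.
Qed.

Lemma pairs_cons2 a b s t : eqmod (pairs s) (pairs t) ->
  eqmod (pairs [:: a, b & s]) (pairs [:: a, b & t]).
Proof. exact: eqmodMl. Qed.

Lemma pairs_move1 x y s t : eqmod (pairs (x :: s ++ y :: t)) (pairs [:: x, y & s ++ t]).
Proof.
have [n sn] := ubnP (size s); elim: n => // n IH in x s sn *.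
case: s sn => [|c [|d s]] sn; first exact: eqmod_refl.
  exact: pairs_swap12.
apply: (eqmod_trans (y := pairs [:: x, c, y, d & s ++ t])); last exact: pairs_swap12.
apply: pairs_cons2; apply: eqmod_trans (pairs_swap01 _ _ _).
by apply: IH; rewrite ltnS in sn; exact: ltnW.
Qed.

Lemma pairs_move0 x s t : eqmod (pairs (s ++ x :: t)) (pairs (x :: s ++ t)).
Proof.
case: s => [|c s]; first exact: eqmod_refl.
exact: eqmod_trans (pairs_move1 _ _ _ _) (pairs_swap01 _ _ _).
Qed.

Lemma pairs_perm s t : perm_eq s t -> eqmod (pairs s) (pairs t).
Proof.
have [n sn] := ubnP (size s); elim: n => // n IH in s t sn *.
have split u v w : perm_eq (u :: v) w -> exists w1 w2,
    w = w1 ++ u :: w2 /\ perm_eq v (w1 ++ w2).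
  move=> uvw; have : u \in w by rewrite -(perm_mem uvw) mem_head.
  move=> uw; case/path.splitPr: uw uvw => w1 w2 uvw; exists w1, w2; split=> //.
  by rewrite -(perm_cons u) (perm_trans uvw) // (perm_catCA w1 [:: u] w2).
case: s sn => [|x [|y s]] sn.
- by rewrite perm_sym => /perm_nilP ->; exact: eqmod_refl.
- move/split => [t1 [t2 [->]]]; rewrite perm_sym => /perm_nilP.
  by case: t1 => [|? ?] //= ->; exact: eqmod_refl.
move/split => [t1 [t2 [-> /split[u1 [u2 [e sp]]]]]].
apply: eqmod_trans (eqmod_sym (pairs_move0 _ _ _)); rewrite e.
apply: eqmod_trans (eqmod_sym (pairs_move1 _ _ _ _)).
by apply: pairs_cons2; apply: IH => //; rewrite ltnS in sn; exact: ltnW.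
Qed.

End Congruence.

Section MonomialWord.
Variable n : nat.

Definition word (M : 'X_{1..n}) : seq 'I_n := flatten [seq nseq (M i) i | i <- enum 'I_n].

Lemma count_word M i : count_mem i (word M) = M i.
Proof.
rewrite /word count_flatten -map_comp sumnE big_map (bigD1_seq i) ?mem_enum ?enum_uniq //=.
rewrite count_nseq /= eqxx mul1n big1 ?addn0 // => j ji.
by rewrite count_nseq /= (negbTE ji).
Qed.

Lemma word0 : word 0%MM = [::].
Proof. by apply/perm_nilP/allP => i _; rewrite /= count_word mnm0E. Qed.

Lemma wordD i M : perm_eq (word (U_(i) + M)) (i :: word M).
Proof. by apply/allP => j _; rewrite /= !count_word mnmDE mnm1E. Qed.

End MonomialWord.

Section PairingMap.
Variables (R : comNzRingType) (J : R -> Prop) (hJ : is_ideal J) (n : nat).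
Variable B : 'I_n -> 'I_n -> R.
Hypothesis Bsym : forall a b, eqmod J (B a b) (B b a).
Hypothesis Bexch : forall a b c d, eqmod J (B a b * B c d) (B a c * B b d).
Implicit Types (h : {mpoly R[n]}).

(** An R-linear retraction of the polynomial ring onto its constants; monomials of odd degree go to
    0. It is multiplicative only in the weak sense of [pairingX2]. *)
Definition pairing h : R := lext idfun (fun M => pairs B (word M)) h.

Lemma pairingX2 a b h : eqmod J (pairing ('X_a * 'X_b * h)) (B a b * pairing h).
Proof.
rewrite /pairing; elim/mpolyind: h => [|c M h _ _ IH].
  by rewrite mulr0 !lext0 mulr0; exact: eqmod_refl.
rewrite mulrDr !lextD mulrDr; apply: eqmodD => //.
rewrite -scalerAr -!mpolyXD !lextZ !lextX /= [X in eqmod _ _ X]mulrCA.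
apply: eqmodMl => //.
apply: (eqmod_trans hJ (y := pairs B [:: a, b & word M])); last exact: eqmod_refl.
apply: (pairs_perm hJ Bsym Bexch).
rewrite -addmA (perm_trans (wordD _ _)) // perm_cons.
exact: wordD.
Qed.

Lemma pairing_const c h : pairing (c%:MP * h) = c * pairing h.
Proof. by rewrite mul_mpolyC /pairing lextZ. Qed.

Lemma pairing1 c : pairing c%:MP = c.
Proof.
rewrite -[c%:MP]mulr1 pairing_const /pairing -mpolyX0 lextX word0.
by rewrite mulr1.
Qed.

(** In each monomial of [h] some letter [b] can be paired with the linear form, which produces the
    sum that the hypothesis places in [J]. *)
Lemma pairing_odd (s : seq (R * 'I_n)) h :
  (forall b, J (\sum_(p <- s) p.1 * B p.2 b)) ->
  J (pairing ((\sum_(p <- s) p.1%:MP * 'X_p.2) * h)).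
Proof.
move=> sB; elim/mpolyind: h => [|c M h _ _ IH].
  by rewrite mulr0 /pairing lext0; exact: (ideal_0 hJ).
rewrite mulrDr /pairing lextD; apply: ideal_D => //.
rewrite -scalerAr lextZ; apply: ideal_M => //.
case eM: (mdeg M) => [|d].
  (* No letter to pair with: the words have length one, and [pairs] is 0 on them by default. *)
  move/eqP: eM; rewrite mdeg_eq0 => /eqP ->; rewrite mpolyX0 mulr1.
  rewrite lext_sum big1; [exact: (ideal_0 hJ)|move=> p _].
  rewrite mul_mpolyC lextZ lextX -[U_(p.2)%MM]addm0.
  have := perm_size (wordD p.2 0%MM); rewrite word0 /=.
  by case: (word _) => [|? [|]] //; rewrite /= mulr0.
case/mdegS: eM => b [M' [-> _]]; rewrite mulr_suml lext_sum.
have e : eqmod J (\sum_(p <- s) pairing (p.1%:MP * 'X_p.2 * 'X_[(U_(b) + M')%MM]))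
    ((\sum_(p <- s) p.1 * B p.2 b) * pairing 'X_[M']).
  elim: s {sB IH} => [|p s IHs]; first by rewrite !big_nil mul0r; exact: eqmod_refl.
  rewrite !big_cons mulrDl; apply: eqmodD => //.
  rewrite -!mulrA pairing_const; apply: eqmodMl => //.
  by rewrite mpolyXD mulrA; exact: pairingX2.
have := ideal_D hJ e (ideal_M hJ (pairing 'X_[M']) (sB b)).
by rewrite [X in X - _ + _]/= [in X in _ + X]mulrC subrK.
Qed.

End PairingMap.

(** * The kernel modulo the relations *)

Section KernelArgument.
Variables (K : numClosedFieldType) (F : comAlgType K) (m : nat).
Variables (J : F -> Prop) (hJ : is_ideal J).
Variables (r : 'I_m -> 'I_m -> F) (p : 'I_m -> 'I_m -> 'I_m -> 'I_m -> F).

Definition dsym i j k l : F :=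
  p i j k l + 2 * (r i k * r j l + r i l * r j k - r i j * r k l).

Hypothesis rC : forall i j, r i j = r j i.
Hypothesis p12 : forall i j k l, p i j k l = p j i k l.
Hypothesis p23 : forall i j k l, p i j k l = p i k j l.
Hypothesis p34 : forall i j k l, p i j k l = p i j l k.
Hypothesis J_minor : forall a a' b b' c c' d d',
  J (dsym a a' b b' * dsym c c' d d' - dsym a a' c c' * dsym b b' d d').
Hypothesis J_curv : forall a b c d x y,
  J (r a b * dsym c d x y + r c d * dsym a b x y
     - (r a c * dsym b d x y + r b d * dsym a c x y)).

Lemma dsymC i j k l : dsym i j k l = dsym k l i j.
Proof.
rewrite /dsym (p23 i j k l) (p12 i k j l) (p34 k i j l) (p23 k i l j).
by rewrite (rC k i) (rC l j) (rC k j) (rC l i); ring.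
Qed.

Lemma dsym12 i j k l : dsym i j k l = dsym j i k l.
Proof. by rewrite /dsym p12 (rC j i); ring. Qed.

Let n := #|{: 'I_m * 'I_m}|.
Notation R := {mpoly F[n]}.

Definition pairB (a b : 'I_n) : F :=
  dsym (enum_val a).1 (enum_val a).2 (enum_val b).1 (enum_val b).2.

Lemma pairB_sym a b : eqmod J (pairB a b) (pairB b a).
Proof. by rewrite /pairB dsymC; exact: eqmod_refl. Qed.

Lemma pairB_exch a b c d : eqmod J (pairB a b * pairB c d) (pairB a c * pairB b d).
Proof. exact: J_minor. Qed.

(* The largest ideal of [R] whose image under [pairing] lies in [J]. *)
Definition pairing_ideal (h : R) := forall h', J (pairing pairB (h * h')).

Notation J' := pairing_ideal.

Lemma pairing_idealP : is_ideal J'.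
Proof.
split=> [h|x y hx hy h|x y hy h].
- by rewrite mul0r /pairing lext0; exact: ideal_0 hJ.
- by rewrite mulrDl /pairing lextD; apply: (ideal_D hJ); [exact: hx|exact: hy].
- by rewrite -mulrA mulrCA; exact: hy.
Qed.

(** Adjoining the d_ij kills nothing new in F modulo [J]: test with the factor 1, as [pairing] fixes
    constants. *)
Lemma pairing_ideal_const f : J' f%:MP -> J f.
Proof. by move/(_ 1); rewrite mulr1 pairing1. Qed.

Definition dvar i j : R := 'X_(enum_rank (i, j)).

Lemma dvarM i j k l : eqmod J' (dvar i j * dvar k l) (dsym i j k l)%:MP.
Proof.
move=> h; rewrite mulrBl /pairing lextD -scaleN1r lextZ /= mulN1r.
have := pairingX2 hJ pairB_sym pairB_exch (enum_rank (i, j)) (enum_rank (k, l)) h.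
by rewrite /eqmod -pairing_const /pairB !enum_rankK.
Qed.

Definition Svar i j : R := 2 * (r i j)%:MP + dvar i j.
Definition Tvar i j : R := 2 * (r i j)%:MP - dvar i j.

Lemma dvar_odd (s : seq (F * ('I_m * 'I_m))) :
  (forall k l, J (\sum_(x <- s) x.1 * dsym x.2.1 x.2.2 k l)) ->
  J' (\sum_(x <- s) x.1%:MP * dvar x.2.1 x.2.2).
Proof.
move=> hs h; have := @pairing_odd _ _ hJ _ _ pairB_sym pairB_exch
  [seq (x.1, enum_rank x.2) | x <- s] h.
rewrite big_map; under eq_bigr => x _ do
  rewrite /= (surjective_pairing x.2) -/(dvar x.2.1 x.2.2).
apply=> b; rewrite big_map /=; under eq_bigr => x _ do rewrite /pairB enum_rankK.
exact: hs.
Qed.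

Lemma dvarC i j : eqmod J' (dvar i j) (dvar j i).
Proof.
have -> : eqmod J' (dvar i j) (dvar j i) =
    J' (\sum_(x <- [:: (1 : F, (i, j)); (-1 : F, (j, i))]) x.1%:MP * dvar x.2.1 x.2.2).
  by rewrite !big_cons big_nil /= mpolyCN mpolyC1 mul1r mulN1r addr0.
apply: dvar_odd => k l; rewrite !big_cons big_nil /= dsym12 mul1r mulN1r addr0 subrr.
exact: ideal_0 hJ.
Qed.

Lemma Svar_sym i j : eqmod J' (Svar i j) (Svar j i).
Proof.
rewrite /Svar rC; apply: (eqmodD pairing_idealP); last exact: dvarC.
exact: eqmod_refl pairing_idealP _.
Qed.

Lemma Tvar_sym i j : eqmod J' (Tvar i j) (Tvar j i).
Proof.
rewrite /Tvar rC; apply: (eqmodD pairing_idealP).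
  exact: eqmod_refl pairing_idealP _.
by have := eqmodMl pairing_idealP (-1) (dvarC i j); rewrite !mulN1r.
Qed.

Lemma mpolyC_nat k : (k%:R : F)%:MP = k%:R :> R.
Proof. by rewrite mpolyCMn mpolyC1. Qed.

(** Replacing the product of two d by [dsym] turns each side into p plus twice the sum of the
    products of r over the three pairings of i, j, k, l, which is totally symmetric. *)
Lemma exchange_even i j k l :
  eqmod J' (4 * (r i j * r k l)%:MP + dvar i j * dvar k l)
           (4 * (r i k * r j l)%:MP + dvar i k * dvar j l).
Proof.
have e : 4 * (r i j * r k l) + dsym i j k l = 4 * (r i k * r j l) + dsym i k j l.
  by rewrite /dsym p23 (rC k j); ring.
have h i' j' k' l' : eqmod J' (4 * (r i' j' * r k' l')%:MP + dvar i' j' * dvar k' l')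
    (4 * (r i' j' * r k' l') + dsym i' j' k' l')%:MP.
  rewrite mpolyCD (mpolyCM _ 4) mpolyC_nat; apply: (eqmodD pairing_idealP); last exact: dvarM.
  exact: eqmod_refl pairing_idealP _.
apply: (eqmod_trans pairing_idealP (h i j k l)); rewrite e.
exact: (eqmod_sym pairing_idealP (h i k j l)).
Qed.

(** Linear in the d, so [dvar_odd] reduces it to [J_curv] after multiplication by any further d. *)
Lemma exchange_odd i j k l :
  eqmod J' ((r i j)%:MP * dvar k l + (r k l)%:MP * dvar i j)
           ((r i k)%:MP * dvar j l + (r j l)%:MP * dvar i k).
Proof.
have -> : eqmod J' ((r i j)%:MP * dvar k l + (r k l)%:MP * dvar i j)
      ((r i k)%:MP * dvar j l + (r j l)%:MP * dvar i k) =
    J' (\sum_(x <- [:: (r i j, (k, l)); (r k l, (i, j)); (- r i k, (j, l)); (- r j l, (i, k))])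
          x.1%:MP * dvar x.2.1 x.2.2).
  rewrite !big_cons big_nil /= !mpolyCN; congr J'; ring.
apply: dvar_odd => x y; rewrite !big_cons big_nil /=.
have := J_curv i j k l x y; congr J; ring.
Qed.

(** A product of two S is the even expression plus twice the odd one; for T the sign of the odd one
    changes. *)
Lemma Svar_exch i j k l : eqmod J' (Svar i j * Svar k l) (Svar i k * Svar j l).
Proof.
have := eqmodD pairing_idealP (exchange_even i j k l)
  (eqmodMl pairing_idealP 2 (exchange_odd i j k l)).
by rewrite /Svar !mpolyCM; congr eqmod; ring.
Qed.

Lemma Tvar_exch i j k l : eqmod J' (Tvar i j * Tvar k l) (Tvar i k * Tvar j l).
Proof.
have := eqmodD pairing_idealP (exchange_even i j k l)
  (eqmodMl pairing_idealP (-2) (exchange_odd i j k l)).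
by rewrite /Tvar !mpolyCM; congr eqmod; ring.
Qed.

Notation KV := {mpoly K[m + m]}.
Notation u := (@xvar K m).
Notation v := (@yvar K m).

Definition scal : {rmorphism K -> R} := @mpolyC n F \o in_alg F.

Definition lpart (M : 'X_{1..m + m}) : 'X_{1..m} := [multinom M (lshift m i) | i < m].
Definition rpart (M : 'X_{1..m + m}) : 'X_{1..m} := [multinom M (rshift m i) | i < m].

(** The variables of [KV] now mean u and v. Monomials of odd degree in u or in v go to 0, so this is
    no ring morphism; modulo [J'] it is compatible with multiplication by the u_i u_j and v_i v_j,
    which is what [acts] records. *)
Definition sigma (h : KV) : R :=
  lext scal (fun M => pairs Svar (word (lpart M)) * pairs Tvar (word (rpart M))) h.

Definition acts (X : KV) (s : R) := forall h, eqmod J' (sigma (X * h)) (s * sigma h).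

Lemma actsU i j : acts (u i * u j) (Svar i j).
Proof.
move=> h; rewrite /sigma; elim/mpolyind: h => [|c M h _ _ IH].
  by rewrite mulr0 !lext0 mulr0; exact: eqmod_refl pairing_idealP _.
rewrite mulrDr !lextD mulrDr; apply: (eqmodD pairing_idealP) => //.
rewrite -scalerAr -!mpolyXD !lextZ !lextX [X in eqmod _ _ X]mulrCA.
apply: (eqmodMl pairing_idealP).
have -> : lpart (U_(lshift m i) + U_(lshift m j) + M) = (U_(i) + (U_(j) + lpart M))%MM.
  by apply/mnmP => k; rewrite !(mnmE, mnmDE, mnm1E) !eq_lshift addnA.
have -> : rpart (U_(lshift m i) + U_(lshift m j) + M) = rpart M.
  by apply/mnmP => k; rewrite !(mnmE, mnmDE, mnm1E) !eq_lrshift.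
rewrite mulrA; apply: (eqmodMr pairing_idealP).
apply: (eqmod_trans pairing_idealP (y := pairs Svar [:: i, j & word (lpart M)])).
  apply: (pairs_perm pairing_idealP Svar_sym Svar_exch).
  by rewrite (perm_trans (wordD _ _)) // perm_cons; exact: wordD.
exact: eqmod_refl pairing_idealP _.
Qed.

Lemma actsV i j : acts (v i * v j) (Tvar i j).
Proof.
move=> h; rewrite /sigma; elim/mpolyind: h => [|c M h _ _ IH].
  by rewrite mulr0 !lext0 mulr0; exact: eqmod_refl pairing_idealP _.
rewrite mulrDr !lextD mulrDr; apply: (eqmodD pairing_idealP) => //.
rewrite -scalerAr -!mpolyXD !lextZ !lextX [X in eqmod _ _ X]mulrCA.
apply: (eqmodMl pairing_idealP).
have -> : rpart (U_(rshift m i) + U_(rshift m j) + M) = (U_(i) + (U_(j) + rpart M))%MM.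
  by apply/mnmP => k; rewrite !(mnmE, mnmDE, mnm1E) !eq_rshift addnA.
have -> : lpart (U_(rshift m i) + U_(rshift m j) + M) = lpart M.
  by apply/mnmP => k; rewrite !(mnmE, mnmDE, mnm1E) !eq_rlshift.
rewrite [X in eqmod _ _ X]mulrCA; apply: (eqmodMl pairing_idealP).
apply: (eqmod_trans pairing_idealP (y := pairs Tvar [:: i, j & word (rpart M)])).
  apply: (pairs_perm pairing_idealP Tvar_sym Tvar_exch).
  by rewrite (perm_trans (wordD _ _)) // perm_cons; exact: wordD.
exact: eqmod_refl pairing_idealP _.
Qed.

Lemma acts1 : acts 1 1.
Proof. by move=> h; rewrite !mul1r; exact: eqmod_refl pairing_idealP _. Qed.

Lemma actsD X Y s t : acts X s -> acts Y t -> acts (X + Y) (s + t).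
Proof.
by move=> hX hY h; rewrite !mulrDl /sigma lextD; apply: (eqmodD pairing_idealP).
Qed.

Lemma actsM X Y s t : acts X s -> acts Y t -> acts (X * Y) (s * t).
Proof.
move=> hX hY h; rewrite -mulrA; apply: (eqmod_trans pairing_idealP (hX _)).
by rewrite -mulrA; apply: (eqmodMl pairing_idealP).
Qed.

Lemma actsZ c X s : acts X s -> acts (c *: X) (scal c * s).
Proof.
move=> hX h; rewrite -scalerAl /sigma lextZ -mulrA.
by apply: (eqmodMl pairing_idealP); exact: hX.
Qed.

Lemma actsN X s : acts X s -> acts (- X) (- s).
Proof. by move/(actsZ (-1)); rewrite scaleN1r rmorphN1 mulN1r. Qed.

Lemma acts_eqmod X s t : eqmod J' s t -> acts X s -> acts X t.
Proof.
move=> st hX h; apply: (eqmod_trans pairing_idealP (hX h)).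
exact: (eqmodMr pairing_idealP).
Qed.

Variable Phi : {lrmorphism F -> KV}.
Hypothesis Phi_r : forall i j, Phi (r i j) = 4^-1 *: (u i * u j + v i * v j).
Hypothesis Phi_p : forall i j k l, Phi (p i j k l) =
  8^-1 *: (u i * u j * (u k * u l) + v i * v j * (v k * v l)
           - (u i * u j * (v k * v l) + u k * u l * (v i * v j))
           - (u i * u k * (v j * v l) + u j * u l * (v i * v k))
           - (u i * u l * (v j * v k) + u j * u k * (v i * v l))).

Lemma scal_inv k : (k != 0)%N -> scal k%:R^-1 * k%:R = 1.
Proof. by move=> k0; rewrite -(rmorph_nat scal) -rmorphM mulVf ?rmorph1 // pnatr_eq0. Qed.

Lemma acts_r i j : acts (Phi (r i j)) (r i j)%:MP.
Proof.
rewrite Phi_r; have := actsZ 4^-1 (actsD (actsU i j) (actsV i j)); congr acts.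
rewrite /Svar /Tvar addrACA subrr addr0 -mulrDl -natrD mulrA scal_inv //.
by rewrite mul1r.
Qed.

Lemma acts_p i j k l : acts (Phi (p i j k l)) (p i j k l)%:MP.
Proof.
rewrite Phi_p; have U := actsU; have V := actsV.
apply: acts_eqmod; last first.
  apply: (actsZ 8^-1).
  apply: actsD (actsN (actsD (actsM (U _ _) (V _ _)) (actsM (U _ _) (V _ _)))).
  apply: actsD (actsN (actsD (actsM (U _ _) (V _ _)) (actsM (U _ _) (V _ _)))).
  apply: actsD (actsN (actsD (actsM (U _ _) (V _ _)) (actsM (U _ _) (V _ _)))).
  exact: actsD (actsM (U _ _) (U _ _)) (actsM (V _ _) (V _ _)).
rewrite -[X in eqmod _ _ X]mul1r -(@scal_inv 8) // -mulrA.
apply: (eqmodMl pairing_idealP).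
(* The mixed terms in r and d cancel. What remains is 2 d_ij d_kl, twice the sum of the products of
   d over the three pairings, and products of r; once each product of d is replaced by [dsym], the r
   cancel and 8 p is left. *)
have e := eqmodD pairing_idealP (eqmodMl pairing_idealP 2 (dvarM i j k l))
  (eqmodMl pairing_idealP 2 (eqmodD pairing_idealP (dvarM i j k l)
    (eqmodD pairing_idealP (dvarM i k j l) (dvarM i l j k)))).
have := eqmodD pairing_idealP e (eqmod_refl pairing_idealP
  (8 * ((r i j)%:MP * (r k l)%:MP) - 8 * ((r i j)%:MP * (r k l)%:MP
     + (r i k)%:MP * (r j l)%:MP + (r i l)%:MP * (r j k)%:MP))).
congr eqmod; first by rewrite /Svar /Tvar; ring.
rewrite /dsym (p23 i k j l) (p34 i l j k) (p23 i l k j) (p34 i k l j) (p23 i k j l).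
rewrite (rC k j) (rC l j) (rC l k) !(mpolyCD, mpolyCN, mpolyCM, mpolyC_nat); ring.
Qed.

Hypothesis F_gen : forall P : F -> Prop,
  P 1 -> (forall f g a, P f -> P g -> P (a *: f + g)) ->
  (forall i j f, P f -> P (r i j * f)) ->
  (forall i j k l f, P f -> P (p i j k l * f)) -> forall f, P f.

(** Under [sigma], multiplication by [Phi f] becomes multiplication by [f] modulo [J']. Applied to
    1, this recovers [f] from [Phi f]. *)
Lemma kernel_sub f : Phi f = 0 -> J f.
Proof.
have : acts (Phi f) f%:MP.
  elim/F_gen: f => [|f g a hf hg|i j f hf|i j k l f hf].
  - by rewrite rmorph1 mpolyC1; exact: acts1.
  - have -> : (a *: f + g)%:MP = scal a * f%:MP + g%:MP :> R.
      by rewrite mpolyCD -mpolyCM mulr_algl.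
    by rewrite linearP; apply: actsD => //; exact: actsZ.
  - by rewrite rmorphM mpolyCM; apply: actsM => //; exact: acts_r.
  - by rewrite rmorphM mpolyCM; apply: actsM => //; exact: acts_p.
move=> h f0; have := h 1; rewrite f0 mul0r /sigma lext0 -mpolyX0 lextX.
have w0 (M : 'X_{1..m}) : M = 0%MM -> word M = [::] by move=> ->; exact: word0.
rewrite !w0; do ?by apply/mnmP => i; rewrite !(mnmE, mnm0E).
rewrite /= !mulr1 => /(eqmod_sym pairing_idealP); rewrite /eqmod subr0.
exact: pairing_ideal_const.
Qed.

End KernelArgument.

Local Open Scope classical_set_scope.

(** * Irreducibility and orthogonality of cyclic modules *)

Section GLSpan.
Variables (K : numClosedFieldType) (m : nat).
Notation F := (FK K m).
Implicit Types (r u v w : F) (g h : 'M[K]_m) (U W : set F).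

Lemma GL_actF1 (u : F) : GL_actF 1%:M u = u.
Proof.
have lin1 f : lin (1%:M : 'M[K]_m) f = f.
  elim/mpoly_indX: f => [|f k a IHf IHk|j f IH]; first by rewrite rmorph1.
    by rewrite linearP /= IHf IHk.
  rewrite rmorphM /= IH linX (bigD1 j) //= mxE eqxx scale1r big1 ?addr0 // => i ij.
  by rewrite mxE (negbTE ij) scale0r.
elim/F_ind: u => [|f k a IHf IHk|a f IH|b f IH]; first by rewrite rmorph1.
- by rewrite linearP /= IHf IHk.
- by rewrite rmorphM /= IH GL_rho lin1.
- by rewrite rmorphM /= IH GL_pi lin1.
Qed.

Lemma herm_adjoint_r g (u v : F) : herm u (GL_actF g v) = herm (GL_actF (adjmx g) u) v.
Proof. by rewrite herm_adjoint adjmxK. Qed.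

Lemma GL_span_submodule r : GL_submodule (GL_span r).
Proof.
split=> [|g ug f rf U [hU rU]]; last first.
  by case: (hU) => _; apply => //; apply: rf.
split=> [U [[[U0 _] _] _] //|c u v ru rv U hU].
by case: (hU) => -[[_ UD] _] _; apply: UD; [exact: ru|exact: rv].
Qed.

Lemma GL_span_refl r : GL_span r r.
Proof. by move=> U [_ rU]; apply: rU. Qed.

Lemma GL_span_min r U : GL_submodule U -> U r -> GL_span r `<=` U.
Proof. by move=> hU Ur w rw; apply: rw; split => // _ ->. Qed.

Lemma herm_submodule U : (forall g, g \in unitmx -> forall u, U u -> U (GL_actF g u)) ->
  GL_submodule [set w | forall u, U u -> herm u w = 0].
Proof.
move=> sU; split; first split.
- by move=> u _; rewrite herm0r.
- by move=> c v w hv hw u Uu; rewrite hermDr hermZr hv // hw // mulr0 addr0.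
move=> g ug w hw u Uu; rewrite herm_adjoint_r; apply: hw.
by apply: sU => //; exact: adjmx_unit.
Qed.

(** The orthogonal of a stable set is a submodule. This is used twice: to replace [r'] by its span,
    then, by Hermitian symmetry, [r] by its span. *)
Lemma GL_span_orth r r' : (forall g, g \in unitmx -> herm (GL_actF g r) r' = 0) ->
  forall w w', GL_span r w -> GL_span r' w' -> herm w w' = 0.
Proof.
move=> rr' w w' rw r'w'.
have [_ sr'] := GL_span_submodule r'.
suff : GL_span r `<=` [set w | forall u, GL_span r' u -> herm u w = 0].
  by move/(_ w rw w' r'w'); rewrite herm_sym => /eqP; rewrite conjC_eq0 => /eqP.
apply: GL_span_min; first exact: herm_submodule.
move=> u r'u.
pose U := [set v : F | exists2 g, g \in unitmx & v = GL_actF g r].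
suff : GL_span r' `<=` [set w | forall u, U u -> herm u w = 0].
  move/(_ u r'u r) => ru; rewrite herm_sym ru ?rmorph0 //.
  by exists 1%:M; rewrite ?unitmx1 ?GL_actF1.
apply: GL_span_min => [|_ [g ug ->]]; last exact: rr'.
apply: herm_submodule => g ug _ [h uh ->].
by exists (g *m h); rewrite ?GL_actF_mul ?unitmx_mul ?ug.
Qed.

Lemma herm_subspace r : subspace [set u : F | herm u r = 0].
Proof.
split => [|c u v] /=; first by rewrite herm0l.
by move=> hu hv; rewrite hermDl hermZl hu hv mulr0 addr0.
Qed.

(* [D s] is a one-parameter monoid; the hypotheses say that [r] has weight [n]
   and spans the part of weight [n], and that no smaller weight occurs. *)
Lemma GL_span_irreducible r (D : K -> 'M[K]_m) n : r <> 0 ->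
    (forall s, GL_actF (adjmx (D s)) r = (s ^+ n)^* *: r) ->
    (forall g, exists p : {poly F},
       (forall s, GL_actF (D s) (GL_actF g r) = s ^+ n *: p.[s%:A]) /\
       exists c, p`_0 = c *: r) ->
  GL_irreducible (GL_span r).
Proof.
move=> r0 Dr gr; pose W := GL_span r.
have sW : GL_submodule W by exact: GL_span_submodule.
(* The property is propagated to the whole span in a form quantified over all [g], which makes it
   stable under the action. *)
have {gr} Wp w : W w -> exists p : {poly F},
    (forall s, GL_actF (D s) w = s ^+ n *: p.[s%:A]) /\ exists c, p`_0 = c *: r.
  move=> Ww; pose V := [set w : F | forall g, exists p : {poly F},
    (forall s, GL_actF (D s) (GL_actF g w) = s ^+ n *: p.[s%:A]) /\
    exists c, p`_0 = c *: r].
  suff : W `<=` V by move/(_ w Ww 1%:M); rewrite GL_actF1.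
  apply: GL_span_min; last exact: gr.
  split; first split.
  - move=> g; exists 0; split=> [s|]; first by rewrite horner0 !raddf0.
    by exists 0; rewrite coef0 scale0r.
  - move=> a u v hu hv g; have [p [hp [c pc]]] := hu g; have [q [hq [d qd]]] := hv g.
    exists (a%:A *: p + q); split=> [s|].
      by rewrite !linearP /= hp hq hornerD hornerZ mulr_algl scalerDr !scalerA mulrC.
    by exists (a * c + d); rewrite coefD coefZ pc qd mulr_algl scalerDl scalerA.
  - move=> h uh u hu g; have [p [hp pc]] := hu (g *m h).
    exists p; split=> [s|]; last exact: pc.
    by rewrite -(GL_actF_mul g h u) hp.
split => //.
  move=> W0; apply: r0; have : W r by exact: GL_span_refl.
  by rewrite /W W0.
move=> U sU UW; have [U0|/existsNP[u /not_implyP[Uu u0]]] :=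
    pselect (forall u, U u -> u = 0).
  left; apply/seteqP; split=> [u /U0 //|_ ->].
  by case: sU => -[].
right; apply/seteqP; split; first exact: UW.
apply: GL_span_min => //.
(* Otherwise the orbit of [u] would be orthogonal to the span of [r], which contains [u], and [u]
   would be orthogonal to itself. *)
have [g ug gur] : exists2 g, g \in unitmx & herm (GL_actF g u) r <> 0.
  apply: contrapT => hN; apply: u0; apply: herm_eq0.
  pose O := [set v : F | exists2 g, g \in unitmx & v = GL_actF g u].
  suff : W `<=` [set w | forall v, O v -> herm v w = 0].
    by move/(_ u (UW _ Uu)); apply; exists 1%:M; rewrite ?unitmx1 ?GL_actF1.
  apply: GL_span_min.
    apply: herm_submodule => g ug _ [h uh ->].
    by exists (g *m h); rewrite ?GL_actF_mul ?unitmx_mul ?ug.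
  move=> _ [g ug ->]; apply: contrapT => hgr; apply: hN.
  by exists g.
have [v Uv vr] : exists2 v, U v & herm v r <> 0.
  by exists (GL_actF g u) => //; case: sU => _; apply.
have [p [hp [c pc]]] := Wp _ (UW _ Uv).
have Xn0 : 'X != 0 :> {poly K} by rewrite polyX_eq0.
(* The constant coefficient is the component of [v] of weight [n]; it is extracted from the
   translates of [v] divided by s^n. *)
have Up0 : U p`_0.
  apply: (subspace_poly (proj1 sU) Xn0) => s; rewrite hornerX => s0.
  have := subspaceZ (s ^- n) (proj1 sU) (GL_submodule_mx (D s) sU Uv).
  by rewrite hp scalerA mulVf ?scale1r // expf_neq0.
(* The other weight components are orthogonal to [r]. So the component of weight [n], a multiple of
   [r], has the same nonzero product with [r] as [v], and [r] lies in [U]. *)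
have : herm (p`_0 - v) r = 0.
  have -> : p`_0 - v = (p - v%:P)`_0.
    by rewrite coefB coefC.
  apply: (subspace_poly (herm_subspace r) Xn0) => s; rewrite hornerX => s0 /=.
  have sn0 : s ^+ n != 0 by rewrite expf_neq0.
  rewrite hornerD hornerN hornerC; apply: (mulfI sn0); rewrite mulr0 -hermZl.
  have -> : s ^+ n *: (p.[s%:A] - v) =
      GL_actF (D s) v + (- s ^+ n) *: v.
    by rewrite hp scalerBr scaleNr.
  by rewrite hermDl hermZl herm_adjoint Dr hermZr conjCK mulNr subrr.
rewrite -scaleN1r hermDl hermZl mulN1r pc hermZl => /eqP; rewrite subr_eq0 => /eqP hc.
have c0 : c != 0 by apply/eqP => c0; apply: vr; rewrite -hc c0 mul0r.
have := subspaceZ c^-1 (proj1 sU) Up0; rewrite pc scalerA mulVf ?scale1r //.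
Qed.

(** All weights occurring in [r] are at least n', while [r'] has weight n, and different weights are
    orthogonal. *)
Lemma herm_weight_lt r r' (D : K -> 'M[K]_m) n n' : (n < n')%N ->
    (forall s, GL_actF (adjmx (D s)) r' = (s ^+ n)^* *: r') ->
    (exists p : {poly F}, forall s, GL_actF (D s) r = s ^+ n' *: p.[s%:A]) ->
  herm r r' = 0.
Proof.
move=> nn' Dr' [p hp]; have Xn0 : 'X != 0 :> {poly K} by rewrite polyX_eq0.
have -> : r = (r%:P - 'X^(n' - n) * p)`_0.
  by rewrite coefB coefC coefXnM subn_gt0 nn' subr0.
apply: (subspace_poly (herm_subspace r') Xn0) => s; rewrite hornerX => s0 /=.
have sn0 : s ^+ n != 0 by rewrite expf_neq0.
apply: (mulfI sn0); rewrite mulr0 -hermZl hornerD hornerN hornerC hornerM hornerXn.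
rewrite exprZn expr1n -scalerAl mul1r scalerBr scalerA -exprD subnKC 1?ltnW //.
rewrite -(hp s) -scaleN1r hermDl !hermZl herm_adjoint Dr' hermZr conjCK.
by rewrite mulN1r subrr.
Qed.

End GLSpan.

(** * The four highest weight vectors *)

Lemma det_mx_of_rows3 (R : comNzRingType) (a b c d e f g h k : R) :
  \det (mx_of_rows 3 [:: [:: a; b; c]; [:: d; e; f]; [:: g; h; k]]) =
  a * (e * k - f * h) - b * (d * k - f * g) + c * (d * h - e * g).
Proof.
pose M : 'M[R]_3 := mx_of_rows 3 [:: [:: a; b; c]; [:: d; e; f]; [:: g; h; k]].
rewrite -/M (expand_det_row M 0) !big_ord_recl big_ord0 /cofactor.
rewrite !(expand_det_row _ 0) !big_ord_recl !big_ord0 /cofactor !det_mx11 !mxE /=.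
rewrite /bump /= !expr0 !expr1 ?exprS ?expr0. ring.
Qed.

Section HighestWeightVectors.
Variables (K : numClosedFieldType) (m : nat) (hm : (3 <= m)%N).
Notation Z := {mpoly K[m]}.
Notation F := (FK K m).
Implicit Types (g h : 'M[K]_m) (a b c : Z).

Definition rhoL : {linear Z -> F} := @rhoF K m.
Definition piL : {linear Z -> F} := @piF K m.

Definition i0 : 'I_m := Ordinal (ltnW (ltnW hm)).
Definition i1 : 'I_m := Ordinal (ltnW hm).
Definition i2 : 'I_m := Ordinal hm.

Definition zv0 : Z := 'X_i0.
Definition zv1 : Z := 'X_i1.
Definition zv2 : Z := 'X_i2.

Lemma rhoX3 (a b c : nat) i j : mi3 m a b c = (U_(i) + U_(j))%MM ->
  rhoX K (mi3 m a b c) = q2 rhoL 'X_i 'X_j.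
Proof. by move=> ->; rewrite rhoX_rho ?mdegD ?mdeg1 // mpolyXD. Qed.

Lemma piX3 (a b c : nat) i j k l : mi3 m a b c = (U_(i) + U_(j) + U_(k) + U_(l))%MM ->
  piX K (mi3 m a b c) = q4 piL 'X_i 'X_j 'X_k 'X_l.
Proof. by move=> ->; rewrite piX_pi ?mdegD ?mdeg1 // !mpolyXD. Qed.

Ltac mi3_tac := apply/mnmP => -[[|[|[|k]]] hk];
  rewrite !mnmE /= ?nth_nil // -!(inj_eq val_inj) //=.

Lemma R222E : R222 K m = r222 rhoL zv0 zv1 zv2.
Proof.
rewrite /R222 (@rhoX3 2 0 0 i0 i0) ?(@rhoX3 1 1 0 i0 i1) ?(@rhoX3 1 0 1 i0 i2)
  ?(@rhoX3 0 2 0 i1 i1) ?(@rhoX3 0 1 1 i1 i2) ?(@rhoX3 0 0 2 i2 i2); try by mi3_tac.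
by rewrite det_mx_of_rows3.
Qed.

Lemma R42E : R42 K m = r42 rhoL piL zv0 zv1.
Proof.
by rewrite /R42 /r42 (@rhoX3 2 0 0 i0 i0) ?(@rhoX3 1 1 0 i0 i1) ?(@rhoX3 0 2 0 i1 i1)
  ?(@piX3 4 0 0 i0 i0 i0 i0) ?(@piX3 3 1 0 i0 i0 i0 i1)
  ?(@piX3 2 2 0 i0 i0 i1 i1) //; mi3_tac.
Qed.

Lemma R62E : R62 K m = r62 rhoL piL zv0 zv1.
Proof.
by rewrite /R62 /r62 /disc (@rhoX3 2 0 0 i0 i0) ?(@rhoX3 1 1 0 i0 i1)
  ?(@rhoX3 0 2 0 i1 i1) ?(@piX3 4 0 0 i0 i0 i0 i0) ?(@piX3 3 1 0 i0 i0 i0 i1)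
  ?(@piX3 2 2 0 i0 i0 i1 i1) //; mi3_tac.
Qed.

Lemma R44E : R44 K m = r44 rhoL piL zv0 zv1.
Proof.
by rewrite /R44 /r44 /disc (@rhoX3 2 0 0 i0 i0) ?(@rhoX3 1 1 0 i0 i1)
  ?(@rhoX3 0 2 0 i1 i1) ?(@piX3 4 0 0 i0 i0 i0 i0) ?(@piX3 3 1 0 i0 i0 i0 i1)
  ?(@piX3 2 2 0 i0 i0 i1 i1) ?(@piX3 1 3 0 i0 i1 i1 i1) ?(@piX3 0 4 0 i1 i1 i1 i1) //;
  mi3_tac.
Qed.

Lemma GL_q2 g a b : GL_actF g (q2 rhoL a b) = q2 rhoL (lin g a) (lin g b).
Proof. by rewrite /q2 [LHS]GL_rho rmorphM. Qed.

Lemma GL_q4 g a b c d :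
  GL_actF g (q4 piL a b c d) = q4 piL (lin g a) (lin g b) (lin g c) (lin g d).
Proof. by rewrite /q4 [LHS]GL_pi !rmorphM. Qed.

Lemma GL_r222 g a b c :
  GL_actF g (r222 rhoL a b c) = r222 rhoL (lin g a) (lin g b) (lin g c).
Proof. exact: (morph_r222 (GL_q2 g)). Qed.

Lemma GL_r42 g a b : GL_actF g (r42 rhoL piL a b) = r42 rhoL piL (lin g a) (lin g b).
Proof. exact: (morph_r42 (GL_q2 g) (GL_q4 g)). Qed.

Lemma GL_r62 g a b : GL_actF g (r62 rhoL piL a b) = r62 rhoL piL (lin g a) (lin g b).
Proof. exact: (morph_r62 (GL_q2 g) (GL_q4 g)). Qed.

Lemma GL_r44 g a b : GL_actF g (r44 rhoL piL a b) = r44 rhoL piL (lin g a) (lin g b).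
Proof. exact: (morph_r44 (GL_q2 g) (GL_q4 g)). Qed.

Definition torus (d : 'I_m -> K) : 'M[K]_m := diag_mx (\row_i d i).

Lemma adjmx_torus d : adjmx (torus d) = torus (fun i => (d i)^*).
Proof.
by apply/matrixP => i j; rewrite !mxE rmorphMn /= eq_sym; case: eqVneq => [->|].
Qed.

Lemma lin_torus d i : lin (torus d) 'X_i = d i *: 'X_i.
Proof.
rewrite linX (bigD1 i) //= !mxE eqxx mulr1n big1 ?addr0 // => j ji.
by rewrite !mxE (negbTE ji) mulr0n scale0r.
Qed.

Lemma lin_torus_mx d g j : lin (torus d) (lin g 'X_j) = \sum_i (g i j * d i) *: 'X_i.
Proof.
by rewrite linX linear_sum; apply: eq_bigr => i _; rewrite linearZ /= lin_torus scalerA.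
Qed.

(** The zeros project onto the first two variables, so only weights (p, q, 0, .., 0) survive, and
    the exponent of [s] reads q. *)
Definition weights2 (s : K) (i : 'I_m) : K := if i == i0 then 1 else if i == i1 then s else 0.
Definition weights3 (i : 'I_m) : K := if (i < 3)%N then 1 else 0.

Lemma torus2_mx s g j : lin (torus (weights2 s)) (lin g 'X_j) = g i0 j *: zv0 + s *: (g i1 j *: zv1).
Proof.
rewrite lin_torus_mx (bigD1 i0) //= (bigD1 i1) //= big1 => [|i /andP[ni0 ni1]].
  by rewrite /weights2 eqxx mulr1 addr0 scalerA mulrC.
by rewrite /weights2 (negbTE ni0) (negbTE ni1) mulr0 scale0r.
Qed.

Lemma torus3_mx g j : lin (torus weights3) (lin g 'X_j) =
  g i0 j *: zv0 + g i1 j *: zv1 + g i2 j *: zv2.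
Proof.
rewrite lin_torus_mx (bigD1 i0) //= (bigD1 i1) //= (bigD1 i2) //= big1; last first.
  move=> i; rewrite /weights3 -!(inj_eq val_inj) /=.
  by case: ltnP => //; [case: (val i) => [|[|[|]]]|rewrite mulr0 scale0r].
by rewrite /weights3 /= !mulr1 addr0 addrA.
Qed.

Definition equivariant (r : Z -> Z -> F) :=
  forall g a b, GL_actF g (r a b) = r (lin g a) (lin g b).

Lemma covariant_weight (r : Z -> Z -> F) n1 n2 s : covariant r n1 n2 -> equivariant r ->
  GL_actF (adjmx (torus (weights2 s))) (r zv0 zv1) = (s ^+ n2)^* *: r zv0 zv1.
Proof.
move=> [rh _ _] re; rewrite adjmx_torus re /zv0 /zv1 !lin_torus rh.
by rewrite /weights2 eqxx /= rmorph1 expr1n mul1r rmorphXn.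
Qed.

(** Gaussian elimination on the upper left 2 x 2 block of [g]: invariance under adding a multiple of
    the first argument to the second makes the second one s times a multiple of [zv1], which yields
    the factor s^n2. *)
Lemma covariant_torus (r : Z -> Z -> F) n1 n2 g : covariant r n1 n2 -> equivariant r ->
    (n2 < n1)%N \/ n1 = n2 /\ (forall a b, r a b = r b a) ->
  exists p : {poly F},
    (forall s, GL_actF (torus (weights2 s)) (GL_actF g (r zv0 zv1)) = s ^+ n2 *: p.[s%:A]) /\
    exists c : K, p`_0 = c *: r zv0 zv1.
Proof.
move=> [rh rs rp] re n12.
have rgE s : GL_actF (torus (weights2 s)) (GL_actF g (r zv0 zv1)) =
    r (g i0 i0 *: zv0 + s *: (g i1 i0 *: zv1)) (g i0 i1 *: zv0 + s *: (g i1 i1 *: zv1)).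
  by rewrite !re !torus2_mx.
move: (g i0 i0) (g i1 i0) (g i0 i1) (g i1 i1) rgE => a0 a1 b0 b1 rgE.
(* Without a pivot the arguments are exchanged and s^n1 comes out: the constant coefficient vanishes
   if n2 < n1, and for n1 = n2 the symmetry of [r] leads back to [r zv0 zv1]. *)
have [a00|a00] := eqVneq a0 0.
  pose v : F := (a1 ^+ n1 * b0 ^+ n2) *: r zv1 zv0.
  have n21 : (n2 <= n1)%N by case: n12 => [/ltnW|[->]].
  exists ('X^(n1 - n2) * v%:P); split=> [s|].
    rewrite rgE a00 scale0r add0r -[X in r _ X]scale1r !scalerA rh expr1n mulr1.
    rewrite rs -[X in r X _]scale1r rh expr1n mul1r hornerM hornerXn hornerC.
    rewrite exprZn expr1n -scalerAl mul1r /v !scalerA -exprD subnKC //.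
    by rewrite exprMn mulrA.
  case: n12 => [lt12|[e12 rC]].
    by exists 0; rewrite scale0r coefXnM subn_gt0 lt12.
  by exists (a1 ^+ n1 * b0 ^+ n2); rewrite e12 subnn mul1r coefC /v rC e12.
pose u s := a0 *: zv0 + s *: (a1 *: zv1).
have up : polyfam u by apply: polyfamD; [exact: polyfamC|exact: polyfam_id].
have [p hp] := rp u (fun=> zv1) up (polyfamC zv1).
(* [t] is the determinant of the block divided by the pivot. *)
pose t := (b1 - b0 * a1 / a0); exists ((t ^+ n2)%:A *: p); split=> [s|].
  rewrite rgE hornerZ -hp mulr_algl [RHS]scalerA -exprMn -/(u s).
  have -> : b0 *: zv0 + s *: (b1 *: zv1) = (s * t) *: zv1 + (b0 / a0) *: u s.
    rewrite /u scalerDr !scalerA divfK // addrCA -scalerDl; congr (_ + _ *: _).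
    by rewrite /t; field.
  by rewrite rs -[X in r X _]scale1r rh expr1n mul1r.
have := hp 0; rewrite /u scale0r addr0 scale0r horner_coef0 => p0.
exists (t ^+ n2 * a0 ^+ n1); rewrite coefZ mulr_algl -p0 -[X in r _ X]scale1r rh.
by rewrite expr1n mulr1 scalerA.
Qed.

End HighestWeightVectors.

Section Values.
Variables (K : numClosedFieldType) (Z F : comAlgType K) (rho pi : {linear Z -> F}).
Variables (ev : {rmorphism F -> K}) (a b c : Z).
Hypotheses (aa : ev (q2 rho a a) = 1) (bb : ev (q2 rho b b) = 1) (cc : ev (q2 rho c c) = 1).
Hypotheses (ab : ev (q2 rho a b) = 0) (ac : ev (q2 rho a c) = 0) (bc : ev (q2 rho b c) = 0).
Hypotheses (a4 : ev (q4 pi a a a a) = 1) (a3b : ev (q4 pi a a a b) = 0).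
Hypotheses (a2b2 : ev (q4 pi a a b b) = 0) (ab3 : ev (q4 pi a b b b) = 0).
Hypotheses (b4 : ev (q4 pi b b b b) = 0).

Let evE := (rmorphD, rmorphN, rmorphM, rmorphXn, rmorph_nat).

Lemma ev_r222 : ev (r222 rho a b c) = 1.
Proof. by rewrite /r222 !evE /= aa bb cc ab ac bc; ring. Qed.
Lemma ev_r42 : ev (r42 rho pi a b) = 1.
Proof. by rewrite /r42 !evE /= aa bb ab a4 a3b a2b2; ring. Qed.
Lemma ev_r62 : ev (r62 rho pi a b) = 4.
Proof. by rewrite /r62 /disc !evE /= aa bb ab a4 a3b a2b2; ring. Qed.
Lemma ev_r44 : ev (r44 rho pi a b) = - 16.
Proof. by rewrite /r44 /disc !evE /= aa bb ab a4 a3b a2b2 ab3 b4; ring. Qed.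
End Values.

Section Signs.
Variables (K : numClosedFieldType) (Z F : comAlgType K) (rho pi : {linear Z -> F}).
Variables (tau : {rmorphism F -> F}).
Hypothesis tau_q2 : forall a b, tau (q2 rho a b) = q2 rho a b.
Hypothesis tau_q4 : forall a b c d, tau (q4 pi a b c d) = - q4 pi a b c d.

Lemma sign_r42 a b : tau (r42 rho pi a b) = - r42 rho pi a b.
Proof. by rewrite /r42 !(rmorphD, rmorphN, rmorphM, rmorph_nat) /= !tau_q2 !tau_q4; ring. Qed.
Lemma sign_r62 a b : tau (r62 rho pi a b) = r62 rho pi a b.
Proof.
by rewrite /r62 /disc !(rmorphD, rmorphN, rmorphM, rmorphXn, rmorph_nat) /= !tau_q2 !tau_q4; ring.
Qed.
Lemma sign_r44 a b : tau (r44 rho pi a b) = r44 rho pi a b.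
Proof.
by rewrite /r44 /disc !(rmorphD, rmorphN, rmorphM, rmorphXn, rmorph_nat) /= !tau_q2 !tau_q4; ring.
Qed.
End Signs.

(** * Irreducibility of the four spans *)

Section Spans.
Variables (K : numClosedFieldType) (m : nat) (hm : (3 <= m)%N).
Notation Z := {mpoly K[m]}.
Notation F := (FK K m).
Notation N := #|{: mindex m 2 + mindex m 4}|.
Notation z0 := (zv0 K hm).
Notation z1 := (zv1 K hm).
Notation z2 := (zv2 K hm).
Notation rho := (rhoL K m).
Notation pi := (piL K m).
Notation s222 := (r222 rho z0 z1 z2).
Notation s42 := (r42 rho pi z0 z1).
Notation s62 := (r62 rho pi z0 z1).
Notation s44 := (r44 rho pi z0 z1).
Implicit Types (g h : 'M[K]_m) (u v w : F).

Definition point (j : 'I_m) (f : Z) : K := f.@[fun i => (i == j)%:R].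

(** A point where no highest weight vector vanishes: rho becomes the identity form on the first
    three variables, and pi the fourth power of the first coordinate. *)
Definition value (k : 'I_N) : K :=
  match enum_val k with
  | inl a => point (i0 hm) 'X_[mnm_of a] + point (i1 hm) 'X_[mnm_of a]
             + point (i2 hm) 'X_[mnm_of a]
  | inr b => point (i0 hm) 'X_[mnm_of b]
  end.

Lemma value_q2 i j : (q2 rho 'X_i 'X_j).@[value] =
  ((i == i0 hm) && (j == i0 hm))%:R + ((i == i1 hm) && (j == i1 hm))%:R
  + ((i == i2 hm) && (j == i2 hm))%:R.
Proof.
have [|a ea] := @mindexP m 2 (U_(i) + U_(j))%MM; first by rewrite mdegD !mdeg1.
have -> : q2 rho 'X_i 'X_j = rho_var K a.
  by rewrite /q2 -mpolyXD ea; exact: sum_mindexX.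
rewrite mevalXU /value enum_rankK /point -ea mpolyXD !mevalM !mevalXU.
by rewrite -!natrM !mulnb.
Qed.

Lemma value_q4 i j k l : (q4 pi 'X_i 'X_j 'X_k 'X_l).@[value] =
  [&& i == i0 hm, j == i0 hm, k == i0 hm & l == i0 hm]%:R.
Proof.
have [|b eb] := @mindexP m 4 (U_(i) + U_(j) + U_(k) + U_(l))%MM.
  by rewrite !mdegD !mdeg1.
have -> : q4 pi 'X_i 'X_j 'X_k 'X_l = pi_var K b.
  by rewrite /q4 -!mpolyXD eb; exact: sum_mindexX.
rewrite mevalXU /value enum_rankK /point -eb !mpolyXD !mevalM !mevalXU.
by rewrite -!natrM !mulnb -!andbA.
Qed.

Lemma r_neq0 : [/\ s222 <> 0, s42 <> 0, s62 <> 0 & s44 <> 0].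
Proof.
have ev0 (x : F) : x.@[value] != 0 -> x <> 0 by move=> + x0; rewrite x0 meval0 eqxx.
pose ev : {rmorphism F -> K} := meval value.
split; apply: ev0.
- rewrite -[X in X != 0]/(ev _) ev_r222 ?oner_eq0 //; by rewrite /ev /= value_q2 /= ?addr0 ?add0r.
- rewrite -[X in X != 0]/(ev _) ev_r42 ?oner_eq0 //; by rewrite /ev /= ?value_q2 ?value_q4 /= ?addr0 ?add0r.
- rewrite -[X in X != 0]/(ev _) ev_r62 ?pnatr_eq0 //; by rewrite /ev /= ?value_q2 ?value_q4 /= ?addr0 ?add0r.
- rewrite -[X in X != 0]/(ev _) ev_r44 ?oppr_eq0 ?pnatr_eq0 //; by rewrite /ev /= ?value_q2 ?value_q4 /= ?addr0 ?add0r.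
Qed.

Lemma irreducible_cov r n1 n2 : covariant r n1 n2 -> @equivariant K m r ->
    (n2 < n1)%N \/ n1 = n2 /\ (forall a b, r a b = r b a) -> r z0 z1 <> 0 ->
  GL_irreducible (GL_span (r z0 z1)).
Proof.
move=> rc re n12 r0.
apply: (@GL_span_irreducible _ _ _ (fun s => torus (weights2 hm s)) n2 r0) => [s|g].
  exact: covariant_weight rc re.
exact: covariant_torus rc re n12.
Qed.

Lemma torus3_r222 g : exists c,
  GL_actF (torus (@weights3 K m)) (GL_actF g s222) = c *: s222.
Proof.
rewrite !GL_r222 !torus3_mx.
pose o (k : 'I_3) : 'I_m := tnth [tuple i0 hm; i1 hm; i2 hm] k.
have [c [e _]] := r222_gram rho (fun i j => g (o i) (o j)) z0 z1 z2.
by exists c; rewrite -e.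
Qed.

(** Three vectors in a plane have Gram determinant 0. *)
Lemma torus2_r222 g : GL_actF (torus (weights2 hm 1)) (GL_actF g s222) = 0.
Proof.
rewrite !GL_r222 !torus2_mx !scale1r.
pose o (k : 'I_3) : 'I_m := tnth [tuple i0 hm; i1 hm; i2 hm] k.
have [c [e c0]] := r222_gram rho (fun i j => if i == 2%:R then 0 else g (o i) (o j)) z0 z1 z2.
move: e; rewrite c0 // scale0r => <-; rewrite !scale0r !addr0.
by [].
Qed.

Lemma irreducible_spans : [/\ GL_irreducible (GL_span s222), GL_irreducible (GL_span s42),
  GL_irreducible (GL_span s62) & GL_irreducible (GL_span s44)].
Proof.
have [n222 n42 n62 n44] := r_neq0; split.
- apply: (@GL_span_irreducible _ _ _ (fun=> torus (@weights3 K m)) 0 n222) => [s|g].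
    by rewrite adjmx_torus GL_r222 /zv0 /zv1 /zv2 !lin_torus /weights3 /= !rmorph1 !scale1r.
  have [c e] := torus3_r222 g; exists (c *: s222)%:P; split=> [s|].
    by rewrite hornerC e scale1r.
  by exists c; rewrite coefC.
- by apply: irreducible_cov (covariant_r42 _ _) _ _ n42; [exact: GL_r42|left].
- by apply: irreducible_cov (covariant_r62 _ _) _ _ n62; [exact: GL_r62|left].
- apply: irreducible_cov (covariant_r44 _ _) _ _ n44; first exact: GL_r44.
  by right; split=> [//|a b]; exact: (r44C _ _ a b).
Qed.

Lemma adjmx_scalar (t : K) : adjmx (t%:M : 'M[K]_m) = (t^*)%:M.
Proof. by rewrite /adjmx map_scalar_mx tr_scalar_mx. Qed.

Lemma lin_scalar (t : K) j : lin (t%:M : 'M[K]_m) 'X_j = t *: 'X_j.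
Proof.
rewrite linX (bigD1 j) //= mxE eqxx mulr1n big1 ?addr0 // => i ij.
by rewrite mxE (negbTE ij) mulr0n scale0r.
Qed.

(** A single scalar matrix detects the degree, because the powers of 2 are distinct in [K]; it is
    self-adjoint, so different degrees are orthogonal. *)
Definition homogeneous d u := GL_actF 2%:M u = 2 ^+ d *: u.

Lemma homogeneous_submodule d : GL_submodule (homogeneous d).
Proof.
split; first split.
- by rewrite /homogeneous !raddf0.
- move=> c u v hu hv; rewrite /homogeneous linearP /= hu hv scalerDr !scalerA.
  by rewrite mulrC.
move=> g _ u hu; rewrite /homogeneous -GL_actF_mul -scalar_mxC GL_actF_mul hu.
by rewrite linearZ.
Qed.

Lemma homogeneous_orth d e u v : homogeneous d u -> homogeneous e v -> d <> e ->
  herm u v = 0.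
Proof.
move=> hu hv de; have := herm_adjoint 2%:M u v.
rewrite adjmx_scalar conjC_nat hu hv hermZl hermZr rmorphXn /= conjC_nat => /eqP.
rewrite -subr_eq0 -mulrBl mulf_eq0 subr_eq0 -!natrX eqr_nat eqn_exp2l // => /orP[/eqP//|].
by move/eqP.
Qed.

Lemma homogeneousM d e u v : homogeneous d u -> homogeneous e v ->
  homogeneous (d + e) (u * v).
Proof.
move=> hu hv; rewrite /homogeneous rmorphM /= hu hv exprD.
by rewrite -scalerAl -scalerAr scalerA.
Qed.

Lemma homogeneous_cov r n1 n2 : covariant r n1 n2 -> @equivariant K m r ->
  homogeneous (n1 + n2) (r z0 z1).
Proof. by move=> [rh _ _] re; rewrite /homogeneous re !lin_scalar rh exprD. Qed.

End Spans.

(** * Orthogonality of the spans to each other and to their multiples *)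

Section Orthogonality.
Variables (K : numClosedFieldType) (m : nat) (hm : (3 <= m)%N).
Notation Z := {mpoly K[m]}.
Notation F := (FK K m).
Notation N := #|{: mindex m 2 + mindex m 4}|.
Notation z0 := (zv0 K hm).
Notation z1 := (zv1 K hm).
Notation z2 := (zv2 K hm).
Notation rho := (rhoL K m).
Notation pi := (piL K m).
Notation s222 := (r222 rho z0 z1 z2).
Notation s42 := (r42 rho pi z0 z1).
Notation s62 := (r62 rho pi z0 z1).
Notation s44 := (r44 rho pi z0 z1).
Implicit Types (g h : 'M[K]_m) (u v w : F).

Lemma mindex_ind (P : 'I_N -> Prop) :
  (forall a : mindex m 2, P (enum_rank (inl a))) ->
  (forall b : mindex m 4, P (enum_rank (inr b))) -> forall k, P k.
Proof. by move=> Pl Pr k; rewrite -(enum_valK k); case: (enum_val k). Qed.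

Definition psign (k : 'I_N) : K := if enum_val k is inl _ then 1 else -1.

(** The sign change pi -> - pi, self-adjoint and commuting with the action. It separates [s42], odd
    in pi, from [s62] and [s44], which are even. *)
Definition flip : F -> F := linsubst (fun k l => (k == l)%:R * psign l).

HB.instance Definition _ := GRing.LRMorphism.on flip.

Lemma flipX k : flip 'X_k = psign k *: 'X_k.
Proof.
rewrite /flip linsubstX (bigD1 k) //= eqxx mul1r big1 ?addr0 // => l lk.
by rewrite (negbTE lk) mul0r scale0r.
Qed.

Lemma flip_rho f : flip (rhoF f) = rhoF f.
Proof.
rewrite linear_sum; apply: eq_bigr => a _; rewrite linearZ /= flipX.
by rewrite /psign enum_rankK scale1r.
Qed.

Lemma flip_pi f : flip (piF f) = - piF f.
Proof.
rewrite linear_sum -sumrN; apply: eq_bigr => a _; rewrite linearZ /= flipX.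
by rewrite /psign enum_rankK scaleN1r scalerN.
Qed.

Lemma flip_GL g u : flip (GL_actF g u) = GL_actF g (flip u).
Proof.
elim/F_ind: u => [|f k a IHf IHk|a f IH|b f IH].
- by rewrite !rmorph1.
- by rewrite !linearP /= IHf IHk.
- by rewrite !rmorphM /= IH GL_rho !flip_rho GL_rho.
- by rewrite !rmorphM /= IH GL_pi !flip_pi rmorphN /= GL_pi.
Qed.

Lemma flip_herm u v : herm (flip u) v = herm u (flip v).
Proof.
apply: fischer_adjoint => [k|k l]; first exact: gnorm_gt0.
rewrite rmorphM /= conjC_nat eq_sym; case: eqVneq => [->|_]; last by rewrite !mul0r !mulr0.
congr (_ * _); rewrite !mul1r /psign; case: enum_val => _; first by rewrite rmorph1.
by rewrite rmorphN rmorph1.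
Qed.

Definition flip_eigen (s : K) u := flip u = s *: u.

Lemma flip_submodule s : GL_submodule (flip_eigen s).
Proof.
split; first split.
- by rewrite /flip_eigen !raddf0.
- move=> c u v hu hv; rewrite /flip_eigen linearP /= hu hv scalerDr !scalerA.
  by rewrite mulrC.
by move=> g _ u hu; rewrite /flip_eigen flip_GL hu linearZ.
Qed.

Lemma flip_q2 a b : flip (q2 rho a b) = q2 rho a b.
Proof. exact: flip_rho. Qed.
Lemma flip_q4 a b c d : flip (q4 pi a b c d) = - q4 pi a b c d.
Proof. exact: flip_pi. Qed.

Definition hwv (i : 'I_4) : F := tnth [tuple s222; s42; s62; s44] i.
Definition hdeg (i : 'I_4) : nat := tnth [tuple 6; 6; 8; 8] i.

Lemma ord4_ind (P : 'I_4 -> Prop) : P 0 -> P 1 -> P 2%:R -> P 3%:R -> forall i, P i.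
Proof.
move=> P0 P1 P2 P3 i; have : i \in [:: 0; 1; 2%:R; 3%:R].
  by case: i => [[|[|[|[|]]]]].
by rewrite !inE => /or4P[] /eqP ->.
Qed.

Lemma span_homogeneous i u : GL_span (hwv i) u -> homogeneous (hdeg i) u.
Proof.
move: u; apply: GL_span_min; first exact: homogeneous_submodule.
elim/ord4_ind: i; rewrite /hwv /hdeg /tnth /=.
- by rewrite /homogeneous GL_r222 !lin_scalar r222Z.
- exact: homogeneous_cov (covariant_r42 _ _) (@GL_r42 K m).
- exact: homogeneous_cov (covariant_r62 _ _) (@GL_r62 K m).
- exact: homogeneous_cov (covariant_r44 _ _) (@GL_r44 K m).
Qed.

Lemma hwv_torus1 i : i != 0 -> GL_actF (adjmx (torus (weights2 hm 1))) (hwv i) = hwv i.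
Proof.
elim/ord4_ind: i => // _; rewrite /hwv /tnth /=.
- by rewrite (covariant_weight _ _ (covariant_r42 _ _) (@GL_r42 K m)) expr1n rmorph1 scale1r.
- by rewrite (covariant_weight _ _ (covariant_r62 _ _) (@GL_r62 K m)) expr1n rmorph1 scale1r.
- by rewrite (covariant_weight _ _ (covariant_r44 _ _) (@GL_r44 K m)) expr1n rmorph1 scale1r.
Qed.

Lemma span222_torus u : GL_span s222 u -> GL_actF (torus (weights2 hm 1)) u = 0.
Proof.
move=> su; suff /(_ u su 1%:M) : GL_span s222 `<=`
    [set u | forall g, GL_actF (torus (weights2 hm 1)) (GL_actF g u) = 0].
  by rewrite GL_actF1.
apply: GL_span_min => [|g]; last exact: torus2_r222.
split; first split.
- by move=> g; rewrite !raddf0.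
- by move=> c a b ha hb g; rewrite !linearP /= ha hb scaler0 addr0.
by move=> g _ a ha h; rewrite -(GL_actF_mul h g a).
Qed.

Lemma span_orth i j u v : i != j -> GL_span (hwv i) u -> GL_span (hwv j) v ->
  herm u v = 0.
Proof.
wlog lij : i j u v / (i < j)%N => [hw ij hu hv|ij hu hv].
  have /orP[lij|lij] : (i < j)%N || (j < i)%N by rewrite -neq_ltn.
    exact: (hw i j).
  by rewrite herm_sym (hw j i) ?rmorph0 // eq_sym.
have [dij|/eqP dij] := eqVneq (hdeg i) (hdeg j); last first.
  exact: homogeneous_orth (span_homogeneous hu) (span_homogeneous hv) dij.
(* The rank-two projection kills the span of [s222], while its adjoint fixes the other highest
   weight vectors. *)
have [i0|ni0] := eqVneq i 0.
  have j0 : j != 0 by rewrite -val_eqE /= -lt0n (leq_ltn_trans _ lij).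
  rewrite i0 in hu; move: u v hu hv; apply: GL_span_orth => g ug.
  rewrite -(hwv_torus1 j0) herm_adjoint_r adjmxK span222_torus ?herm0l //.
  by case: (GL_span_submodule s222) => _; apply => //; exact: GL_span_refl.
(* What remains is [s62] against [s44]: the second weight of [s62] is 2, whereas translates of [s44]
   only involve exponents at least 4. *)
have [ei ej] : i = 2%:R /\ j = 3%:R.
  move: ni0 lij dij; elim/ord4_ind: i {hu ij}; elim/ord4_ind: j {hv} => //.
rewrite ei in hu; rewrite ej in hv; rewrite herm_sym.
suff -> : herm v u = 0 by rewrite rmorph0.
move: v u hv hu; apply: GL_span_orth => g _.
apply: (@herm_weight_lt _ _ _ _ (fun s => torus (weights2 hm s)) 2 4) => // [s|].
  exact: covariant_weight (covariant_r62 _ _) (@GL_r62 K m).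
have [|p [hp _]] := covariant_torus hm g (covariant_r44 rho pi) (@GL_r44 K m).
  by right; split=> [//|a b]; exact: (r44C _ _ a b).
by exists p.
Qed.

Lemma span_flip i u : GL_span (hwv i) u -> i != 0 ->
  flip_eigen (if i == 1 then -1 else 1) u.
Proof.
move=> hu i0; move: u hu; apply: GL_span_min; first exact: flip_submodule.
move: i0; elim/ord4_ind: i => // _; rewrite /flip_eigen /hwv /tnth /=.
- by rewrite scaleN1r; exact: (sign_r42 flip_q2 flip_q4).
- by rewrite scale1r; exact: (sign_r62 flip_q2 flip_q4).
- by rewrite scale1r; exact: (sign_r44 flip_q2 flip_q4).
Qed.

Lemma lin_scalarX (t : K) (M : 'X_{1..m}) :
  lin (t%:M : 'M[K]_m) 'X_[M] = t ^+ mdeg M *: 'X_[M].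
Proof.
rewrite mpolyXE_id rmorph_prod; under eq_bigr => i _ do
  rewrite rmorphXn /= lin_scalar exprZn.
by rewrite scaler_prod prodrXr -mdegE.
Qed.

Lemma homogeneous_rho (a : mindex m 2) : homogeneous 2 (rho_var K a).
Proof.
rewrite /homogeneous GL_rho_var lin_scalarX mdeg_mindex linearZ /=.
by rewrite /rhoF sum_mindexX.
Qed.

Lemma homogeneous_pi (b : mindex m 4) : homogeneous 4 (pi_var K b).
Proof.
rewrite /homogeneous GL_pi_var lin_scalarX mdeg_mindex linearZ /=.
by rewrite /piF sum_mindexX.
Qed.

Lemma monomial_homogeneous (M : 'X_{1..N}) :
  exists2 d, homogeneous d ('X_[M] : F) & (d <= 1)%N -> M = 0%MM.
Proof.
elim: {M}(mdeg M) {-2}M (erefl (mdeg M)) => [|d IH] M.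
  move/eqP; rewrite mdeg_eq0 => /eqP ->; exists 0%N => //.
  by rewrite /homogeneous mpolyX0 rmorph1 scale1r.
case/mdegS => k [M' [-> /IH [e hM' _]]]; rewrite mpolyXD.
elim/mindex_ind: k => [a|b].
  by exists (2 + e)%N => //; exact: homogeneousM (homogeneous_rho a) hM'.
by exists (4 + e)%N => //; exact: homogeneousM (homogeneous_pi b) hM'.
Qed.

(** Multiples of the span of [s222] die under the rank-two projection; rho times the span of [s42]
    has the wrong sign under [flip]. *)
Lemma rho_augmented i j u v (a : mindex m 2) : (hdeg i < hdeg j)%N ->
  GL_span (hwv i) u -> GL_span (hwv j) v -> herm (rho_var K a * u) v = 0.
Proof.
move=> dij hu hv.
have j1 : (1 < j)%N by move: dij; elim/ord4_ind: j {hv}; elim/ord4_ind: i {hu}.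
have [i0|i1] : i = 0 \/ i = 1.
    by move: dij; elim/ord4_ind: i {hu} => //; elim/ord4_ind: j {hv j1} => //; auto.
  suff : GL_span (hwv j) `<=` [set v | forall x, (exists2 f, GL_span s222 f &
      exists q, x = rhoF q * f) -> herm x v = 0].
    move/(_ v hv); apply; exists u; first by rewrite i0 in hu.
    by exists 'X_[a]; rewrite /rhoF sum_mindexX.
  apply: GL_span_min.
    apply: herm_submodule => g ug _ [f sf [q ->]]; exists (GL_actF g f).
      by case: (GL_span_submodule s222) => _; apply.
    by exists (lin g q); rewrite rmorphM /= GL_rho.
  move=> _ [f sf [q ->]]; rewrite -hwv_torus1; last by rewrite -val_eqE /= -lt0n ltnW.
  by rewrite herm_adjoint_r adjmxK rmorphM /= (span222_torus sf) mulr0 herm0l.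
have fv : flip v = v.
  by rewrite (span_flip hv) -?val_eqE /= ?(gtn_eqF j1) ?scale1r // -lt0n ltnW.
have fu : flip (rho_var K a * u) = - (rho_var K a * u).
  rewrite rmorphM /= (span_flip hu) i1 //= scaleN1r mulrN; congr (- (_ * _)).
  by have := flip_rho 'X_[a]; rewrite /rhoF sum_mindexX.
have := flip_herm (rho_var K a * u) v; rewrite fu fv -scaleN1r hermZl mulN1r.
move/eqP; rewrite -subr_eq0 -opprD oppr_eq0 -mulr2n mulrn_eq0 /=.
by move/eqP.
Qed.

(** The degrees are 6 and 8, so a nontrivial multiple can only meet one of the spans in its own
    degree if degree 6 is multiplied by a single rho. Everything else is orthogonal by degree. *)
Lemma span_augmented i j u v : GL_span (hwv i) u -> GL_span (hwv j) v ->
  forall a k, herm (a * 'X_k * u) v = 0.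
Proof.
move=> hu hv a k; elim/mpolyind: a => [|c M a _ _ IH]; first by rewrite !mul0r herm0l.
rewrite !mulrDl hermDl IH addr0 -!scalerAl hermZl.
have [d hd d1] := monomial_homogeneous M.
have hdu := span_homogeneous hu; have hdv := span_homogeneous hv.
apply/eqP; rewrite mulf_eq0; apply/orP; right; apply/eqP.
have i68 (n : 'I_4) : hdeg n = 6%N \/ hdeg n = 8%N by elim/ord4_ind: n; auto.
elim/mindex_ind: k {IH} => [b|b].
  have hb := homogeneous_rho b.
  have [e|/eqP ne] := eqVneq (d + 2 + hdeg i)%N (hdeg j); last first.
    exact: (homogeneous_orth (homogeneousM (homogeneousM hd hb) hdu) hdv ne).
  have dle : (d <= 1)%N by move: e; case: (i68 i) => ->; case: (i68 j) => ->; lia.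
  rewrite d1 // mpolyX0 mul1r; apply: rho_augmented hu hv.
  by lia.
have hb := homogeneous_pi b.
apply: (homogeneous_orth (homogeneousM (homogeneousM hd hb) hdu) hdv).
by case: (i68 i) => ->; case: (i68 j) => ->; lia.
Qed.

End Orthogonality.

Section Vanishing.
Variables (Z F R : comNzRingType) (rho pi : {additive Z -> F}) (ev : {rmorphism F -> R}).
Variables (I : Type) (z : I -> Z) (x y : I -> R).
Hypothesis ev2 : forall i j, ev (q2 rho (z i) (z j)) = x i * y j + y i * x j.
Hypothesis ev4 : forall i j k l, ev (q4 pi (z i) (z j) (z k) (z l)) =
  16 * (x i * x j * x k * x l) + y i * y j * y k * y l.

Let evE := (rmorphD, rmorphN, rmorphM, rmorphXn, rmorph_nat).

Lemma vanish_r222 i j k : ev (r222 rho (z i) (z j) (z k)) = 0.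
Proof. by rewrite /r222 !evE /= !ev2; ring. Qed.
Lemma vanish_r42 i j : ev (r42 rho pi (z i) (z j)) = 0.
Proof. by rewrite /r42 !evE /= !ev2 !ev4; ring. Qed.
Lemma vanish_r62 i j : ev (r62 rho pi (z i) (z j)) = 0.
Proof. by rewrite /r62 /disc !evE /= !ev2 !ev4; ring. Qed.
Lemma vanish_r44 i j : ev (r44 rho pi (z i) (z j)) = 0.
Proof. by rewrite /r44 /disc !evE /= !ev2 !ev4; ring. Qed.
End Vanishing.

(** * The map to the polynomial ring and the coordinates u, v *)

Section Substitution.
Variables (K : numClosedFieldType) (m : nat).
Notation KV := {mpoly K[m + m]}.
Notation F := (FK K m).
Notation x := (@xvar K m).
Notation y := (@yvar K m).
Notation rho := (rhoL K m).
Notation pi := (piL K m).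

Definition gens : F -> KV := subst (fun k => gen K (enum_val k)).

HB.instance Definition _ := GRing.LRMorphism.on gens.

Lemma gens_q2 i j : gens (q2 rho 'X_i 'X_j) = 2^-1 *: (x i * y j + y i * x j).
Proof.
have [|a ea] := @mindexP m 2 (U_(i) + U_(j))%MM; first by rewrite mdegD !mdeg1.
have -> : q2 rho 'X_i 'X_j = rho_var K a.
  by rewrite /q2 -mpolyXD ea; exact: sum_mindexX.
by rewrite /gens substX enum_rankK /= qgen_polar2 -ea mpolyXD polar2M.
Qed.

Lemma gens_q4 i j k l : gens (q4 pi 'X_i 'X_j 'X_k 'X_l) =
  x i * x j * x k * x l + y i * y j * y k * y l.
Proof.
have [|b eb] := @mindexP m 4 (U_(i) + U_(j) + U_(k) + U_(l))%MM.
  by rewrite !mdegD !mdeg1.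
have -> : q4 pi 'X_i 'X_j 'X_k 'X_l = pi_var K b.
  by rewrite /q4 -!mpolyXD eb; exact: sum_mindexX.
rewrite /gens substX enum_rankK /= pgen_power4 -eb !mpolyXD /power4.
by do 6!rewrite rmorphM /=; rewrite !substX.
Qed.

Lemma halfM4 (a b c d : KV) :
  (2^-1 *: a) * (2^-1 *: b) * (2^-1 *: c) * (2^-1 *: d) = 16^-1 *: (a * b * c * d).
Proof.
by rewrite -!scalerAl -!scalerAr -!scalerAl !scalerA; congr (_ *: _); field.
Qed.

Lemma gens_hwv (hm : (3 <= m)%N) i : gens (hwv K hm i) = 0.
Proof.
(* Halving x removes the denominator from the image of [q2] and puts a factor 16 into that of [q4];
   the relations then vanish by identities over any commutative ring. *)
pose hx i : KV := 2^-1 *: x i.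
have e2 k l : gens (q2 rho 'X_k 'X_l) = hx k * y l + y k * hx l.
  by rewrite gens_q2 scalerDr -scalerAl -scalerAr.
have e4 k l k' l' : gens (q4 pi 'X_k 'X_l 'X_k' 'X_l') =
    16 * (hx k * hx l * hx k' * hx l') + y k * y l * y k' * y l'.
  by rewrite gens_q4 /hx halfM4 mulr_natl -scaler_nat scalerA mulfV ?scale1r ?pnatr_eq0.
elim/ord4_ind: i; rewrite /hwv /tnth /=.
- exact: (vanish_r222 e2).
- exact: (vanish_r42 e2 e4).
- exact: (vanish_r62 e2 e4).
- exact: (vanish_r44 e2 e4).
Qed.

(** Expresses x and y in terms of u = x + y and v = i (x - y); in the result [x] and [y] stand for u
    and v. *)
Definition diagonalize : KV -> KV :=
  subst (on_xy (fun i => 2^-1 *: (x i - 'i *: y i)) (fun i => 2^-1 *: (x i + 'i *: y i))).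

HB.instance Definition _ := GRing.LRMorphism.on diagonalize.

Definition Phi : F -> KV := diagonalize \o gens.

HB.instance Definition _ := GRing.LRMorphism.on Phi.

Lemma iyM i j : ('i *: y i) * ('i *: y j) = - (y i * y j).
Proof. by rewrite -scalerAl -scalerAr scalerA -expr2 sqrCi scaleN1r. Qed.

Lemma Phi_q2 i j : Phi (q2 rho 'X_i 'X_j) = 4^-1 *: (x i * x j + y i * y j).
Proof.
rewrite /Phi /= gens_q2 linearZ linearD !rmorphM /= /diagonalize !substX !on_xyx !on_xyy.
rewrite -!scalerAl -!scalerAr !scalerA -scalerDr scalerA.
have e : (x i - 'i *: y i) * (x j + 'i *: y j) + (x i + 'i *: y i) * (x j - 'i *: y j) =
    2 *: (x i * x j + y i * y j).
  by rewrite scaler_nat -[y i * y j]opprK -iyM; ring.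
rewrite e scalerA; congr (_ *: _); by field.
Qed.

Lemma Phi_q4 i j k l : Phi (q4 pi 'X_i 'X_j 'X_k 'X_l) =
  8^-1 *: (x i * x j * (x k * x l) + y i * y j * (y k * y l)
           - (x i * x j * (y k * y l) + x k * x l * (y i * y j))
           - (x i * x k * (y j * y l) + x j * x l * (y i * y k))
           - (x i * x l * (y j * y k) + x j * x k * (y i * y l))).
Proof.
rewrite /Phi /= gens_q4 linearD !rmorphM /= /diagonalize !substX !on_xyx !on_xyy.
rewrite !halfM4 -scalerDr.
have N a b : y a * y b = - (('i *: y a) * ('i *: y b)) by rewrite iyM opprK.
rewrite !N; move: ('i *: y i) ('i *: y j) ('i *: y k) ('i *: y l) => a b c d.
set X := (X in 16^-1 *: X); set Y := (X in _ = 8^-1 *: X).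
have -> : X = 2 *: Y by rewrite /X /Y scaler_nat; ring.
rewrite scalerA; congr (_ *: _); by field.
Qed.

Lemma F_gen (P : F -> Prop) :
  P 1 -> (forall f g a, P f -> P g -> P (a *: f + g)) ->
  (forall i j f, P f -> P (q2 rho 'X_i 'X_j * f)) ->
  (forall i j k l f, P f -> P (q4 pi 'X_i 'X_j 'X_k 'X_l * f)) -> forall f, P f.
Proof.
move=> P1 PD P2 P4; elim/mpoly_indX => // k f Pf; elim/mindex_ind: k => [a|b].
  have [i [j ea]] := mdeg2P (mdeg_mindex a).
  have -> : 'X_(enum_rank (inl a)) = q2 rho 'X_i 'X_j.
    by rewrite /q2 -mpolyXD -ea; apply/esym; exact: sum_mindexX.
  exact: P2.
have /mdegS[i [b1 [eb /mdegS[j [b2 [eb1 /mdeg2P[k [l eb2]]]]]]]] := mdeg_mindex b.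
have -> : 'X_(enum_rank (inr b)) = q4 pi 'X_i 'X_j 'X_k 'X_l.
  rewrite /q4 -!mpolyXD -!addmA -eb2 -eb1 -eb; apply/esym; exact: sum_mindexX.
exact: P4.
Qed.

Definition lform (a : {mpoly K[m]}) := exists c : 'I_m -> K, a = \sum_i c i *: 'X_i.

Lemma lformX i : lform 'X_i.
Proof.
exists (fun j => (j == i)%:R); rewrite (bigD1 i) //= eqxx scale1r big1 ?addr0 // => j ji.
by rewrite (negbTE ji) scale0r.
Qed.

Lemma lformD a b : lform a -> lform b -> lform (a + b).
Proof.
move=> [c ->] [d ->]; exists (fun i => c i + d i); rewrite -big_split.
by apply: eq_bigr => i _; rewrite scalerDl.
Qed.

Lemma lformN a : lform a -> lform (- a).
Proof.
move=> [c ->]; exists (fun i => - c i); rewrite -sumrN.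
by apply: eq_bigr => i _; rewrite scaleNr.
Qed.

Lemma lform_lin (hm : (3 <= m)%N) a b c : lform a -> lform b -> lform c ->
  exists g : 'M[K]_m, [/\ lin g (zv0 K hm) = a, lin g (zv1 K hm) = b & lin g (zv2 K hm) = c].
Proof.
move=> [u ->] [v ->] [w ->].
exists (\matrix_(i, j) (if j == i0 hm then u i else if j == i1 hm then v i else w i)).
by split; rewrite linX; apply: eq_bigr => i _; rewrite mxE.
Qed.

End Substitution.

(** * Generation and minimality *)

Section Ideals.
Variables (K : numClosedFieldType) (m : nat).
Notation F := (FK K m).
Implicit Types (X I : set F).

Lemma smallest_idealP X : ideal (smallest (@ideal K m) X).
Proof.
split=> [I [[I0 _ _] _] //|u v hu hv I hI|a u hu I hI].
  by case: (hI) => -[_ ID _] _; apply: ID; [exact: hu|exact: hv].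
by case: (hI) => -[_ _ IM] _; apply: IM; exact: hu.
Qed.

Lemma sub_smallest_ideal X : X `<=` smallest (@ideal K m) X.
Proof. by move=> u Xu I [_ XI]; exact: XI. Qed.

Lemma smallest_ideal_min X I : ideal I -> X `<=` I -> smallest (@ideal K m) X `<=` I.
Proof. by move=> hI XI u; apply. Qed.

Lemma ideal_is_ideal I : ideal I -> is_ideal I.
Proof. by case. Qed.

Lemma sum_subspaces_subspace s (W : 'I_s -> set F) :
  (forall i, subspace (W i)) -> subspace (sum_subspaces W).
Proof.
move=> hW; split; first by exists (fun=> 0) => [i|]; [case: (hW i)|rewrite big1].
move=> c _ _ [u hu ->] [v hv ->]; exists (fun i => c *: u i + v i).
  by move=> i; case: (hW i) => _; apply.
by rewrite scaler_sumr -big_split.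
Qed.

Lemma sub_sum_subspaces s (W : 'I_s -> set F) i :
  (forall i, subspace (W i)) -> W i `<=` sum_subspaces W.
Proof.
move=> hW u Wu; exists (fun j => if j == i then u else 0).
  by move=> j; case: eqVneq => [->|_] //; case: (hW j).
by rewrite (bigD1 i) //= eqxx big1 ?addr0 // => j /negbTE ->.
Qed.
End Ideals.

Section Main.
Variables (K : numClosedFieldType) (w : K) (m : nat).
Variables (hw : 4.-primitive_root w) (hm : (3 <= m)%N).
Notation F := (FK K m).
Notation z0 := (zv0 K hm).
Notation z1 := (zv1 K hm).
Notation z2 := (zv2 K hm).
Notation rho := (rhoL K m).
Notation pi := (piL K m).
Notation I := (kernel (@phi K w m hw)).
Notation W := (fun i => GL_span (hwv K hm i)).

Lemma kernelE f : I f <-> gens f = 0.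
Proof.
rewrite /kernel /= /gens -(inv_poly_phi hw); split=> [->|f0]; first by rewrite raddf0.
by apply: val_inj; rewrite [LHS]f0 raddf0.
Qed.

Lemma kernel_ideal : ideal I.
Proof.
split=> [|u v|a u]; rewrite /kernel /=; first by rewrite raddf0.
  by move=> hu hv; rewrite raddfD /= hu hv addr0.
by move=> hu; rewrite rmorphM /= hu mulr0.
Qed.

Lemma kernel_GL_ideal : GL_ideal I.
Proof.
split; first exact: kernel_ideal.
move=> g _ f; rewrite /kernel /= => f0; apply: val_inj.
by rewrite [LHS](phi_equivariant hw) f0 !raddf0.
Qed.

Lemma span_kernel i : W i `<=` I.
Proof.
apply: GL_span_min; last by apply/kernelE; exact: gens_hwv.
case: kernel_GL_ideal => [[I0 ID IM] sI]; split; last exact: sI.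
split=> [|c u v Iu Iv]; first exact: I0.
by apply: (ID _ _ _ Iv); rewrite -mulr_algl; exact: (IM _ _ Iu).
Qed.

Lemma span_subspace i : subspace (W i).
Proof. by case: (GL_span_submodule (hwv K hm i)). Qed.

Lemma kernel_generated : I `<=` smallest (@ideal K m) (sum_subspaces W).
Proof.
set J := smallest (@ideal K m) _; have hJ : ideal J by exact: smallest_idealP.
have [J0 JD JM] := hJ.
have WJ i : W i `<=` J.
  by move=> u Wu; apply: sub_smallest_ideal; exact: sub_sum_subspaces span_subspace _ Wu.
(* Singular [g] must be allowed, since the linear forms to which the relations are transported may
   be dependent. *)
have GJ i g : J (GL_actF g (hwv K hm i)).
  apply: (WJ i); apply: (GL_submodule_mx g (GL_span_submodule _)).
  exact: GL_span_refl.
have Jdiv n (u : F) : J (n.+1%:R * u) -> J u.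
  move=> Ju; have := JM (n.+1%:R^-1 : K)%:A _ Ju; rewrite mulr_algl mulr_natl -scaler_nat scalerA.
  by rewrite mulVf ?scale1r // pnatr_eq0.
have J222 a b c : lform a -> lform b -> lform c -> J (r222 rho a b c).
  move=> la lb lc; have [g [<- <- <-]] := lform_lin hm la lb lc.
  by rewrite -GL_r222; exact: (GJ 0).
have J42 a b : lform a -> lform b -> J (r42 rho pi a b).
  move=> la lb; have [g [<- <- _]] := lform_lin hm la lb lb.
  by rewrite -GL_r42; exact: (GJ 1).
have J62 a b : lform a -> lform b -> J (r62 rho pi a b).
  move=> la lb; have [g [<- <- _]] := lform_lin hm la lb lb.
  by rewrite -GL_r62; exact: (GJ 2%:R).
have J44 a b : lform a -> lform b -> J (r44 rho pi a b).
  move=> la lb; have [g [<- <- _]] := lform_lin hm la lb lb.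
  by rewrite -GL_r44; exact: (GJ 3%:R).
have lX := @lformX K m; have lD := @lformD K m; have lN := @lformN K m.
move=> f /kernelE f0.
apply: (@kernel_sub K F m J (ideal_is_ideal hJ) (fun i j => q2 rho 'X_i 'X_j)
  (fun i j k l => q4 pi 'X_i 'X_j 'X_k 'X_l) _ _ _ _ _ _ (@Phi K m)) => //.
- by move=> i j; exact: q2C.
- by move=> i j k l; exact: q4C12.
- by move=> i j k l; exact: q4C23.
- by move=> i j k l; exact: q4C34.
- by move=> *; apply: (J_minor lD lN JD JM Jdiv J222 J42 J62 J44).
- by move=> *; apply: (J_curv_pairs lD lN JD JM Jdiv J222 J42).
- exact: Phi_q2.
- exact: Phi_q4.
- exact: F_gen.
- by rewrite -[LHS]/(diagonalize (gens f)) f0 raddf0.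
Qed.

Lemma sum_spans_kernel : sum_subspaces W `<=` I.
Proof.
move=> _ [vs hvs ->]; have [I0 ID _] := kernel_ideal.
apply: big_ind => [|u v|i _]; [exact: I0|exact: ID|exact: span_kernel (hvs i)].
Qed.

Lemma direct_spans : direct_sum W.
Proof.
move=> v hv v0 i; apply: herm_eq0.
have := herm0l (v i); rewrite -v0 herm_suml (bigD1 i) //= big1 ?addr0 // => j ji.
exact: span_orth ji (hv j) (hv i).
Qed.

(** The factor [b] makes the orthogonality stable under multiplication, as needed for the set [T] in
    [minimal_generation] to be an ideal. *)
Lemma sum_augmented u v : sum_subspaces W u -> sum_subspaces W v ->
  forall a b, herm (b * (a - (a@_0%MM)%:MP) * u) v = 0.
Proof.
move=> [us hu ->] [vs hv ->] a.
elim/mpoly_indX: a => [|f g c IHf IHg|k f _] b.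
- by rewrite mcoeff1 eqxx mpolyC1 subrr mulr0 mul0r herm0l.
- have -> : c *: f + g - ((c *: f + g)@_0%MM)%:MP =
      c *: (f - (f@_0%MM)%:MP) + (g - (g@_0%MM)%:MP) :> F.
    rewrite mcoeffD mcoeffZ mpolyCD mpolyCM mul_mpolyC scalerBr opprD addrACA //.
  by rewrite mulrDr mulrDl -scalerAr -scalerAl hermDl hermZl IHf IHg mulr0 addr0.
rewrite rmorphM /= mcoeffX mnm1_eq0 mul0r mpolyC0 subr0.
rewrite herm_sumr big1 // => j _; rewrite mulr_sumr herm_suml big1 // => i _.
by rewrite [_ * f]mulrC mulrA; exact: span_augmented (hu i) (hv j) _ _.
Qed.

(** Nakayama by orthogonality: [T] is an ideal containing [U], hence all of the kernel. So [v] in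
    the sum is u + z with z orthogonal to the sum; but z = v - u lies in the sum, and z = 0. *)
Lemma minimal_generation U : subspace U -> U `<=` sum_subspaces W ->
  smallest (@ideal K m) U = I -> U = sum_subspaces W.
Proof.
move=> hU UW UI; apply/seteqP; split=> // v Wv.
pose T := [set f : F | exists u z, [/\ U u, f = u + z &
  forall a v, sum_subspaces W v -> herm (a * z) v = 0]].
have Tv : T v.
  have : I v by exact: sum_spans_kernel.
  rewrite -UI; apply; split.
    split.
    - exists 0, 0; split; [by case: hU|by rewrite addr0|].
      by move=> a v' _; rewrite mulr0 herm0l.
    - move=> _ _ [u [z [Uu -> hz]]] [u' [z' [Uu' -> hz']]].
      exists (u + u'), (z + z'); split; [exact: subspaceD|by rewrite addrACA|].
      by move=> a v' Wv'; rewrite mulrDr hermDl hz // hz' // addr0.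
    - move=> a _ [u [z [Uu -> hz]]].
      (* Only the constant term of [a] keeps [u] inside [U]; the rest of [a] moves it into F_+ times
         the sum. *)
      exists (a@_0%MM *: u), ((a - (a@_0%MM)%:MP) * u + a * z); split.
      + exact: subspaceZ.
      + by rewrite mulrDr addrA mulrBl mul_mpolyC addrCA subrr addr0.
      + move=> b v' Wv'; rewrite mulrDr hermDl !mulrA hz // addr0.
        by apply: sum_augmented => //; exact: UW.
  move=> u Uu; exists u, 0; split; [by []|by rewrite addr0|].
  by move=> a v' _; rewrite mulr0 herm0l.
have [u [z [Uu vE hz]]] := Tv.
suff z0 : z = 0 by rewrite vE z0 addr0.
apply: herm_eq0; have := hz 1 z; rewrite mul1r; apply.
have -> : z = v - u by rewrite vE addrAC subrr add0r.
by apply: subspaceB => //; [exact: sum_subspaces_subspace span_subspace|exact: UW].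
Qed.

Theorem dihedral_relations : minimally_GL_generated I
  [tuple R222 K m; R42 K m; R62 K m; R44 K m].
Proof.
rewrite (R222E _ hm) (R42E _ hm) (R62E _ hm) (R44E _ hm).
split.
- exact: kernel_GL_ideal.
- have [h0 h1 h2 h3] := irreducible_spans K hm.
  by elim/ord4_ind.
- exact: direct_spans.
split.
- exact: sum_subspaces_subspace span_subspace.
- apply/seteqP; split; last exact: kernel_generated.
  exact: smallest_ideal_min kernel_ideal sum_spans_kernel.
- exact: minimal_generation.
Qed.

End Main.

Local Open Scope complex_scope.

Theorem theorem6p8 (R : realType) (w : R[i]) (hw : 4.-primitive_root w)
    (m : nat) (hm : (3 <= m)%N) :
  minimally_GL_generated (kernel (@phi _ w m hw))
    [tuple R222 R[i] m; R42 R[i] m; R62 R[i] m; R44 R[i] m].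
Proof. exact: dihedral_relations. Qed.
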